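(* Let $\mathfrak A$ be a commutative, separated, sequentially complete strong polymetric ring with $1\in\mathfrak A$, and let $a(z)\in\mathfrak A[z^{-1},z]^\star$ be an invertible Laurent series with rapidly decreasing coefficients (the inverse also having rapidly decreasing coefficients). Let $\mathbb H=\mathbb Z+\frac12$. Then \[\pi^+(a(z),1,w)=\widetilde{\det}\left(\mathsf U(a(z)^{-1})\,\mathsf F^{R+}(1,w)\,\mathsf U(a(z))\right)=\widetilde{\det}\left(\mathbf 1_{\mathbb Z}-w\,\mathsf U(a(z)^{-1})\mathbf 1_{\mathbb Z^-}\mathsf U(a(z))\mathsf U(z^{-1})\right),\] \[\tilde\pi(a(z),w)=\det\left(\mathsf U(a(z))\,\widetilde{\mathsf U}(a(z),1)^{-1}\right)\cdot\det\left(\mathsf U_{\mathbb H}(a(z)^{-1})(w\mathbf 1_{\mathbb H^-}+\mathbf 1_{\mathbb H^+})^{-1}\mathsf U_{\mathbb H}(a(z))(w\mathbf 1_{\mathbb H^-}+\mathbf 1_{\mathbb H^+})\right),\] \[\pi^-(a(z),1,w)=\widetilde{\det}\left(\mathsf U(a(z)^{-1})\,\mathsf F^{R-}(1,w)\,\mathsf U(a(z))\right)=\widetilde{\det}\left(\mathbf 1_{\mathbb Z}-w^{-1}\,\mathsf U(a(z)^{-1})\mathbf 1_{\mathbb Z^+}\mathsf U(a(z))\mathsf U(z)\right).\]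
   Context: **Rings and Laurent series.** A topological ring $\mathfrak A$ is a strong polymetric ring if (a) its topology is induced by a family of ''seminorms'' $p:\mathfrak A\to[0,+\infty)$ with $p(0)=0$, $p(-X)=p(X)$, $p(X+Y)\le p(X)+p(Y)$; and (b) for each seminorm $p$ there is a seminorm $\tilde p$ such that for all $n\in\mathbb N$ and all $X_1,\dots,X_n\in\mathfrak A$, $p(X_1\cdots X_n)\le\tilde p(X_1)\cdots\tilde p(X_n)$. A family of elements of $\mathfrak A$ indexed by $\mathbb Z$ (or by pairs of indices) is rapidly decreasing if for every seminorm $p$ the family of values of $p$ stays bounded when multiplied by any function of polynomial growth of the index. $\mathfrak A[z^{-1},z]$ is the algebra of Laurent series $\sum_{n\in\mathbb Z}a_nz^n$ with rapidly decreasing coefficients, with its usual topology, and ${}^\star$ denotes its unit group; $\mathfrak A[w^{-1},w]$ is the same in the variable $w$. **Matrices.** $\mathbf e_{n,m}$ denotes the elementary matrix, $\mathbf 1_S=\sum_{s\in S}\mathbf e_{s,s}$, $S^+=\{s\in S: s>0\}$, $S^-=\{s\in S:s<0\}$ for $S=\mathbb Z$ or $S=\mathbb H=\mathbb Z+\frac12$. For $a(z)=\sum a_nz^n$, $\mathsf U(a(z))=\sum_{n,m\in\mathbb Z}a_{n-m}\mathbf e_{n,m}$ and $\mathsf U_{\mathbb H}(a(z))=\sum_{n,m\in\mathbb H}a_{n-m}\mathbf e_{n,m}$. Here $w$ is a formal Laurent series variable (coefficients rapidly decreasing) and $t$ a formal power series variable. Put \[\mathsf F^{R+}(t,w)=\mathbf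 1_{\mathbb Z}-tw\,\mathbf 1_{\mathbb Z^-}\mathsf U(z^{-1}),\qquad \mathsf F^{R-}(t,w)=\mathbf 1_{\mathbb Z}-tw^{-1}\,\mathbf 1_{\mathbb Z^+}\mathsf U(z),\] \[\mathsf U^{\pm}(a(z),t,w)=\mathsf F^{R\pm}(t,w)\,\mathsf U(a(z))\,\mathsf F^{R\pm}(t,w)^{-1}\] (inverses as power series in $t$). The entries of $\mathsf U^{\pm}(z^n,t,w)$ are polynomials in $t,w,w^{-1}$, and one may substitute $t=1$ in $\mathsf U^{\pm}(a(z),t,w)=\sum_na_n\mathsf U^\pm(z^n,t,w)$; the result is $\mathsf U^{\pm}(a(z),1,w)$, a rapidly decreasing perturbation of $\mathsf U(a(z))$ (i.e. $\mathsf U(a(z))$ plus a rapidly decreasing matrix). The matrix $\widetilde{\mathsf U}(a(z),w)$ is the $\mathbb Z\times\mathbb Z$ matrix with $(n,m)$ entry - $a_{n-m}$ if $n,m>0$ or $n,m<0$; - $-w\,a_{n-m+1}$ if $n<0<m$; - $-w^{-1}a_{n-m-1}$ if $m<0<n$; - $1$ if $n=m=0$, and $0$ if exactly one of $n,m$ is $0$. It is also a rapidly decreasing perturbation of $\mathsf U(a(z))$. Inverses of $\widetilde{\mathsf U}(a(z),w)$ are taken among Toeplitz matrices over $\mathfrak A[w^{-1},w]$, i.e. matrices $\mathbf 1_{\mathbb Z^-}\mathsf U(a_{\mathrm n}(z))\mathbf 1_{\mathbb Z^-}+\mathbf 1_{\mathbb Z^+}\mathsf U(a_{\mathrm p}(z))\mathbf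 1_{\mathbb Z^+}+A$ with $a_{\mathrm n},a_{\mathrm p}$ rapidly decreasing Laurent series and $A$ a rapidly decreasing matrix. **Determinants.** If $A$ is a rapidly decreasing $S\times S$ matrix, $\det(\mathbf 1_S+A)$ is the (convergent) alternating sum, over finite permutations $\sigma$ of $S$, of the products $\prod_{s\in S}(\mathbf 1_S+A)_{s,\sigma(s)}$. For a more general $S\times S$ matrix $W$ one writes $\widetilde{\det}\,W$ for the same alternating sum over finite permutations, when it converges (in the sense that the sum of the seminorms of the terms of the corresponding permanent converges). **The quantities.** \[\tilde\pi(a(z),w)=\det\bigl(\mathsf U(a(z))\widetilde{\mathsf U}(a(z),w)^{-1}\bigr),\qquad \pi^{\pm}(a(z),1,w)=\det\bigl(\mathsf U^{\pm}(a(z),1,w)\mathsf U(a(z))^{-1}\bigr),\] where the second formula defines $\pi^+$ with all upper signs and $\pi^-$ with all lower signs. *)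

(* Defs.v *)
From HB Require Import structures.
From mathcomp Require Import all_boot all_order all_algebra.
From mathcomp Require Import perm finmap.
From mathcomp Require Import mathcomp_extra boolp classical_sets functions.
From mathcomp Require Import cardinality fsbigop reals ereal esum.
From mathcomp Require Import zify ring lra.

Set Implicit Arguments.
Unset Strict Implicit.
Unset Printing Implicit Defensive.

Import Order.TTheory GRing.Theory Num.Theory.
Local Open Scope ring_scope.
Local Open Scope classical_set_scope.

(* Seminorms in the sense of polymetric rings: no homogeneity is required. The
   topology is the one induced by the family [sn], so that it does not appear
   as a separate structure. *)
HB.mixin Record hasSeminorms (R : realType) A of GRing.ComPzRing A := {
  sn_index : Type;
  sn : sn_index -> A -> R;
  sn_ge0 : forall p x, 0 <= sn p x;
  sn0 : forall p, sn p 0 = 0;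
  snN : forall p x, sn p (- x) = sn p x;
  snD : forall p x y, sn p (x + y) <= sn p x + sn p y
}.

#[short(type="seminormedRingType")]
HB.structure Definition SeminormedRing (R : realType) :=
  {A of GRing.ComPzRing A & hasSeminorms R A}.

Arguments sn_index {R} s.
Arguments sn {R s} p x.

Section Convergence.
Context {R : realType} {A : seminormedRingType R}.

Definition cauchy_sn (u : nat -> A) :=
  forall (p : sn_index A) (e : R), 0 < e ->
  exists N : nat, forall m n : nat, (N <= m)%N -> (N <= n)%N ->
    sn p (u m - u n) < e.

Definition cvg_sn (u : nat -> A) (l : A) :=
  forall (p : sn_index A) (e : R), 0 < e ->
  exists N : nat, forall n : nat, (N <= n)%N -> sn p (u n - l) < e.

Definition has_sum {I : choiceType} (f : I -> A) (s : A) :=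
  forall (p : sn_index A) (e : R), 0 < e ->
  exists J0 : {fset I}, forall J : {fset I}, (J0 `<=` J)%fset ->
    sn p (s - \sum_(i <- J) f i) < e.

Definition has_prod {I : choiceType} (f : I -> A) (s : A) :=
  forall (p : sn_index A) (e : R), 0 < e ->
  exists J0 : {fset I}, forall J : {fset I}, (J0 `<=` J)%fset ->
    sn p (s - \prod_(i <- J) f i) < e.

Definition tsum {I : choiceType} (f : I -> A) : A := xget 0 (has_sum f).
Definition tprod {I : choiceType} (f : I -> A) : A := xget 0 (has_prod f).

Definition abs_summable {I : choiceType} (f : I -> A) :=
  forall p : sn_index A, (\esum_(i in [set: I]) (sn p (f i))%:E < +oo)%E.

(* [sz i] is the size of the index [i]; every function of polynomial growth
   is dominated by some C (1 + sz i)^k. *)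
Definition rapid {I : Type} (sz : I -> R) (f : I -> A) :=
  forall (p : sn_index A) (k : nat),
  exists C : R, forall i, sn p (f i) * (1 + sz i) ^+ k <= C.

End Convergence.

HB.mixin Record isCompleteStrongPolymetric (R : realType) A
    of SeminormedRing R A := {
  sn_strong : forall p : sn_index A, exists q : sn_index A,
    forall s : seq A, s != [::] ->
    sn p (\prod_(x <- s) x) <= \prod_(x <- s) sn q x;
  sn_separated : forall x : A, (forall p : sn_index A, sn p x = 0) -> x = 0;
  sn_complete : forall u : nat -> A, cauchy_sn u -> exists l, cvg_sn u l
}.

#[short(type="completeStrongPolymetricType")]
HB.structure Definition CompleteStrongPolymetric (R : realType) :=
  {A of SeminormedRing R A & isCompleteStrongPolymetric R A}.


Section SummationTheory.
Context {R : realType}.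

Lemma ler_sum_sub (T : eqType) (s t : seq T) (g : T -> R) :
  (forall i, 0 <= g i) -> uniq s -> {subset s <= t} ->
  \sum_(i <- s) g i <= \sum_(i <- t) g i.
Proof.
move=> g0; elim: s t => [|x s IH] t /= us st.
  by rewrite big_nil sumr_ge0.
case/andP: us => xs us.
have xt : x \in t by apply: st; rewrite inE eqxx.
rewrite big_cons (big_rem x xt) /= lerD2l; apply: IH => // y ys.
have yx : y != x by apply: contraNneq xs => <-.
have := perm_mem (perm_to_rem xt) y; rewrite inE (negPf yx) /= => <-.
by apply: st; rewrite inE ys orbT.
Qed.

Lemma sum_invsq (N : nat) : \sum_(0 <= m < N) (1 + m%:R : R) ^- 2 <= 2.
Proof.
suff H k : \sum_(0 <= m < k.+1) (1 + m%:R : R) ^- 2 <= 2 - (k.+1%:R)^-1.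
  case: N => [|N]; first by rewrite big_nil.
  by apply: (le_trans (H N)); rewrite gerBl invr_ge0 ler0n.
elim: k => [|k IH].
  by rewrite big_nat1 addr0 expr1n invr1; lra.
rewrite big_nat_recr //=; apply: (le_trans (lerD IH (lexx _))).
have -> : (1 + k.+1%:R : R) = k.+2%:R by rewrite addrC natr1.
have k1 : 0 < (k.+1%:R : R) by rewrite ltr0n.
have E : (k.+2%:R : R) = k.+1%:R + 1 by rewrite natr1.
have k2 : 0 < (k.+2%:R : R) by rewrite ltr0n.
suff : (k.+2%:R : R) ^- 2 <= (k.+1%:R)^-1 - (k.+2%:R)^-1.
  by move=> h; rewrite -addrA lerD2l addrC lerBlDr addrC.
move: k2; rewrite E; move: (k.+1%:R : R) k1 => x x0 x1.
have -> : x^-1 - (x + 1)^-1 = (x * (x + 1))^-1.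
  by field; rewrite !gt_eqF.
rewrite lef_pV2 ?posrE ?mulr_gt0 ?exprn_gt0 //.
by rewrite expr2 ler_wpM2r ?(ltW x1) // lerDl.
Qed.

Lemma esum_bounded (I : choiceType) (g : I -> R) (M : R) :
  (forall J : {fset I}, \sum_(i <- J) g i <= M) ->
  (\esum_(i in [set: I]) (g i)%:E <= M%:E)%E.
Proof.
move=> H; apply: ge_ereal_sup => _ [X [finX _] <-].
by rewrite fsbig_finite //= sumEFin lee_fin.
Qed.

Lemma sum_le_esum (I : choiceType) (g : I -> R) (J : {fset I}) :
  (forall i, 0 <= g i) ->
  ((\sum_(i <- J) g i)%:E <= \esum_(i in [set: I]) (g i)%:E)%E.
Proof.
move=> g0; apply: ereal_sup_ubound; exists [set` J].
  by split => //; exact: finite_fset.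
by rewrite fsbig_finite ?set_fsetK ?sumEFin //; exact: finite_fset.
Qed.

Lemma sum_fsetUd (I : choiceType) (V : nmodType) (f : I -> V) (J K : {fset I}) :
  [disjoint J & K]%fset ->
  \sum_(i <- (J `|` K)%fset) f i = \sum_(i <- J) f i + \sum_(i <- K) f i.
Proof.
move=> dJK; rewrite -big_cat; apply: perm_big.
apply: uniq_perm => //=; last by move=> x; rewrite in_fsetU mem_cat.
rewrite cat_uniq !fset_uniq andbT /=; apply/hasPn => x /= xK.
by apply: contraL xK => xJ; apply: (fdisjointP dJK).
Qed.

Lemma sum_fsetDS (I : choiceType) (V : nmodType) (f : I -> V) (J K : {fset I}) :
  (J `<=` K)%fset ->
  \sum_(i <- K) f i = \sum_(i <- J) f i + \sum_(i <- (K `\` J)%fset) f i.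
Proof.
move=> JK; rewrite -sum_fsetUd; last by apply/fdisjointP => x xJ; rewrite in_fsetD xJ.
congr (\sum_(i <- enum_fset _) _); apply/fsetP => x; rewrite in_fsetU in_fsetD.
by case: (boolP (x \in J)) => // /(fsubsetP JK).
Qed.

Lemma esum_tail (I : choiceType) (g : I -> R) (e : R) :
  (forall i, 0 <= g i) -> (\esum_(i in [set: I]) (g i)%:E < +oo)%E -> 0 < e ->
  exists J0 : {fset I}, forall J : {fset I}, [disjoint J0 & J]%fset ->
    \sum_(i <- J) g i < e.
Proof.
move=> g0 fin e0; set S := esum _ _ in fin.
have S0 : (0 <= S)%E by apply: esum_ge0 => i _; rewrite lee_fin.
have Sfin : S \is a fin_num by rewrite ge0_fin_numE.
have : (S - e%:E < S)%E by rewrite lteBlDr // lteDl // lte_fin.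
rewrite {2}/S => /ereal_sup_gt[_ [X [finX _] <-]].
rewrite fsbig_finite //= sumEFin => lt.
exists (fset_set X) => J dJ.
have := sum_le_esum (fset_set X `|` J)%fset g0; rewrite -/S.
rewrite sum_fsetUd // => le.
move: lt le; rewrite -(fineK Sfin) -EFinB lte_fin lee_fin; lra.
Qed.

Context {A : seminormedRingType R}.
Implicit Types (p : sn_index A) (x y s : A).

Lemma snB p x y : sn p (x - y) <= sn p x + sn p y.
Proof. by rewrite -[sn p y]snN snD. Qed.

Lemma snBC p x y : sn p (x - y) = sn p (y - x).
Proof. by rewrite -snN opprB. Qed.

Lemma sn_sum p (I : Type) (r : seq I) (f : I -> A) :
  sn p (\sum_(i <- r) f i) <= \sum_(i <- r) sn p (f i).
Proof.
elim: r => [|i r IH]; first by rewrite !big_nil sn0.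
by rewrite !big_cons (le_trans (snD _ _ _)) // lerD2l.
Qed.

Lemma has_sum_le p (I : choiceType) (f : I -> A) s (M : R) :
  has_sum f s -> (forall J : {fset I}, \sum_(i <- J) sn p (f i) <= M) ->
  sn p s <= M.
Proof.
move=> fs bM; apply/ler_addgt0Pr => e e0.
have [J0 H] := fs p e e0.
have := H J0 (fsubset_refl _) => /ltW h.
rewrite -(subrK (\sum_(i <- J0) f i) s) (le_trans (snD _ _ _)) // addrC lerD //.
by rewrite (le_trans (sn_sum _ _ _)).
Qed.

Lemma has_sum_fin (I : choiceType) (f : I -> A) (J0 : {fset I}) :
  (forall i, i \notin J0 -> f i = 0) -> has_sum f (\sum_(i <- J0) f i).
Proof.
move=> f0 p e e0; exists J0 => J J0J.
rewrite [X in _ - X](_ : _ = \sum_(i <- J0) f i) ?subrr ?sn0 //.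
rewrite (sum_fsetDS _ J0J) [X in _ + X](_ : _ = 0) ?addr0 //.
rewrite big_seq big1 // => i.
by rewrite in_fsetD => /andP[/f0].
Qed.

Lemma has_sumD (I : choiceType) (f g : I -> A) s t :
  has_sum f s -> has_sum g t -> has_sum (fun i => f i + g i) (s + t).
Proof.
move=> fs gt p e e0; have e2 : 0 < e / 2 by rewrite divr_gt0.
have [Jf Hf] := fs p _ e2; have [Jg Hg] := gt p _ e2.
exists (Jf `|` Jg)%fset => J; rewrite fsubUset => /andP[/Hf hf /Hg hg].
rewrite big_split /= opprD addrACA (le_lt_trans (snD _ _ _)) //.
by rewrite [ltRHS]splitr ltrD.
Qed.

Lemma has_sum_bij (I J : choiceType) (h : I -> J) (h' : J -> I)
    (f : J -> A) s : cancel h h' -> cancel h' h ->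
  has_sum f s -> has_sum (f \o h) s.
Proof.
move=> hK h'K fs p e e0; have [J0 H] := fs p e e0.
exists [fset h' j | j in J0]%fset => K sub.
have inj : {in K &, injective h} by move=> x y _ _; apply: (can_inj hK).
have := H [fset h i | i in K]%fset; rewrite big_imfset //=; apply.
apply/fsubsetP => j jJ0; apply/imfsetP; exists (h' j); rewrite ?h'K //=.
by apply: (fsubsetP sub); apply/imfsetP; exists j.
Qed.

Lemma eq_has_sum (I : choiceType) (f g : I -> A) s :
  f =1 g -> has_sum f s -> has_sum g s.
Proof. by move=> fg; have -> : f = g by apply/funext. Qed.

Lemma has_sum_fubini (I J : choiceType) (f : I * J -> A) (r : I -> A) s :
  has_sum f s -> (forall i, has_sum (fun j => f (i, j)) (r i)) -> has_sum r s.
Proof.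
move=> fs fr p e e0; have e2 : 0 < e / 2 by rewrite divr_gt0.
have [J0 H] := fs p _ e2.
exists [fset x.1 | x in J0]%fset => K sub.
pose d := e / 2 / (1 + (size K)%:R).
have K0 : 0 < 1 + (size K)%:R :> R by rewrite ltr_wpDr ?ler0n.
have d0 : 0 < d by rewrite divr_gt0.
have /choice[L HL] : forall i, exists Li : {fset J}, forall M : {fset J},
    (Li `<=` M)%fset -> sn p (r i - \sum_(j <- M) f (i, j)) < d.
  by move=> i; apply: (fr i p d d0).
pose M := ([fset x.2 | x in J0] `|` \bigcup_(i <- K) L i)%fset.
have LM i : i \in K -> (L i `<=` M)%fset.
  by move=> iK; rewrite fsubsetU // bigfcup_sup ?orbT.
have big : \sum_(k <- (K `*` M)%fset) f k = \sum_(i <- K) \sum_(j <- M) f (i, j).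
  rewrite -(big_allpairs (F := f)); apply: perm_big; apply: uniq_perm.
  - exact: fset_uniq.
  - by rewrite allpairs_uniq // => -[? ?] [? ?].
  - move=> [i j]; rewrite in_fsetM /=; apply/andP/allpairsP => /= [[iK jM]|].
      by exists (i, j).
    by case=> -[i' j'] /= [? ? [-> ->]].
have := H (K `*` M)%fset; rewrite big => h.
rewrite -(subrKA (\sum_(i <- K) \sum_(j <- M) f (i, j))).
rewrite (le_lt_trans (snD _ _ _)) // [ltRHS]splitr ltr_leD //.
  apply: h; apply/fsubsetP => -[i j] ij; rewrite in_fsetM /=; apply/andP; split.
    by apply: (fsubsetP sub); apply/imfsetP; exists (i, j).
  by rewrite in_fsetU; apply/orP; left; apply/imfsetP; exists (i, j).
rewrite -sumrB (le_trans (sn_sum _ _ _)) //.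
apply: (@le_trans _ _ (\sum_(i <- K) d)).
  rewrite big_seq [leRHS]big_seq; apply: ler_sum => i iK.
  by rewrite snBC ltW // HL // LM.
rewrite big_const_seq count_predT iter_addr_0 -[d *+ _]mulr_natr /d.
by rewrite mulrAC ler_pdivrMr // ler_wpM2l ?(ltW e2) // lerDr.
Qed.

End SummationTheory.

Section PolymetricTheory.
Context {R : realType} {A : completeStrongPolymetricType R}.
Implicit Types (p q : sn_index A) (x y s t : A).

Lemma sn_mul p : exists q, forall x y, sn p (x * y) <= sn q x * sn q y.
Proof.
have [q H] := sn_strong p; exists q => x y.
by have := H [:: x; y] isT; rewrite !big_cons !big_nil !mulr1.
Qed.

Lemma sn_small_eq0 x : (forall p (e : R), 0 < e -> sn p x < e) -> x = 0.
Proof.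
move=> H; apply: (@sn_separated R A) => p; apply/eqP; rewrite eq_le sn_ge0 andbT.
by apply/ler_addgt0Pr => e e0; rewrite add0r ltW // H.
Qed.

Lemma has_sum_unique (I : choiceType) (f : I -> A) s t :
  has_sum f s -> has_sum f t -> s = t.
Proof.
move=> fs ft; apply/eqP; rewrite -subr_eq0; apply/eqP; apply: sn_small_eq0 => p e e0.
have e2 : 0 < e / 2 by rewrite divr_gt0.
have [Js Hs] := fs p _ e2; have [Jt Ht] := ft p _ e2.
have := Hs _ (fsubsetUl Js Jt); have := Ht _ (fsubsetUr Js Jt).
rewrite snBC => h1 h2; rewrite -(subrKA (\sum_(i <- (Js `|` Jt)%fset) f i)).
by rewrite (le_lt_trans (snD _ _ _)) // [ltRHS]splitr ltrD.
Qed.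

Lemma tsumE (I : choiceType) (f : I -> A) s : has_sum f s -> tsum f = s.
Proof.
move=> fs; apply: (@has_sum_unique _ f) => //.
by apply: (@xgetPex _ 0 (has_sum f)); exists s.
Qed.

Lemma has_sumMr (I : choiceType) (f : I -> A) s x :
  has_sum f s -> has_sum (fun i => f i * x) (s * x).
Proof.
move=> fs p e e0; have [q Hq] := sn_mul p.
have x0 : 0 < 1 + sn q x by rewrite ltr_wpDr ?sn_ge0.
have [J0 H] := fs q (e / (1 + sn q x)) (divr_gt0 e0 x0).
exists J0 => J /H h; rewrite -mulr_suml -mulrBl (le_lt_trans (Hq _ _)) //.
apply: (@le_lt_trans _ _ (sn q (s - \sum_(i <- J) f i) * (1 + sn q x))).
  by rewrite ler_wpM2l ?sn_ge0 // lerDr.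
by rewrite -ltr_pdivlMr.
Qed.

Lemma abs_summable_has_sum (I : countType) (f : I -> A) :
  abs_summable f -> has_sum f (tsum f).
Proof.
move=> fa.
pose Jn n := [fset i | i in pmap (@choice.pickle_inv I) (iota 0 n)]%fset.
have in_Jn n i : (i \in Jn n) = (@choice.pickle I i < n)%N.
  apply/imfsetP/idP => /= [[j /= + ->]|lt].
    rewrite mem_pmap => /mapP[k]; rewrite mem_iota add0n => /= kn.
    move=> /esym/(congr1 (omap (@choice.pickle I))) /=; have := (@choice.pickle_invK I k).
    by case: (@choice.pickle_inv I k) => //= j' -> [<-].
  exists i => //=; rewrite mem_pmap; apply/mapP; exists (@choice.pickle I i).
    by rewrite mem_iota.
  by rewrite choice.pickleK_inv.
have tail p (e : R) : 0 < e -> exists N : nat, forall J : {fset I},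
    (Jn N `<=` J)%fset -> sn p (\sum_(i <- J) f i - \sum_(i <- Jn N) f i) < e.
  move=> e0; have [J0 H] := esum_tail (fun i => sn_ge0 p (f i)) (fa p) e0.
  exists (\max_(i <- J0) (@choice.pickle I i).+1)%N => J sub.
  rewrite (sum_fsetDS _ sub) addrAC subrr add0r (le_lt_trans (sn_sum _ _ _)) //.
  apply: H; apply/fdisjointP => i iJ0; rewrite in_fsetD negb_and negbK in_Jn.
  by rewrite (bigD1_seq i) //= leq_max leqnn.
have [] := @sn_complete R A (fun n => \sum_(i <- Jn n) f i).
  move=> p e e0; have e2 : 0 < e / 2 by rewrite divr_gt0.
  have [N H] := tail p _ e2; exists N => m n Nm Nn.
  have sub k : (N <= k)%N -> (Jn N `<=` Jn k)%fset.
    move=> Nk; apply/fsubsetP => i; rewrite !in_Jn => /leq_trans; exact.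
  rewrite -(subrKA (\sum_(i <- Jn N) f i)) (le_lt_trans (snD _ _ _)) //.
  by rewrite [ltRHS]splitr ltrD ?H ?sub // snBC H ?sub.
move=> s Hs; suff fs : has_sum f s by rewrite (tsumE fs).
move=> p e e0; have e2 : 0 < e / 2 by rewrite divr_gt0.
have e4 : 0 < e / 2 / 2 by rewrite divr_gt0.
have [N H] := tail p _ e4; have [N' H'] := Hs p _ e2.
exists (Jn N) => J sub; set n := maxn N N'.
have [M [MN MJ]] : exists M, (maxn N N' <= M)%N /\ (J `<=` Jn M)%fset.
  exists (maxn (maxn N N') (\max_(i <- J) (@choice.pickle I i).+1)%N); rewrite leq_maxl; split => //.
  apply/fsubsetP => i iJ; rewrite in_Jn leq_max; apply/orP; right.
  by rewrite (bigD1_seq i) //= leq_max leqnn.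
rewrite -(subrKA (\sum_(i <- Jn M) f i)) (le_lt_trans (snD _ _ _)) //.
rewrite [ltRHS]splitr ltrD //.
  by rewrite snBC H' // (leq_trans _ MN) // leq_maxr.
rewrite -(subrKA (\sum_(i <- Jn N) f i)) (le_lt_trans (snD _ _ _)) //.
rewrite [ltRHS]splitr ltrD //; last by rewrite snBC H.
by rewrite H // (fsubset_trans sub).
Qed.

End PolymetricTheory.

Definition intsz {R : realType} (n : int) : R := `|n|%N%:R.

Section RapidTheory.
Context {R : realType} {A : completeStrongPolymetricType R}.
Implicit Types (p q : sn_index A) (a b c : int -> A).

Definition weight (n : int) : R := 1 + intsz n.

Lemma weight_ge1 n : 1 <= weight n.
Proof. by rewrite lerDl ler0n. Qed.

Lemma weight_gt0 n : 0 < weight n.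
Proof. exact: lt_le_trans ltr01 (weight_ge1 n). Qed.

Lemma weight_ge0 n : 0 <= weight n. Proof. exact: ltW (weight_gt0 n). Qed.

Lemma weightD m n : weight (m + n) <= weight m * weight n.
Proof.
have le : (`|(m + n)%R| <= `|m| + `|n|)%N by lia.
have : intsz (m + n) <= intsz m + intsz n :> R by rewrite -natrD ler_nat.
have m0 : 0 <= intsz m :> R by rewrite ler0n.
have n0 : 0 <= intsz n :> R by rewrite ler0n.
rewrite /weight; nra.
Qed.

Lemma sum_weight (J : {fset int}) : \sum_(n <- J) weight n ^- 2 <= 4.
Proof.
pose N := (\max_(n <- J) `|n|.+1)%N.
have g0 n : 0 <= weight n ^- 2 by rewrite invr_ge0 exprn_ge0 ?weight_ge0.
pose t := [seq Posz m | m <- iota 0 N] ++ [seq Negz m | m <- iota 0 N].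
have sub : {subset J <= t}.
  move=> n nJ; have : (`|n| < N)%N by rewrite /N (bigD1_seq n) //= leq_max leqnn.
  rewrite /t mem_cat; case: n {nJ} => m mN; apply/orP; [left|right].
    by apply: map_f; rewrite mem_iota.
  by apply: map_f; rewrite mem_iota /= add0n; apply: ltn_trans mN.
apply: (le_trans (ler_sum_sub g0 (fset_uniq J) sub)).
rewrite big_cat !big_map /= (_ : 4 = 2 + 2); last by ring.
have S : \sum_(m <- iota 0 N) (1 + m%:R : R) ^- 2 <= 2.
  by have := @sum_invsq R N; rewrite /index_iota subn0.
apply: lerD; apply: le_trans S => //; apply: ler_sum => m _.
rewrite lef_pV2 ?posrE ?exprn_gt0 ?weight_gt0 // ?ltr_wpDr ?ler0n //.
rewrite lerXn2r ?nnegrE ?addr_ge0 ?ler0n ?weight_ge0 //.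
by rewrite lerD2l ler_nat.
Qed.

Lemma rapid_invsq a p k : rapid intsz a ->
  exists2 C : R, 0 <= C & forall n, sn p (a n) * weight n ^+ k <= C * weight n ^- 2.
Proof.
move=> /(_ p (k + 2)%N)[C HC]; exists C.
  by apply: le_trans (HC 0); rewrite mulr_ge0 ?sn_ge0 ?exprn_ge0 ?weight_ge0.
move=> n; rewrite ler_pdivlMr ?exprn_gt0 ?weight_gt0 // -mulrA -exprD.
exact: HC.
Qed.

Lemma rapid_sum_bounded a p k : rapid intsz a ->
  exists M : R, forall J : {fset int}, \sum_(n <- J) sn p (a n) * weight n ^+ k <= M.
Proof.
move=> /(rapid_invsq p k)[C C0 H]; exists (C * 4) => J.
apply: (le_trans (ler_sum _ (fun n _ => H n))).
by rewrite -mulr_sumr ler_wpM2l // sum_weight.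
Qed.

Lemma rapid_conv_bound p k : exists q, forall a b, rapid intsz a -> rapid intsz b ->
  exists2 C : R, 0 <= C & forall n i,
    sn p (a i * b (n - i)) * weight n ^+ k <= C * weight i ^- 2.
Proof.
have [q Hq] := sn_mul p; exists q => a b ra rb.
have [Ca Ca0 Ha] := rapid_invsq q k ra.
have [Cb Hb] := rb q k.
exists (Ca * Cb).
  rewrite mulr_ge0 //; apply: le_trans (Hb 0).
  by rewrite mulr_ge0 ?sn_ge0 ?exprn_ge0 ?weight_ge0.
move=> n i; set m := n - i.
have wn : weight n ^+ k <= weight i ^+ k * weight m ^+ k.
  rewrite -exprMn lerXn2r ?nnegrE ?mulr_ge0 ?weight_ge0 //.
  by rewrite (_ : n = i + m) ?weightD // addrC subrK.
apply: (@le_trans _ _ ((sn q (a i) * weight i ^+ k) * (sn q (b m) * weight m ^+ k))).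
  rewrite mulrACA; apply: ler_pM => //; rewrite ?sn_ge0 ?exprn_ge0 ?weight_ge0 //.
apply: (@le_trans _ _ ((Ca * weight i ^- 2) * Cb)); last by rewrite mulrAC.
apply: ler_pM => //; first by rewrite mulr_ge0 ?sn_ge0 ?exprn_ge0 ?weight_ge0.
  by rewrite mulr_ge0 ?sn_ge0 ?exprn_ge0 ?weight_ge0.
Qed.

Definition conv a b : int -> A := fun n => tsum (fun i => a i * b (n - i)).

Lemma conv_sum a b n : rapid intsz a -> rapid intsz b ->
  has_sum (fun i => a i * b (n - i)) (conv a b n).
Proof.
move=> ra rb; apply: abs_summable_has_sum => p.
have [_ /(_ a b ra rb)[C C0 H]] := rapid_conv_bound p 0.
apply: (@le_lt_trans _ _ (C * 4)%:E); last by rewrite ltry.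
apply: esum_bounded => J; apply: (@le_trans _ _ (\sum_(i <- J) C * weight i ^- 2)).
  by apply: ler_sum => i _; have := H n i; rewrite expr0 mulr1.
by rewrite -mulr_sumr ler_wpM2l // sum_weight.
Qed.

Lemma rapid_conv a b : rapid intsz a -> rapid intsz b -> rapid intsz (conv a b).
Proof.
move=> ra rb p k; have [_ /(_ a b ra rb)[C C0 H]] := rapid_conv_bound p k.
exists (C * 4) => n; have w0 : 0 < weight n ^+ k by rewrite exprn_gt0 ?weight_gt0.
rewrite -/(weight n) -ler_pdivlMr //.
apply: (has_sum_le (conv_sum n ra rb)) => J.
rewrite ler_pdivlMr // mulr_suml.
apply: (le_trans (ler_sum _ (fun i _ => H n i))).
by rewrite -mulr_sumr ler_wpM2l // sum_weight.
Qed.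

Lemma convC a b : rapid intsz a -> rapid intsz b -> conv a b = conv b a.
Proof.
move=> ra rb; apply/funext => n.
have inv : cancel (fun i : int => n - i) (fun i => n - i).
  by move=> i; rewrite opprB addrC subrK.
apply: (has_sum_unique (conv_sum n ra rb)).
apply: (eq_has_sum _ (has_sum_bij inv inv (conv_sum n rb ra))) => i /=.
by rewrite inv mulrC.
Qed.

Lemma convDl a b c : rapid intsz a -> rapid intsz b -> rapid intsz c ->
  conv (a + b) c = conv a c + conv b c.
Proof.
move=> ra rb rc; apply/funext => n; apply: tsumE.
apply: (eq_has_sum _ (has_sumD (conv_sum n ra rc) (conv_sum n rb rc))) => i.
by rewrite -mulrDl.
Qed.

Definition mono (x : A) (j : int) : int -> A := fun n => if n == j then x else 0.

Lemma rapid_mono (x : A) (j : int) : rapid intsz (mono x j).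
Proof.
move=> p k; exists (sn p x * weight j ^+ k) => n; rewrite /mono.
case: eqP => [->//|_]; rewrite sn0 mul0r.
by rewrite mulr_ge0 ?sn_ge0 ?exprn_ge0 ?weight_ge0.
Qed.

Lemma conv1l a : conv (mono 1 0) a = a.
Proof.
apply/funext => n; apply: tsumE.
have := @has_sum_fin R A int (fun i => mono 1 0 i * a (n - i)) [fset 0]%fset.
rewrite big_seq_fset1 /mono eqxx mul1r subr0; apply=> i.
by rewrite in_fset1 => /negPf->; rewrite mul0r.
Qed.

Lemma convA a b c : rapid intsz a -> rapid intsz b -> rapid intsz c ->
  conv a (conv b c) = conv (conv a b) c.
Proof.
move=> ra rb rc; apply/funext => n.
pose f (x : int * int) := a x.1 * (b (x.2 - x.1) * c (n - x.2)).
have fa : abs_summable f.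
  move=> p; have [q Hq] := sn_mul p; have [q' Hq'] := sn_mul q.
  have [Ca Ca0 Ha] := rapid_invsq q 0 ra.
  have [Cb Cb0 Hb] := rapid_invsq q' 0 rb.
  have [Cc Hc] := rc q' 0%N.
  pose g i := weight i ^- 2.
  have g0 i : 0 <= g i by rewrite invr_ge0 exprn_ge0 ?weight_ge0.
  have Cc0 : 0 <= Cc.
    by apply: le_trans (Hc 0); rewrite expr0 mulr1 sn_ge0.
  pose C := Ca * (Cb * Cc).
  have C0 : 0 <= C by rewrite !mulr_ge0.
  have Hf x : sn p (f x) <= C * (g x.1 * g (x.2 - x.1)).
    apply: (le_trans (Hq _ _)).
    have := Ha x.1; rewrite expr0 mulr1 => ha.
    have := Hb (x.2 - x.1); rewrite expr0 mulr1 => hb.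
    have := Hc (n - x.2); rewrite expr0 mulr1 => hc.
    apply: (@le_trans _ _ ((Ca * g x.1) * (Cb * g (x.2 - x.1) * Cc))).
      apply: ler_pM => //; rewrite ?sn_ge0 //.
      by apply: (le_trans (Hq' _ _)); apply: ler_pM; rewrite ?sn_ge0.
    by rewrite (_ : _ * _ = C * (g x.1 * g (x.2 - x.1))) // /C; ring.
  apply: (@le_lt_trans _ _ (C * (4 * 4))%:E); last by rewrite ltry.
  apply: esum_bounded => J; apply: (le_trans (ler_sum _ (fun x _ => Hf x))).
  rewrite -mulr_sumr ler_wpM2l //.
  pose J1 := [fset x.1 | x in J]%fset; pose J2 := [fset x.2 - x.1 | x in J]%fset.
  apply: (@le_trans _ _ (\sum_(x <- [seq (i, i + j) | i <- J1, j <- J2])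
                           (g x.1 * g (x.2 - x.1)))).
    apply: ler_sum_sub => [x||]; [by rewrite mulr_ge0|exact: fset_uniq|].
    move=> [i j] ij; apply/allpairsP; exists (i, j - i) => /=.
    split; first by apply/imfsetP; exists (i, j).
      by apply/imfsetP; exists (i, j).
    by rewrite addrC subrK.
  rewrite big_allpairs_dep /=.
  under eq_bigr => i _ do under eq_bigr => j _ do rewrite addrAC subrr add0r.
  under eq_bigr => i _ do rewrite -mulr_sumr.
  rewrite -mulr_suml; apply: ler_pM; rewrite ?sumr_ge0 // ?sum_weight //.
have sf := abs_summable_has_sum fa.
have E1 : conv a (conv b c) n = tsum f.
  apply: (has_sum_unique (conv_sum n ra (rapid_conv rb rc))).
  apply: (has_sum_fubini sf) => i; rewrite [X in has_sum _ X]mulrC.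
  have h1 : cancel (fun j : int => j - i) (fun j => j + i) by move=> j; rewrite subrK.
  have h2 : cancel (fun j : int => j + i) (fun j => j - i) by move=> j; rewrite addrK.
  have := has_sumMr (a i) (has_sum_bij h1 h2 (conv_sum (n - i) rb rc)).
  apply: eq_has_sum => j /=; rewrite /f /= mulrC; congr (_ * (_ * c _)).
  by ring.
rewrite E1; apply/esym.
apply: (has_sum_unique (conv_sum n (rapid_conv ra rb) rc)).
pose sw (x : int * int) := (x.2, x.1).
have swK : cancel sw sw by case.
apply: (has_sum_fubini (has_sum_bij swK swK sf)) => j.
have := has_sumMr (c (n - j)) (conv_sum j ra rb).
by apply: eq_has_sum => i; rewrite /f /= mulrA.
Qed.

Lemma rapid0 : rapid intsz (0 : int -> A).
Proof. by move=> p k; exists 0 => n; rewrite sn0 mul0r. Qed.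

Lemma rapidN a : rapid intsz a -> rapid intsz (- a).
Proof. by move=> ra p k; have [C H] := ra p k; exists C => n; rewrite snN. Qed.

Lemma rapidD a b : rapid intsz a -> rapid intsz b -> rapid intsz (a + b).
Proof.
move=> ra rb p k; have [C H] := ra p k; have [D K] := rb p k.
exists (C + D) => n; apply: le_trans (lerD (H n) (K n)).
by rewrite -mulrDl ler_wpM2r ?snD // exprn_ge0 ?weight_ge0.
Qed.

End RapidTheory.

Section LaurentSeries.
Context {R : realType} {A : completeStrongPolymetricType R}.

Definition rapid_seq : {pred int -> A} := fun a => `[< rapid intsz a >].

Lemma rapid_seqP a : reflect (rapid intsz a) (a \in rapid_seq).
Proof. exact: asboolP. Qed.

Lemma rapid_seq_zmod : zmod_closed rapid_seq.
Proof.
split; first exact/rapid_seqP/rapid0.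
move=> a b /rapid_seqP ra /rapid_seqP rb; apply/rapid_seqP.
exact/(rapidD ra)/rapidN.
Qed.

HB.instance Definition _ := GRing.isZmodClosed.Build (int -> A) rapid_seq rapid_seq_zmod.

Record laurent := Laurent { lcoef :> int -> A; _ : lcoef \in rapid_seq }.

HB.instance Definition _ := [isSub for lcoef].
HB.instance Definition _ := [Choice of laurent by <:].
HB.instance Definition _ := [SubChoice_isSubZmodule of laurent by <:].

Implicit Types a b c : laurent.

Lemma lcoef_rapid a : rapid intsz a.
Proof. by apply/rapid_seqP; case: a. Qed.

Definition lmul a b : laurent :=
  Laurent (introT (rapid_seqP _) (rapid_conv (lcoef_rapid a) (lcoef_rapid b))).

(* the monomial x z^j *)
Definition lmono (x : A) (j : int) : laurent :=
  Laurent (introT (rapid_seqP _) (rapid_mono x j)).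

Lemma lmulA : associative lmul.
Proof. by move=> a b c; apply: val_inj; apply: convA; apply: lcoef_rapid. Qed.

Lemma lmulC : commutative lmul.
Proof. by move=> a b; apply: val_inj; apply: convC; apply: lcoef_rapid. Qed.

Lemma lmul1l : left_id (lmono 1 0) lmul.
Proof. by move=> a; apply: val_inj; apply: conv1l. Qed.

Lemma lmulDl : left_distributive lmul +%R.
Proof. by move=> a b c; apply: val_inj; apply: convDl; apply: lcoef_rapid. Qed.

HB.instance Definition _ :=
  GRing.Zmodule_isComPzRing.Build laurent lmulA lmulC lmul1l lmulDl.

(* The seminorms sum_n p(a_n) (1 + |n|)^k; they induce the same topology as the
   suprema of p(a_n) (1 + |n|)^k, and they are submultiplicative. *)
Definition lsn (pk : sn_index A * nat) a : R :=
  fine (\esum_(n in [set: int]) (sn pk.1 (a n) * (1 + intsz n) ^+ pk.2)%:E).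

Let lsn_term_ge0 p k a (n : int) : 0 <= sn p (a n) * (1 + intsz n) ^+ k.
Proof. by rewrite mulr_ge0 ?sn_ge0 ?exprn_ge0 ?weight_ge0. Qed.

Lemma lsn_fin p k a :
  (\esum_(n in [set: int]) (sn p (a n) * (1 + intsz n) ^+ k)%:E)%E \is a fin_num.
Proof.
rewrite ge0_fin_numE; last by apply: esum_ge0 => n _; rewrite lee_fin lsn_term_ge0.
have [M HM] := rapid_sum_bounded p k (lcoef_rapid a).
by apply: (@le_lt_trans _ _ M%:E); [exact: esum_bounded|rewrite ltry].
Qed.

Lemma lsn_ge0 pk a : 0 <= lsn pk a.
Proof. by apply/fine_ge0/esum_ge0 => n _; rewrite lee_fin lsn_term_ge0. Qed.

Lemma lsn0 pk : lsn pk 0 = 0.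
Proof. by rewrite /lsn esum1 // => n _; rewrite sn0 mul0r. Qed.

Lemma lsnN pk a : lsn pk (- a) = lsn pk a.
Proof. by congr fine; apply: eq_esum => n _; rewrite snN. Qed.

Lemma lsnD pk a b : lsn pk (a + b) <= lsn pk a + lsn pk b.
Proof.
rewrite -fineD ?lsn_fin // fine_le ?fin_numD ?lsn_fin //.
rewrite -esumD; try by move=> n _; rewrite lee_fin lsn_term_ge0.
apply: le_esum => n _; rewrite -EFinD lee_fin -mulrDl.
by rewrite ler_wpM2r ?snD // exprn_ge0 ?weight_ge0.
Qed.

HB.instance Definition _ :=
  hasSeminorms.Build R laurent lsn_ge0 lsn0 lsnN lsnD.

End LaurentSeries.

Arguments laurent {R} A.

(* [Half k] is the half-integer k + 1/2 *)
Record half := Half { hfloor : int }.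

Lemma hfloorK : cancel hfloor Half. Proof. by case. Qed.

HB.instance Definition _ := Choice.copy half (can_type hfloorK).

Definition halfval (h : half) : rat := (hfloor h)%:~R + 2^-1.

Definition halfsz {R : realType} (h : half) : R := ratr `|halfval h|.

Section FinitePermutations.
Context {S : choiceType}.

(* Injectivity suffices, the support of an [fsfun] being finite. *)
Definition finperm := {s : {fsfun S -> S} | fsinjectiveb s}.

Lemma finperm_supp (s : finperm) (x : finsupp (val s)) :
  val s (val x) \in finsupp (val s).
Proof.
by rewrite mem_finsupp (inj_eq (elimT fsinjectiveP (valP s))) -mem_finsupp fsvalP.
Qed.

Definition finperm_res (s : finperm) (x : finsupp (val s)) : finsupp (val s) :=
  [` finperm_supp x]%fset.

Lemma finperm_res_inj (s : finperm) : injective (@finperm_res s).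
Proof.
move=> x y /(congr1 val) /= /(elimT fsinjectiveP (valP s)); exact: val_inj.
Qed.

Definition odd_finperm (s : finperm) : bool := perm (@finperm_res_inj s).

End FinitePermutations.

Arguments finperm : clear implicits.

Section Matrices.
Context {R : realType} {B : seminormedRingType R} {S : choiceType}.
Implicit Types (X Y W : S -> S -> B) (sz : S -> R).

Definition immul X Y : S -> S -> B := fun n m => tsum (fun k => X n k * Y k m).

Definition imscale (x : B) X : S -> S -> B := fun n m => x * X n m.

Definition imone : S -> S -> B := fun n m => (n == m)%:R.

(* the matrix 1_P *)
Definition imind (P : pred S) : S -> S -> B := fun n m => ((n == m) && P n)%:R.

Definition im_rapid sz X :=
  rapid (fun x : S * S => sz x.1 + sz x.2) (fun x => X x.1 x.2).

Definition inverse_in (T : set (S -> S -> B)) X Y :=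
  [/\ T Y, immul X Y = imone & immul Y X = imone].

Definition iminv (T : set (S -> S -> B)) X : S -> S -> B :=
  xget 0 (inverse_in T X).

Definition tdet_term W (s : finperm S) : B := tprod (fun n => W n (val s n)).

(* tdet is \widetilde{det}; it is det on perturbations of 1 (see [det_defined]). *)
Definition tdet W : B := tsum (fun s => (-1) ^+ odd_finperm s * tdet_term W s).

Definition tdet_cvg W :=
  (forall s : finperm S, exists x, has_prod (fun n => W n (val s n)) x) /\
  abs_summable (tdet_term W).

(* W = 1 + a rapidly decreasing matrix, so that [tdet W] is det W *)
Definition det_defined sz W := im_rapid sz (W - imone) /\ tdet_cvg W.

(* A power series in t with matrix coefficients is a function on nat. *)
Implicit Types F G : nat -> S -> S -> B.

Definition psconst X : nat -> S -> S -> B := fun k => if k is 0%N then X else 0.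

(* X + t Y *)
Definition pslin X Y : nat -> S -> S -> B :=
  fun k => match k with 0 => X | 1 => Y | _ => 0 end.

Definition psmul F G : nat -> S -> S -> B :=
  fun k => \sum_(i < k.+1) immul (F i) (G (k - i)%N).

Definition psinv F : nat -> S -> S -> B :=
  xget 0 [set G | psmul F G = psconst imone /\ psmul G F = psconst imone].

(* Substitution of t = 1 in entries that are polynomials in t: the sum below is
   over the k where the coefficient is nonzero. *)
Definition at1 F : S -> S -> B := fun n m => \sum_(k \in [set: nat]) F k n m.

End Matrices.

Notation "X ** Y" := (immul X Y) (at level 40, left associativity) : ring_scope.

Section Toeplitz.
Context {R : realType} {B : seminormedRingType R}.

Definition Zneg : pred int := fun n => n < 0.
Definition Zpos : pred int := fun n => 0 < n.

Definition laurent_mx (c : int -> B) : int -> int -> B := fun n m => c (n - m).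

Definition toeplitz (X : int -> int -> B) :=
  exists (an ap : int -> B) (Z : int -> int -> B),
  [/\ rapid intsz an, rapid intsz ap, im_rapid intsz Z &
      X = imind Zneg ** laurent_mx an ** imind Zneg +
          imind Zpos ** laurent_mx ap ** imind Zpos + Z].

Definition tinv (X : int -> int -> B) := iminv toeplitz X.

Definition toeplitz_invertible (X : int -> int -> B) :=
  exists Y, inverse_in toeplitz X Y.

End Toeplitz.

(* All matrices below have their entries in A[w^-1, w] = [laurent A], in which
   A is embedded by constant series. The monomial [lX j] stands both for z^j, as
   an argument of [U], and for the scalar w^j. *)
Section Loops.
Context {R : realType} {A : completeStrongPolymetricType R}.
Implicit Types a : laurent A.

Definition lconst (x : A) : laurent A := lmono x 0.
Definition lX (j : int) : laurent A := lmono 1 j.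

Definition U a : int -> int -> laurent A := laurent_mx (fun n => lconst (a n)).

Definition Hneg : pred half := fun h => halfval h < 0.
Definition Hpos : pred half := fun h => 0 < halfval h.

(* The difference of two half-integers is the difference of their floors. *)
Definition UH a : half -> half -> laurent A :=
  fun n m => lconst (a (hfloor n - hfloor m)).

Definition FRp : nat -> int -> int -> laurent A :=
  pslin imone (- imscale (lX 1) (imind Zneg ** U (lX (-1)))).

Definition FRm : nat -> int -> int -> laurent A :=
  pslin imone (- imscale (lX (-1)) (imind Zpos ** U (lX 1))).

(* F U(a) F^-1 at t = 1, as the sum of the a_j (F U(z^j) F^-1)(1) *)
Definition Uconj (F : nat -> int -> int -> laurent A) a :
    int -> int -> laurent A :=
  fun n m => tsum (fun j : int =>
    lconst (a j) * at1 (psmul (psmul F (psconst (U (lX j)))) (psinv F)) n m).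

(* [winv] is the inverse of [w]. *)
Definition Utilde a (w winv : laurent A) : int -> int -> laurent A := fun n m =>
  if ((0 < n) && (0 < m)) || ((n < 0) && (m < 0)) then lconst (a (n - m))
  else if (n < 0) && (0 < m) then - (w * lconst (a (n - m + 1)))
  else if (m < 0) && (0 < n) then - (winv * lconst (a (n - m - 1)))
  else (n == m)%:R.

(* w 1_{H^-} + 1_{H^+}, with w = [lX 1] *)
Definition DH : half -> half -> laurent A :=
  imscale (lX 1) (imind Hneg) + imind Hpos.

Definition pi_plus_mx a := Uconj FRp a ** tinv (U a).
Definition pi_minus_mx a := Uconj FRm a ** tinv (U a).
Definition pi_tilde_mx a := U a ** tinv (Utilde a (lX 1) (lX (-1))).

Definition pi_plus a : laurent A := tdet (pi_plus_mx a).
Definition pi_minus a : laurent A := tdet (pi_minus_mx a).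
Definition pi_tilde a : laurent A := tdet (pi_tilde_mx a).

End Loops.

(* Main.v *)
Require Import Defs.
From HB Require Import structures.
From mathcomp Require Import all_boot all_order all_algebra.
From mathcomp Require Import perm finmap.
From mathcomp Require Import boolp classical_sets functions.
From mathcomp Require Import fsbigop reals ereal esum sequences exp.
From mathcomp Require Import zify ring lra.

(** Every determinant below is a limit of determinants of finite blocks. Consider
    T + X, where X decreases rapidly and T is the identity or, more generally, a
    bidiagonal matrix with diagonal entries 1 and entries 0 or -1 beside the
    diagonal. In the products of the entries (n, s n) of T + X, let I be the set
    of rows in which the entry of X is chosen. A finite permutation s all of whose
    entries outside the rows of I are nonzero entries of T is determined by its
    restriction to I ([steps_off_unique]). Hence the seminorms of all terms add up
    to at most the product over the rows n of 1 plus the sum of the seminorms of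
    the entries of X in row n ([sum_majorant]). The expansion is therefore
    absolutely convergent, and by dominated convergence X may be replaced by
    approximations while T + X is cut down to finite blocks ([fdet_cvg]). In this
    way finite determinants yield the rules det ((1 + X) (1 + Y)) =
    det (1 + X) det (1 + Y), det (1 + X Y) = det (1 + Y X) and
    det ((1 + X) T) = det (1 + X) ([det_mul], [det_sylvester], [tdet_mul_bidiag]).
    The entries - w of F become - 1 after multiplication of the (n, m) entry by
    w^(n - m), which changes no term of a determinant ([tdet_twist]).

    Write b for the inverse of a, so that U(b) is the inverse of U(a). The matrix
    V = F U(a) F^-1 at t = 1 is a rapidly decreasing perturbation of U(a) with
    V F = F U(a). Thus U(b) F U(a) = (U(b) V) F has the determinant of U(b) V,
    which is that of V U(b) ([pi_direction]).

    When the nonzero integers are identified with the half-integers, U~(a, w)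
    becomes E U_H(a) E^-1, where E is diagonal with entries - w at negative and 1
    at positive indices ([dUt_dK]). So the inverse of U~(a, w) is U~(b, w), and
    U(a) U~(b, w) is the product of U(a) U~(b, 1) and U~(a, 1) U~(b, w). The last
    matrix is conjugate to U_H(b) D^-1 U_H(a) D with D = w 1_{H^-} + 1_{H^+}
    ([pi_tilde_factor]). *)

Set Implicit Arguments.
Unset Strict Implicit.
Unset Printing Implicit Defensive.

Import Order.TTheory GRing.Theory Num.Theory.
Local Open Scope ring_scope.
Local Open Scope classical_set_scope.

(** * Unordered sums and products *)

Section Summation.
Context {R : realType} {B : completeStrongPolymetricType R}.
Implicit Types (p q : sn_index B) (x y z : B).

Lemma cvg_sn_unique (u : nat -> B) x y : cvg_sn u x -> cvg_sn u y -> x = y.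
Proof.
move=> ux uy; apply/eqP; rewrite -subr_eq0; apply/eqP/sn_small_eq0 => p e e0.
have e2 : 0 < e / 2 by rewrite divr_gt0.
have [N1 H1] := ux p _ e2; have [N2 H2] := uy p _ e2.
have := H1 _ (leq_maxl N1 N2); have := H2 _ (leq_maxr N1 N2).
rewrite snBC => h2; rewrite snBC => h1.
rewrite -(subrKA (u (maxn N1 N2))) (le_lt_trans (snD _ _ _)) //.
by rewrite [ltRHS]splitr ltrD // snBC.
Qed.

Lemma cvg_sn_cst x : cvg_sn (fun=> x) x.
Proof. by move=> p e e0; exists 0%N => n _; rewrite subrr sn0. Qed.

Lemma eq_cvg_sn (u v : nat -> B) x : u =1 v -> cvg_sn u x -> cvg_sn v x.
Proof. by move=> /funext ->. Qed.

Lemma cvg_snD (u v : nat -> B) x y :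
  cvg_sn u x -> cvg_sn v y -> cvg_sn (fun n => u n + v n) (x + y).
Proof.
move=> ux vy p e e0; have e2 : 0 < e / 2 by rewrite divr_gt0.
have [N1 H1] := ux p _ e2; have [N2 H2] := vy p _ e2.
exists (maxn N1 N2) => n; rewrite geq_max => /andP[/H1 h1 /H2 h2].
by rewrite opprD addrACA (le_lt_trans (snD _ _ _)) // [ltRHS]splitr ltrD.
Qed.

Lemma cvg_snM (u v : nat -> B) x y :
  cvg_sn u x -> cvg_sn v y -> cvg_sn (fun n => u n * v n) (x * y).
Proof.
move=> ux vy p e e0; have [q Hq] := sn_mul p.
have e2 : 0 < e / 2 by rewrite divr_gt0.
pose X := 1 + sn q x; pose Y := 1 + sn q y.
have X0 : 0 < X by rewrite ltr_pwDl ?sn_ge0.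
have Y0 : 0 < Y by rewrite ltr_pwDl ?sn_ge0.
have [N1 H1] := ux q _ (divr_gt0 e2 Y0).
have [N2 H2] := vy q _ (divr_gt0 e2 X0).
have [N3 H3] := vy q 1 ltr01.
exists (maxn N1 (maxn N2 N3)) => n; rewrite !geq_max => /and3P[/H1 h1 /H2 h2 /H3 h3].
have -> : u n * v n - x * y = (u n - x) * v n + x * (v n - y) by ring.
rewrite (le_lt_trans (snD _ _ _)) // [ltRHS]splitr ltrD //.
  apply: (le_lt_trans (Hq _ _)); apply: (@le_lt_trans _ _ (sn q (u n - x) * Y)).
    rewrite ler_wpM2l ?sn_ge0 // -(subrK y (v n)).
    by rewrite (le_trans (snD _ _ _)) // lerD2r ltW.
  by rewrite -ltr_pdivlMr.
apply: (le_lt_trans (Hq _ _)); apply: (@le_lt_trans _ _ (X * sn q (v n - y))).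
  by rewrite ler_wpM2r ?sn_ge0 // lerDr.
by rewrite mulrC -ltr_pdivlMr.
Qed.

Lemma cvg_sn_prod (I : Type) (r : seq I) (u : I -> nat -> B) (x : I -> B) :
  (forall i, cvg_sn (u i) (x i)) ->
  cvg_sn (fun n => \prod_(i <- r) u i n) (\prod_(i <- r) x i).
Proof.
move=> ux; elim: r => [|i r IH].
  by rewrite big_nil; apply: eq_cvg_sn (cvg_sn_cst 1) => n; rewrite big_nil.
by rewrite big_cons; apply: eq_cvg_sn (cvg_snM (ux i) IH) => n; rewrite big_cons.
Qed.

Lemma abs_summable_le (I : choiceType) (f : I -> B) :
  (forall p, exists M : R, forall J : {fset I}, \sum_(i <- J) sn p (f i) <= M) ->
  abs_summable f.
Proof.
move=> H p; have [M HM] := H p; apply: (@le_lt_trans _ _ M%:E); rewrite ?ltry //.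
exact: esum_bounded.
Qed.

Lemma abs_summable_bounded (I : choiceType) (f : I -> B) : abs_summable f ->
  forall p, exists M : R, forall J : {fset I}, \sum_(i <- J) sn p (f i) <= M.
Proof.
move=> H p; have := H p; set S := esum _ _ => Slt.
have S0 : (0 <= S)%E by apply: esum_ge0 => i _; rewrite lee_fin sn_ge0.
have Sfin : S \is a fin_num by rewrite ge0_fin_numE.
exists (fine S) => J; rewrite -lee_fin fineK //.
by apply: sum_le_esum => i; exact: sn_ge0.
Qed.

Lemma has_sum_fin_cvg (I : choiceType) (f : I -> B) x (K : nat -> {fset I}) :
  (forall i, exists N, forall n, (N <= n)%N -> i \in K n) ->
  has_sum f x -> cvg_sn (fun n => \sum_(i <- K n) f i) x.
Proof.
move=> HK fx p e e0; have [J0 H] := fx p e e0.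
have /choice[N HN] := HK; exists (\max_(i <- J0) N i)%N => n Hn.
rewrite snBC; apply: H; apply/fsubsetP => i iJ; apply: HN.
by rewrite (leq_trans _ Hn) // (bigD1_seq i) //= leq_maxl.
Qed.

(** Dominated convergence, for summands and finite ranges of summation that vary
    simultaneously: outside a large finite set of indices, the majorant makes
    all the sums small at once. *)
Lemma has_sum_dominated (I : choiceType) (F : nat -> I -> B) (f : I -> B) x
    (K : nat -> {fset I}) :
  (forall i, exists N, forall n, (N <= n)%N -> i \in K n) ->
  (forall i, cvg_sn (F^~ i) (f i)) ->
  (forall p, exists g : I -> R, exists M : R,
     (forall n i, sn p (F n i) <= g i) /\
     (forall J : {fset I}, \sum_(i <- J) g i <= M)) ->
  has_sum f x -> cvg_sn (fun n => \sum_(i <- K n) F n i) x.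
Proof.
move=> HK Ff dom fx p e e0.
have [g [M [Hg HM]]] := dom p.
have e3 : 0 < e / 3 by rewrite divr_gt0.
have g0 i : 0 <= g i by apply: le_trans (Hg 0%N i); exact: sn_ge0.
have gfin : (\esum_(i in [set: I]) (g i)%:E < +oo)%E.
  by apply: (@le_lt_trans _ _ M%:E); rewrite ?ltry //; exact: esum_bounded.
have [J1 H1] := esum_tail g0 gfin e3.
have [J2 H2] := fx p _ e3.
pose J := (J1 `|` J2)%fset.
have cJ : cvg_sn (fun n => \sum_(i <- J) F n i) (\sum_(i <- J) f i).
  elim: (enum_fset J) => [|i r IH].
    by rewrite big_nil; apply: eq_cvg_sn (cvg_sn_cst 0) => n; rewrite big_nil.
  by rewrite big_cons; apply: eq_cvg_sn (cvg_snD (Ff i) IH) => n; rewrite big_cons.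
have [N1 HN1] := cJ p _ e3.
have /choice[N HN] := HK.
exists (maxn N1 (\max_(i <- J) N i)%N) => n; rewrite geq_max => /andP[n1 n2].
have sub : (J `<=` K n)%fset.
  apply/fsubsetP => i iJ; apply: HN.
  by rewrite (leq_trans _ n2) // (bigD1_seq i) //= leq_maxl.
rewrite (sum_fsetDS _ sub).
have split3 (u v w d : B) : u + v - w = (u - d) + v + (d - w) by ring.
rewrite (split3 _ _ _ (\sum_(i <- J) f i)).
rewrite (_ : e = e / 3 + e / 3 + e / 3); last by field.
apply: (le_lt_trans (snD _ _ _)); apply: ltrD; last first.
  by rewrite snBC; apply: (H2 J); rewrite fsubsetUr.
apply: (le_lt_trans (snD _ _ _)); apply: ltrD; first exact: HN1.
apply: (le_lt_trans (sn_sum _ _ _)).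
apply: (@le_lt_trans _ _ (\sum_(i <- (K n `\` J)%fset) g i)); first exact: ler_sum.
apply: H1; apply/fdisjointP => i iJ1; rewrite in_fsetD negb_and negbK.
by rewrite in_fsetU iJ1.
Qed.

Lemma big_fset_inj (I J : choiceType) (V : Type) (idx : V)
    (op : Monoid.com_law idx) (h : I -> J) (f : J -> V) (L : {fset I}) :
  injective h ->
  \big[op/idx]_(j <- [fset h i | i in L]%fset) f j = \big[op/idx]_(i <- L) f (h i).
Proof. by move=> hI; rewrite big_imfset //= => x y _ _; exact: hI. Qed.

(** Convergence of a net of finite sums or products passes to a reindexing by
    [h], because large sets on the side of [J] may be chosen to consist of an
    image under [h] and of indices with neutral terms. *)
Lemma big_fset_preim (I J : choiceType) (V : Type) (idx : V)
    (op : Monoid.com_law idx) (h : I -> J) (f : J -> V) :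
  injective h -> (forall j, (forall i, j <> h i) -> f j = idx) ->
  forall J0 : {fset J}, exists I0 : {fset I}, forall L : {fset I},
    (I0 `<=` L)%fset -> exists2 L' : {fset J}, (J0 `<=` L')%fset &
      \big[op/idx]_(j <- L') f j = \big[op/idx]_(i <- L) f (h i).
Proof.
move=> hI hf J0.
have /choice[g Hg] : forall j : J, exists o : option I,
    if o is Some i then j = h i else forall i, j <> h i.
  move=> j; have [[i ->]|nj] := pselect (exists i, j = h i); first by exists (Some i).
  by exists None => i ji; apply: nj; exists i.
have gh i : g (h i) = Some i.
  by have := Hg (h i); case: (g _) => [k /hI ->//|/(_ i)].
exists [fset i | i in pmap g (enum_fset J0)]%fset => L sub.
exists (J0 `|` [fset h i | i in L])%fset; first exact: fsubsetUl.
rewrite -(big_fset_inj op f L hI) [RHS]big_seq.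
rewrite [LHS](bigID (fun j => j \in [fset h i | i in L]%fset)) /=.
rewrite [X in op _ X]big1_seq ?Monoid.mulm1; last first.
  move=> j /andP[jn]. rewrite in_fsetU (negPf jn) orbF => jJ0.
  apply: hf => i ji; case/negP: jn; rewrite ji; apply/imfsetP; exists i => //=.
  apply: (fsubsetP sub); apply/imfsetP; exists i => //=.
  by rewrite mem_pmap -gh -ji map_f.
rewrite -big_filter -[RHS]big_filter; apply: perm_big; apply: uniq_perm.
- by rewrite filter_uniq ?fset_uniq.
- by rewrite filter_uniq ?fset_uniq.
move=> j; rewrite !mem_filter in_fsetU.
by case: (j \in [fset _ | _ in L]%fset); rewrite ?orbT.
Qed.

Lemma has_sum_inj (I J : choiceType) (h : I -> J) (f : J -> B) x :
  injective h -> (forall j, (forall i, j <> h i) -> f j = 0) ->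
  has_sum f x -> has_sum (f \o h) x.
Proof.
move=> hI hf fx p e e0; have [J0 H] := fx p e e0.
have [I0 HI] := big_fset_preim +%R hI hf J0.
by exists I0 => L /HI[L' /H + <-].
Qed.

Lemma has_prod_inj (I J : choiceType) (h : I -> J) (f : J -> B) x :
  injective h -> (forall j, (forall i, j <> h i) -> f j = 1) ->
  has_prod f x -> has_prod (f \o h) x.
Proof.
move=> hI hf fx p e e0; have [J0 H] := fx p e e0.
have [I0 HI] := big_fset_preim *%R hI hf J0.
by exists I0 => L /HI[L' /H + <-].
Qed.

Lemma has_prod_unique (I : choiceType) (f : I -> B) x y :
  has_prod f x -> has_prod f y -> x = y.
Proof.
move=> fx fy; apply/eqP; rewrite -subr_eq0; apply/eqP; apply: sn_small_eq0 => p e e0.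
have e2 : 0 < e / 2 by rewrite divr_gt0.
have [J1 H1] := fx p _ e2; have [J2 H2] := fy p _ e2.
have := H1 _ (fsubsetUl J1 J2); have := H2 _ (fsubsetUr J1 J2).
rewrite snBC => h1 h2; rewrite -(subrKA (\prod_(i <- (J1 `|` J2)%fset) f i)).
by rewrite (le_lt_trans (snD _ _ _)) // [ltRHS]splitr ltrD.
Qed.

Lemma tprodE (I : choiceType) (f : I -> B) x : has_prod f x -> tprod f = x.
Proof.
move=> fx; apply: (@has_prod_unique _ f) => //.
by apply: (@xgetPex _ 0 (has_prod f)); exists x.
Qed.

End Summation.

(** * Transporting permutations along injections *)

Section PushPermutations.

(** The two permutations are products of the same number of transpositions. *)
Lemma odd_perm_extend (T T' : finType) (h : T -> T') (s : {perm T}) (s' : {perm T'}) :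
  injective h -> (forall x, s' (h x) = h (s x)) ->
  (forall y, (forall x, y <> h x) -> s' y = y) -> odd_perm s' = odd_perm s.
Proof.
move=> hI hs hf; case: (prod_tpermP s) hs => ts -> dts hs.
pose ts' := [seq (h t.1, h t.2) | t <- ts].
have dts' : all dpair ts'.
  rewrite all_map; apply: sub_all dts => -[x y] /=.
  by rewrite /dpair /= (inj_eq hI).
suff -> : s' = (\prod_(t <- ts') tperm t.1 t.2)%g.
  by rewrite !odd_perm_prod // size_map.
apply/permP => y; rewrite /ts' big_map.
have [[x ->]|ny] := pselect (exists x, y = h x); last first.
  rewrite hf; last by move=> x yx; apply: ny; exists x.
  elim: (ts) => [|t r IH]; first by rewrite big_nil perm1.
  rewrite big_cons permM tpermD -?IH //;
    by apply/eqP => E; apply: ny; eexists; rewrite -E.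
rewrite hs {hs dts dts' ts'}; elim: ts x => [|t r IH] x; first by rewrite !big_nil !perm1.
by rewrite !big_cons !permM IH (inj_tperm _ _ _ hI).
Qed.

Context {T : finType} {S : choiceType} (h : T -> S) (hI : injective h).

Let push_fun (s : {perm T}) (y : S) : S :=
  if [pick x | h x == y] is Some x then h (s x) else y.

Let push_fs (s : {perm T}) : {fsfun S -> S} :=
  [fsfun y in [fset h x | x : T]%fset => push_fun s y].

Let push_funE s x : push_fun s (h x) = h (s x).
Proof.
rewrite /push_fun; case: pickP => [z /eqP/hI -> //|/(_ x)]; by rewrite eqxx.
Qed.

Let push_fun_out s y : (forall x, y <> h x) -> push_fun s y = y.
Proof. by rewrite /push_fun; case: pickP => // x /eqP E /(_ x); rewrite E. Qed.

Let push_fsE s y : push_fs s y = push_fun s y.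
Proof.
rewrite /push_fs fsfun_fun; case: imfsetP => // ny; rewrite push_fun_out // => x yx.
by apply: ny; exists x.
Qed.

Let push_inj s : fsinjectiveb (push_fs s).
Proof.
apply/fsinjectiveP => y z; rewrite !push_fsE.
have [[x ->]|ny] := pselect (exists x, y = h x);
have [[x' ->]|nz] := pselect (exists x, z = h x); rewrite ?push_funE.
- by move/hI/perm_inj ->.
- rewrite (@push_fun_out _ z); last by move=> t tx; apply: nz; exists t.
  by move=> E; case: nz; exists (s x).
- rewrite (@push_fun_out _ y); last by move=> t tx; apply: ny; exists t.
  by move=> E; case: ny; exists (s x').
- by rewrite !push_fun_out // => t tx; [apply: nz|apply: ny]; exists t.
Qed.

(** This serves both for the blocks of a matrix and for the supports of finite
    permutations, so that signs need to be compared only once. *)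
Definition push (s : {perm T}) : finperm S := exist _ (push_fs s) (push_inj s).

Lemma pushE s x : val (push s) (h x) = h (s x).
Proof. by rewrite push_fsE push_funE. Qed.

Lemma push_out s y : (forall x, y <> h x) -> val (push s) y = y.
Proof. by rewrite push_fsE; exact: push_fun_out. Qed.

Lemma odd_push s : odd_finperm (push s) = odd_perm s.
Proof.
have /choice[g Hg] : forall y : finsupp (val (push s)), exists x, val y = h x.
  move=> y; have := valP y; rewrite mem_finsupp => E.
  apply: contrapT => ny; move/eqP: E; apply; apply: push_out => x yx.
  by apply: ny; exists x.
have gI : injective g by move=> y z E; apply: val_inj; rewrite !Hg E.
rewrite /odd_finperm; apply/esym; apply: (odd_perm_extend gI) => [y|x nx].
  by apply: hI; rewrite permE -Hg /= -pushE -Hg.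
apply/eqP; case: eqP => // /eqP sx; exfalso.
have hx : h x \in finsupp (val (push s)).
  by rewrite mem_finsupp pushE (inj_eq hI).
by apply: (nx [` hx]%fset); apply: hI; rewrite -Hg.
Qed.

Lemma push_onto (t : finperm S) :
  (forall y, y \in finsupp (val t) -> exists x, y = h x) -> exists s, t = push s.
Proof.
move=> Ht.
have tI := elimT fsinjectiveP (valP t).
have /choice[f Hf] : forall x, exists x', val t (h x) = h x'.
  move=> x; have [E|/eqP E] := eqVneq (val t (h x)) (h x); first by exists x.
  by apply: Ht; rewrite mem_finsupp (inj_eq tI) ; apply/eqP.
have fI : injective f.
  by move=> x y E; apply/hI/tI; rewrite !Hf E.
exists (perm fI); apply: val_inj; apply/fsfunP => y.
have [[x ->]|ny] := pselect (exists x, y = h x); first by rewrite pushE Hf permE.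
rewrite push_out; last by move=> x yx; apply: ny; exists x.
by apply: fsfun_dflt; apply/negP => /Ht.
Qed.

Lemma finsupp_push s y : y \in finsupp (val (push s)) -> exists x, y = h x.
Proof.
rewrite mem_finsupp => E; apply: contrapT => ny; move/eqP: E; apply.
by apply: push_out => x yx; apply: ny; exists x.
Qed.

Lemma push_injective : injective push.
Proof.
by move=> s t E; apply/permP => x; apply: hI; rewrite -!pushE E.
Qed.

End PushPermutations.

(** * Determinants under extension of the index set and diagonal conjugation *)

Lemma sum_signed_tdet_term {R : realType} {B : completeStrongPolymetricType R}
    (S : countType) (W : S -> S -> B) : tdet_cvg W ->
  has_sum (fun s => (-1) ^+ odd_finperm s * tdet_term W s) (tdet W).
Proof.
move=> [_ sW]; apply: abs_summable_has_sum => p; have := sW p; congr (_ < _)%E.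
apply: eq_esum => s _; congr _%:E.
by case: odd_finperm; rewrite ?mul1r // mulN1r snN.
Qed.

Section Transport.
Context {R : realType} {B : completeStrongPolymetricType R}.
Context {S : choiceType} {S' : countType} (h : S -> S') (hI : injective h).

Let hvalI (s : finperm S) : injective (h \o val : finsupp (val s) -> S').
Proof. by move=> x y /hI /val_inj. Qed.

Definition finperm_map (s : finperm S) : finperm S' :=
  push (@hvalI s) (perm (@finperm_res_inj _ s)).

Lemma finperm_mapE s x : val (finperm_map s) (h x) = h (val s x).
Proof.
have [xs|xs] := boolP (x \in finsupp (val s)).
  by rewrite -[x]/(val [` xs]%fset) -/((h \o val) _) pushE permE.
rewrite push_out ?fsfun_dflt // => y /hI xy.
by move: xs; rewrite xy; rewrite (valP y).
Qed.

Lemma finperm_map_out s y : (forall x, y <> h x) -> val (finperm_map s) y = y.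
Proof. by move=> ny; apply: push_out => x; exact: ny. Qed.

Lemma odd_finperm_map s : odd_finperm (finperm_map s) = odd_finperm s.
Proof. exact: odd_push. Qed.

Lemma finperm_map_inj : injective finperm_map.
Proof.
move=> s t E; apply: val_inj; apply/fsfunP => x.
by apply: hI; rewrite -!finperm_mapE E.
Qed.

Lemma finperm_map_onto (t : finperm S') :
  (forall y, y \in finsupp (val t) -> exists x, y = h x) ->
  exists s, t = finperm_map s.
Proof.
move=> Ht; have tI := elimT fsinjectiveP (valP t).
have /choice[g Hg] : forall y : finsupp (val t), exists x, val y = h x.
  by move=> y; apply: Ht; exact: valP.
have gI : injective g by move=> y z E; apply: val_inj; rewrite !Hg E.
exists (push gI (perm (@finperm_res_inj _ t))); apply: val_inj; apply/fsfunP => y.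
have [yt|yt] := boolP (y \in finsupp (val t)).
  by rewrite -[y]/(val [` yt]%fset) Hg finperm_mapE pushE -Hg permE -Hg.
have [[x yx]|ny] := pselect (exists x, y = h x).
  rewrite yx finperm_mapE push_out -?yx ?fsfun_dflt // => z xz.
  by move: yt; rewrite yx xz -Hg (valP z).
by rewrite finperm_map_out ?fsfun_dflt // => x yx; apply: ny; exists x.
Qed.

Variables (W : S -> S -> B) (W' : S' -> S' -> B).
Hypothesis hW : forall x y, W' (h x) (h y) = W x y.
Hypothesis hW1 : forall y z, (forall x, y <> h x) -> W' y z = (y == z)%:R.

Let term_map s x : has_prod (fun n => W' n (val (finperm_map s) n)) x ->
  has_prod (fun n => W n (val s n)) x.
Proof.
move=> H; have := has_prod_inj hI _ H.
have -> : (fun n => W' n (val (finperm_map s) n)) \o h = (fun n => W n (val s n)).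
  by apply/funext => n /=; rewrite finperm_mapE hW.
by apply=> y ny; rewrite hW1 // finperm_map_out // eqxx.
Qed.

(** A permutation moving a point off the range of [h] meets a zero entry, so the
    determinant of the extension by the identity is a sum over the permutations
    of the smaller index set. *)
Lemma tdet_transport : tdet_cvg W' -> tdet_cvg W /\ tdet W = tdet W'.
Proof.
move=> [cW' sW'].
have tE s : tdet_term W s = tdet_term W' (finperm_map s).
  have [x Hx] := cW' (finperm_map s).
  by rewrite /tdet_term (tprodE Hx) (tprodE (term_map Hx)).
split; first split.
- by move=> s; have [x /term_map] := cW' (finperm_map s); exists x.
- apply: abs_summable_le => p; have [M HM] := abs_summable_bounded sW' p.
  exists M => J; have := HM [fset finperm_map s | s in J]%fset.
  rewrite (big_fset_inj _ _ _ finperm_map_inj); apply: le_trans.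
  by apply: ler_sum => s _; rewrite tE.
apply: tsumE.
have := has_sum_inj finperm_map_inj _ (sum_signed_tdet_term (conj cW' sW')).
pose f' s := (-1) ^+ odd_finperm s * tdet_term W' s; rewrite -/f'.
have -> : f' \o finperm_map = (fun s => (-1) ^+ odd_finperm s * tdet_term W s).
  by apply/funext => s; rewrite /f' /= tE odd_finperm_map.
apply=> t nt; rewrite /f' (_ : tdet_term W' t = 0) ?mulr0 //.
have [y ny ty] : exists2 y, (forall x, y <> h x) & val t y != y.
  apply: contrapT => E; have [|s] := @finperm_map_onto t; last exact: nt.
  move=> y; rewrite mem_finsupp => ty; apply: contrapT => ny; apply: E.
  by exists y => // x yx; apply: ny; exists x.
apply: tprodE => p e e0; exists [fset y]%fset => J; rewrite fsub1set => yJ.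
rewrite (big_fsetD1 y yJ) /= hW1 // eq_sym (negPf ty) mul0r subrr sn0 //.
Qed.

End Transport.

(** Conjugation by a diagonal matrix multiplies the term of a permutation [s] by
    the product of the x n / x (s n), which is 1 since s permutes a finite set. *)
Lemma tdet_diag_conj {R : realType} {B : completeStrongPolymetricType R}
    (S : countType) (x y : S -> B) (W : S -> S -> B) :
  (forall n, x n * y n = 1) ->
  let W' := fun n m => x n * W n m * y m in
  tdet_cvg W' -> tdet_cvg W /\ tdet W = tdet W'.
Proof.
move=> xy W' [cW' sW'].
have tr (s : finperm S) z : has_prod (fun n => W' n (val s n)) z ->
    has_prod (fun n => W n (val s n)) z.
  move=> H p e e0; have [J0 HJ] := H p e e0.
  exists (J0 `|` finsupp (val s))%fset => J; rewrite fsubUset => /andP[/HJ + sub].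
  congr (sn p (z - _) < e).
  have sI := elimT fsinjectiveP (valP s).
  have imJ : [fset val s n | n in J]%fset = J.
    apply/eqP; rewrite eqEfcard card_imfset //= leqnn andbT.
    apply/fsubsetP => _ /imfsetP[n /= nJ ->].
    have [ns|/fsfun_dflt -> //] := boolP (n \in finsupp (val s)).
    by apply: (fsubsetP sub); exact: (finperm_supp [` ns]%fset).
  have yE : \prod_(n <- J) y (val s n) = \prod_(n <- J) y n.
    by rewrite -(big_fset_inj *%R y J sI) imJ.
  rewrite !big_split /= yE mulrAC -big_split /=.
  by rewrite [X in X * _]big1 ?mul1r // => n _; rewrite xy.
have tE s : tdet_term W s = tdet_term W' s.
  by have [z Hz] := cW' s; rewrite /tdet_term (tprodE Hz) (tprodE (tr _ _ Hz)).
split; last by rewrite /tdet; congr tsum; apply/funext => s; rewrite tE.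
split=> [s|]; first by have [z /tr] := cW' s; exists z.
by rewrite (_ : tdet_term W = tdet_term W') //; apply/funext.
Qed.

(** * Expansion of products and double sums *)

Section MoreSummation.

Lemma big_fset_fintype (T : finType) (I : choiceType) (V : Type) (idx : V)
    (op : Monoid.com_law idx) (h : T -> I) (F : I -> V) : injective h ->
  \big[op/idx]_(i <- [fset h x | x : T]%fset) F i = \big[op/idx]_(x : T) F (h x).
Proof.
move=> hI; rewrite -[RHS](big_map h xpredT); apply: perm_big.
apply: uniq_perm; rewrite ?fset_uniq ?map_inj_uniq ?index_enum_uniq //.
move=> i; apply/imfsetP/mapP => -[x /= _ ->]; exists x => //.
exact: mem_index_enum.
Qed.

Lemma prodD_fpowerset (A : comPzRingType) (I : choiceType) (x y : I -> A) (K : {fset I}) :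
  \prod_(n <- K) (x n + y n) =
  \sum_(L <- fpowerset K) (\prod_(n <- L) x n * \prod_(n <- (K `\` L)%fset) y n).
Proof.
pose h (L : {set K}) : {fset I} := [fset val n | n in L]%fset.
have hE L (n : K) : (val n \in h L) = (n \in L).
  by apply/imfsetP/idP => /= [[m mL /val_inj ->]//|nL]; exists n.
have hI : injective h by move=> L M E; apply/setP => n; rewrite -!hE E.
have -> : fpowerset K = [fset h L | L : {set K}]%fset.
  apply/fsetP => L; rewrite fpowersetE; apply/idP/imfsetP => [LK|[M /= _ ->]].
    exists (finset (fun n : K => val n \in L)) => //; apply/fsetP => n; apply/idP/idP => [nL|].
      by rewrite -[n]/(val [` fsubsetP LK n nL]%fset) hE inE.
    by move=> /imfsetP[m /=]; rewrite inE => mL ->.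
  by apply/fsubsetP => _ /imfsetP[n /= _ ->]; exact: valP.
rewrite big_fset_fintype // big_seq_fsetE bigA_distr; apply: eq_bigr => L _.
have split_big (P : pred I) (z : I -> A) (M : {fset I}) :
    (forall n, (n \in M) = P n && (n \in K)) ->
    \prod_(n <- M) z n = \prod_(n : K | P (val n)) z (val n).
  move=> HM; rewrite -(big_seq_fsetE _ K P) /= -[RHS]big_filter.
  apply: perm_big; apply: uniq_perm; rewrite ?filter_uniq ?fset_uniq // => n.
  by rewrite mem_filter HM.
rewrite (bigID (mem L)) /=; congr (_ * _).
  rewrite (split_big (fun n => n \in h L)) => [|n].
    by apply: eq_big => n; rewrite ?hE // => ->.
  case: (boolP (n \in h L)) => //= /imfsetP[m /= _ ->]; exact/esym/valP.
rewrite (split_big (fun n => n \notin h L)) => [|n]; last by rewrite in_fsetD.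
by apply: eq_big => n; rewrite ?hE // => /negPf ->.
Qed.

Lemma big_fsetM (V : nmodType) (I J : choiceType) (f : I * J -> V)
    (K : {fset I}) (L : {fset J}) :
  \sum_(x <- (K `*` L)%fset) f x = \sum_(i <- K) \sum_(j <- L) f (i, j).
Proof.
rewrite -(big_allpairs (F := f)); apply: perm_big; apply: uniq_perm.
- exact: fset_uniq.
- by rewrite allpairs_uniq // => -[? ?] [? ?].
- move=> [i j]; rewrite in_fsetM; apply/andP/allpairsP => /= [[iK jL]|].
    by exists (i, j).
  by case=> -[i' j'] /= [? ? [-> ->]].
Qed.

(** Only finitely many inner sums occur at a time, so they can be approximated
    simultaneously by finite sums over a common range. *)
Lemma sum_sn_has_sum {R : realType} {B : seminormedRingType R} (p : sn_index B)
    (I J : choiceType) (u : I -> R) (f : I * J -> B) (r : I -> B) (M : R) (K : {fset I}) :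
  (forall i, 0 <= u i) ->
  (forall i, has_sum (fun j => f (i, j)) (r i)) ->
  (forall L : {fset I * J}, \sum_(x <- L) sn p (f x) * u x.1 <= M) ->
  \sum_(i <- K) sn p (r i) * u i <= M.
Proof.
move=> u0 fr HM; apply/ler_addgt0Pr => e e0.
pose d := e / (1 + \sum_(i <- K) u i).
have K0 : 0 < 1 + \sum_(i <- K) u i by rewrite ltr_wpDr ?sumr_ge0.
have d0 : 0 < d by rewrite divr_gt0.
have /choice[L HL] := fun i => fr i p d d0.
pose N := (\bigcup_(i <- K) L i)%fset.
have LN i : i \in K -> (L i `<=` N)%fset by move=> iK; rewrite bigfcup_sup.
apply: (@le_trans _ _ (\sum_(i <- K) (\sum_(j <- N) sn p (f (i, j)) * u i + d * u i))).
  rewrite big_seq [leRHS]big_seq; apply: ler_sum => i iK.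
  rewrite -mulr_suml -mulrDl ler_wpM2r //.
  rewrite -(subrK (\sum_(j <- N) f (i, j)) (r i)) (le_trans (snD _ _ _)) //.
  by rewrite addrC lerD ?sn_sum // ltW // HL // LN.
rewrite big_split /= lerD //.
  by apply: le_trans (HM (K `*` N)%fset); rewrite big_fsetM.
rewrite -mulr_sumr /d mulrAC.
by rewrite ler_pdivrMr // ler_wpM2l ?(ltW e0) // lerDr.
Qed.

End MoreSummation.

(** * Expansion of the determinant of a perturbed bidiagonal matrix *)

Lemma finperm_preim (S : choiceType) (s : finperm S) (y : S) :
  exists x, val s x = y.
Proof.
have [ys|/fsfun_dflt E] := boolP (y \in finsupp (val s)); last by exists y.
exists (val ((perm (@finperm_res_inj _ s))^-1%g [` ys]%fset)).
have := permKV (perm (@finperm_res_inj _ s)) [` ys]%fset.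
by rewrite permE => /(congr1 val).
Qed.

Section StepPermutations.
Variables (d : int) (P : pred int).

(** The positions at which the bidiagonal matrix [bidiag d P] may be nonzero. *)
Definition step (n m : int) : bool := (m == n) || ((m == n + d) && P n).

Definition steps_off (I : {fset int}) (s : finperm int) : Prop :=
  forall n, n \notin I -> step n (val s n).

(** If [s] fixes n while [t n = n + d], at a point n outside I, then the preimage
    of n under [t] must be n - d, and [s] must fix n - d as well. So the same
    discrepancy recurs at n - d, n - 2d, and so on, which is impossible since [t]
    has finite support. *)
Lemma steps_off_unique I (s t : finperm int) : d != 0 ->
  steps_off I s -> steps_off I t -> (forall n, n \in I -> val s n = val t n) -> s = t.
Proof.
move=> d0 Hs Ht Est; apply: val_inj; apply/fsfunP.
suff descent (s1 s2 : finperm int) n : steps_off I s1 -> steps_off I s2 ->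
    (forall n, n \in I -> val s1 n = val s2 n) ->
    val s1 n = n -> val s2 n = n + d -> False.
  move=> n; apply: contrapT => ne.
  have nI : n \notin I by apply: contra_notN ne => /Est.
  have := Hs n nI; have := Ht n nI.
  rewrite /step => /orP[/eqP tn|/andP[/eqP tn _]] /orP[/eqP sn|/andP[/eqP sn _]].
  - by apply: ne; rewrite sn tn.
  - exact: (descent t s n Ht Hs (fun m mI => esym (Est m mI))).
  - exact: (descent s t n).
  - by apply: ne; rewrite sn tn.
move=> {Hs Ht Est} {}{s t} Hs1 Hs2 E12 s1n s2n.
have s1I := elimT fsinjectiveP (valP s1); have s2I := elimT fsinjectiveP (valP s2).
have far k : val s1 (n - d * k%:Z) = n - d * k%:Z /\
             val s2 (n - d * k%:Z) = n - d * k%:Z + d.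
  elim: k => [|k []]; first by rewrite mulr0 subr0.
  set m := n - d * k%:Z => s1m s2m.
  have -> : n - d * k.+1%:Z = m - d by rewrite /m -addn1 PoszD; ring.
  have [m' s2m'] := finperm_preim s2 m.
  have m'm : m' <> m by move=> E; move: s2m'; rewrite E s2m; lia.
  have s1m' : val s1 m' <> m by rewrite -[X in _ <> X]s1m => /s1I.
  have m'I : m' \notin I by apply: contra_notN s1m' => /E12 ->; rewrite s2m'.
  have m'E : m' = m - d.
    have := Hs2 m' m'I; rewrite s2m' => /orP[/eqP E|/andP[/eqP -> _]]; last by ring.
    by case: m'm.
  rewrite -m'E s2m'; split; last by rewrite m'E; ring.
  have := Hs1 m' m'I => /orP[/eqP //|/andP[/eqP E _]].
  by case: s1m'; rewrite E m'E; ring.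
pose N := (\max_(i <- finsupp (val s2)) `|i|)%N.
pose k := (N + `|n|).+1.
have kin : n - d * k%:Z \in finsupp (val s2).
  by rewrite mem_finsupp (far k).2; apply/eqP; lia.
have le1 : (`|(n - d * k%:Z)%R| <= N)%N.
  by rewrite /N (bigD1_seq _ kin (fset_uniq _)) /= leq_max leqnn.
have le2 : (k <= `|(d * k%:Z)%R|)%N by rewrite abszM /= leq_pmull // absz_gt0.
have kE : k = (N + `|n|).+1 by [].
by clearbody N k; move: (d * k%:Z) le1 le2 => x; lia.
Qed.

End StepPermutations.

Section Expansion.
Context {R : realType} {B : completeStrongPolymetricType R}.
Variables (d : int) (P : pred int).
Hypothesis d0 : d != 0.
Implicit Types (X : int -> int -> B) (s : finperm int) (I : {fset int}).

Definition bidiag : int -> int -> B :=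
  fun n m => (n == m)%:R - ((m == n + d) && P n)%:R.

(** In the rows outside I and outside the support of s, the entry of [bidiag] lies
    on the diagonal and is 1, so the second product may be taken to be finite. *)
Definition mixed_term X s I : B :=
  \prod_(n <- I) X n (val s n) *
  \prod_(n <- (finsupp (val s) `\` I)%fset) bidiag n (val s n).

Lemma bidiag_diag n : bidiag n n = 1.
Proof.
rewrite /bidiag eqxx (_ : (n == n + d) = false) ?subr0 //.
by apply/negP => /eqP; move/eqP: d0; lia.
Qed.

Lemma bidiag_value n m : bidiag n m = 0 \/ step d P n m /\ (bidiag n m = 1 \/ bidiag n m = -1).
Proof.
rewrite /bidiag /step eq_sym; case: eqVneq => [->|ne] /=.
  by right; split=> //; left; have := bidiag_diag n; rewrite /bidiag eqxx.
case: (_ && _); last by left; rewrite mulr0n subr0.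
by right; split=> //; right; rewrite mulr1n sub0r.
Qed.

Lemma sn_mul_bidiag p (x : B) (L : seq int) (f : int -> int) :
  sn p (x * \prod_(n <- L) bidiag n (f n)) <=
  sn p x * (all (fun n => step d P n (f n)) L)%:R.
Proof.
elim: L x => [|n L IH] x /=; first by rewrite big_nil !mulr1.
rewrite big_cons; have [->|[-> [->|->]]] := bidiag_value n (f n).
- by rewrite mul0r mulr0 sn0 mulr_ge0 ?sn_ge0.
- by rewrite mul1r.
- by rewrite mulN1r mulrN -mulNr (le_trans (IH _)) // snN.
Qed.

Lemma prod_mixed X s (K : {fset int}) : (finsupp (val s) `<=` K)%fset ->
  \prod_(n <- K) (X n (val s n) + bidiag n (val s n)) =
  \sum_(I <- fpowerset K) mixed_term X s I.
Proof.
move=> sK; rewrite prodD_fpowerset; apply: eq_bigr => I _; congr (_ * _).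
apply/esym; apply: big_fset_incl => [|n]; first exact: fsetSD.
rewrite !in_fsetD => /andP[-> _] /= /fsfun_dflt E.
by rewrite [X in bidiag _ X]E bidiag_diag.
Qed.

(** A summable bound on the entries which can be shared by a whole sequence of
    approximations. *)
Definition dominated (C : sn_index B -> R) X :=
  forall p n m, sn p (X n m) <= C p * (weight n ^- 2 * weight m ^- 2).

Definition majorant (c : R) (x : finperm int * {fset int}) : R :=
  `[< steps_off d P x.2 x.1 >]%:R *
  \prod_(n <- x.2) (c * (weight n ^- 2 * weight (val x.1 n) ^- 2)).

Lemma majorant_ge0 c x : 0 <= c -> 0 <= majorant c x.
Proof.
move=> c0; rewrite /majorant mulr_ge0 // prodr_ge0 // => n _.
by rewrite mulr_ge0 // mulr_ge0 // invr_ge0 exprn_ge0 ?weight_ge0.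
Qed.

(** By [steps_off_unique], a pair (s, I) is coded faithfully by the restriction of
    s to I, that is, by a choice of at most one column in each row. The sum over
    all such choices is the product over the rows n of 1 plus the sum of the
    bounds in row n. One factor 4 bounds the sum of [weight m ^- 2] over the
    columns, the other one the sum over the rows. *)
Lemma sum_majorant (c : R) (J : {fset finperm int * {fset int}}) : 0 <= c ->
  \sum_(x <- J) majorant c x <= expR (4 * c * 4).
Proof.
move=> c0.
pose r n m : R := c * (weight n ^- 2 * weight m ^- 2).
have w0 n : 0 <= weight n ^- 2 :> R by rewrite invr_ge0 exprn_ge0 ?weight_ge0.
have r0 n m : 0 <= r n m by rewrite !mulr_ge0.
pose X := (\bigcup_(x <- J) (x.2 `|` finsupp (val x.1)))%fset.
have subX x : x \in J -> (x.2 `|` finsupp (val x.1) `<=` X)%fset.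
  by move=> xJ; rewrite (bigfcup_sup (fun x => x.2 `|` finsupp (val x.1))%fset).
have IX x n : x \in J -> n \in x.2 -> n \in X.
  by move=> /subX/fsubsetP H nx; apply: H; rewrite in_fsetU nx.
have sX x n : x \in J -> n \in X -> val x.1 n \in X.
  move=> /subX/fsubsetP H nX; have [ns|/fsfun_dflt -> //] := boolP (n \in finsupp (val x.1)).
  by apply: H; rewrite in_fsetU (finperm_supp [` ns]%fset) orbT.
pose code (x : finperm int * {fset int}) : {ffun X -> option X} :=
  [ffun n => if val n \in x.2 then insub (val x.1 (val n)) else None].
pose G (g : {ffun X -> option X}) : R :=
  \prod_n oapp (fun m => r (val n) (val m)) 1 (g n).
have G0 g : 0 <= G g by apply: prodr_ge0 => n _; case: (g n) => //=.
have codeE x : x \in J -> \prod_(n <- x.2) r n (val x.1 n) = G (code x).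
  move=> xJ.
  transitivity (\prod_(n <- X) if n \in x.2 then r n (val x.1 n) else 1).
    rewrite -(@big_fset_incl _ _ _ _ x.2 X) => [||n _ /negPf -> //].
      by rewrite big_seq [RHS]big_seq; apply: eq_bigr => n ->.
    by apply/fsubsetP => n; exact: IX.
  rewrite big_seq_fsetE; apply: eq_bigr => n _; rewrite ffunE.
  case: ifP => // _; have := sX x (val n) xJ (valP n).
  by case: insubP => [m _ <- //|/negPf ->].
pose J' := [seq x <- J | `[< steps_off d P x.2 x.1 >]].
have uc : uniq (map code J').
  rewrite map_inj_in_uniq ?filter_uniq ?fset_uniq // => -[s I] [t K].
  rewrite !mem_filter /= => /andP[/asboolP Hs xJ] /andP[/asboolP Ht yJ] E.
  have IK : I = K.
    apply/fsetP => n; apply/idP/idP => nI.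
      have nX := IX (s, I) n xJ nI.
      move/ffunP/(_ [` nX]%fset): E; rewrite !ffunE /= nI.
      by case: insubP => [m _ _|/negP[]]; [case: ifP|exact: (sX (s, I))].
    have nX := IX (t, K) n yJ nI.
    move/ffunP/(_ [` nX]%fset): E; rewrite !ffunE /= nI.
    case: ifP => // _; case: insubP => [//|/negP[]]; exact: (sX (t, K)).
  congr (_, _) => //; apply: (steps_off_unique d0 Hs); rewrite ?IK // => n nK.
  have nX := IX (t, K) n yJ nK.
  move/ffunP/(_ [` nX]%fset): E; rewrite !ffunE /= IK nK.
  case: insubP => [m _ <-|/negP[]]; last exact: (sX (s, I)).
  by case: insubP => [m' _ <- [->]|/negP[]] //; exact: (sX (t, K)).
apply: (@le_trans _ _ (\sum_g G g)).
  apply: (@le_trans _ _ (\sum_(x <- J') G (code x))).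
    rewrite big_filter [leRHS]big_mkcond big_seq [leRHS]big_seq.
    apply: ler_sum => x xJ; rewrite /majorant (codeE x xJ).
    by case: asboolP => _; rewrite ?mul1r ?mul0r.
  rewrite -(big_map code xpredT G); apply: ler_sum_sub => //.
  by move=> g _; rewrite mem_index_enum.
rewrite -(bigA_distr_bigA (fun n o => oapp (fun m => r (val n) (val m)) 1 o)) /=.
apply: (@le_trans _ _ (\prod_(n : X) expR (4 * c * weight (val n) ^- 2))).
  apply: ler_prod => n _; rewrite sumr_ge0 /=; last by case=> /=.
  rewrite (bigD1 None) //= (reindex_omap Some id) /=; last by case.
  under eq_bigl => m do rewrite eqxx.
  apply: le_trans (expR_ge1Dx _); rewrite lerD2l -(big_seq_fsetE _ X xpredT (r (val n))) /=.
  rewrite /r -mulr_sumr -mulr_sumr (mulrC 4) -[leRHS]mulrA (mulrC 4).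
  by rewrite ler_wpM2l // ler_wpM2l // sum_weight.
rewrite -(big_seq_fsetE _ X xpredT (fun n => expR (4 * c * weight n ^- 2))) /= -expR_sum.
rewrite ler_expR -mulr_sumr ler_wpM2l ?mulr_ge0 //; exact: sum_weight.
Qed.

End Expansion.

(** * Determinants as limits of finite determinants *)

Section FiniteSections.
Context {B : comPzRingType}.

Definition block_point (N : nat) (i : 'I_(N.*2.+1)) : int := (i : nat)%:Z - N%:Z.

Lemma block_point_inj N : injective (@block_point N).
Proof. by move=> i j; rewrite /block_point => E; apply: val_inj => /=; lia. Qed.

Definition block (N : nat) : {fset int} := [fset block_point i | i : 'I_(N.*2.+1)]%fset.

Lemma in_block N n : (n \in block N) = (`|n| <= N)%N.
Proof.
apply/imfsetP/idP => [[i /= _ ->]|nN].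
  by rewrite /block_point; have := ltn_ord i; lia.
have lt : (`|(n + N%:Z)%R| < N.*2.+1)%N by lia.
by exists (Ordinal lt) => //=; rewrite /block_point /=; lia.
Qed.

Definition section_mx N (X : int -> int -> B) : 'M[B]_(N.*2.+1) :=
  \matrix_(i, j) X (block_point i) (block_point j).

Definition fdet N (X : int -> int -> B) : B := \det (section_mx N X).

(** It converges to the product of X and Y, and its block is the product of the
    blocks of X and Y. *)
Definition mulblock N (X Y : int -> int -> B) : int -> int -> B :=
  fun n m => \sum_(k <- block N) X n k * Y k m.

Lemma section_mxM N X Y : section_mx N (mulblock N X Y) = section_mx N X *m section_mx N Y.
Proof.
apply/matrixP => i j; rewrite !mxE /mulblock big_fset_fintype; last exact: block_point_inj.
by apply: eq_bigr => k _; rewrite !mxE.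
Qed.

Lemma section_mxD N X Y : section_mx N (X + Y) = section_mx N X + section_mx N Y.
Proof. by apply/matrixP => i j; rewrite !mxE. Qed.

Lemma section_mx1 N : section_mx N (fun n m => (n == m)%:R) = 1%:M.
Proof. by apply/matrixP => i j; rewrite !mxE (inj_eq (@block_point_inj N)). Qed.

End FiniteSections.

Lemma eventually_block (J : {fset int}) :
  exists N0, forall N, (N0 <= N)%N -> (J `<=` block N)%fset.
Proof.
exists (\max_(n <- J) `|n|)%N => N leN; apply/fsubsetP => n nJ; rewrite in_block.
by apply: leq_trans leN; rewrite (bigD1_seq n nJ (fset_uniq J)) /= leq_max leqnn.
Qed.

Section DeterminantLimit.
Context {R : realType} {B : completeStrongPolymetricType R}.
Variables (d : int) (P : pred int).
Hypothesis d0 : d != 0.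
Implicit Types (X : int -> int -> B) (s : finperm int) (I : {fset int}).

Local Notation T := (bidiag (B := B) d P).
Local Notation mixed_term := (mixed_term d P).
Local Notation majorant := (majorant (R := R) d P).

Definition expansion_term X (x : finperm int * {fset int}) : B :=
  (-1) ^+ odd_finperm x.1 * mixed_term X x.1 x.2.

Lemma sn_expansion_term p X x :
  sn p (expansion_term X x) = sn p (mixed_term X x.1 x.2).
Proof. by rewrite /expansion_term; case: odd_finperm; rewrite ?mul1r // mulN1r snN. Qed.

Lemma dominated_ge0 (C : sn_index B -> R) X p : dominated C X -> 0 <= C p.
Proof.
move=> /(_ p 0 0); rewrite /weight /intsz addr0 expr1n invr1 !mulr1.
by apply: le_trans; exact: sn_ge0.
Qed.

Lemma sn_mixed_term p : exists q, forall C X x, dominated C X ->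
  sn p (mixed_term X x.1 x.2) <= (1 + sn p 1) * majorant (C q) x.
Proof.
have [q Hq] := sn_strong p; exists q => C X [s I] domX /=.
have C0 := dominated_ge0 q domX.
apply: (le_trans (sn_mul_bidiag P d0 _ _ _ _)); rewrite /majorant /=.
case: allP => [Hs|_]; last first.
  rewrite mulr0 mulr_ge0 ?addr_ge0 ?sn_ge0 //; exact: (majorant_ge0 d P (s, I)).
rewrite asboolT; last first.
  move=> n nI; have [ns|/fsfun_dflt ->] := boolP (n \in finsupp (val s)).
    by apply: Hs; rewrite in_fsetD nI.
  by rewrite /step eqxx.
rewrite mulr1 mul1r; have [->|I0] := eqVneq I fset0.
  by rewrite !big_seq_fset0 mulr1 lerDr.
have g0 : 0 <= \prod_(n <- I) (C q * (weight n ^- 2 * weight (val s n) ^- 2)).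
  apply: prodr_ge0 => n _; rewrite !mulr_ge0 // invr_ge0 exprn_ge0 ?weight_ge0 //.
apply: (@le_trans _ _ (1 * \prod_(n <- I) (C q * (weight n ^- 2 * weight (val s n) ^- 2)))).
  have := Hq [seq X n (val s n) | n <- I]; rewrite !big_map mul1r => H.
  apply: le_trans (H _) _; last by apply: ler_prod => n _; rewrite sn_ge0 domX.
  by rewrite -size_eq0 size_map; move: I0; rewrite -cardfs_eq0.
by rewrite ler_wpM2r // lerDl sn_ge0.
Qed.

Lemma expansion_summable C X : dominated C X ->
  forall p, exists M : R, forall J : {fset finperm int * {fset int}},
    \sum_(x <- J) sn p (expansion_term X x) <= M.
Proof.
move=> domX p; have [q Hq] := sn_mixed_term p.
exists ((1 + sn p 1) * expR (4 * C q * 4)) => J.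
apply: (@le_trans _ _ (\sum_(x <- J) (1 + sn p 1) * majorant (C q) x)).
  by apply: ler_sum => x _; rewrite sn_expansion_term; exact: (Hq C X x).
rewrite -mulr_sumr ler_wpM2l ?addr_ge0 ?sn_ge0 //.
exact: (sum_majorant P d0 J (dominated_ge0 q domX)).
Qed.

Lemma expansion_has_sum C X : dominated C X ->
  has_sum (expansion_term X) (tsum (expansion_term X)).
Proof.
by move=> domX; apply: abs_summable_has_sum; apply: abs_summable_le; exact: expansion_summable domX.
Qed.

Lemma mixed_has_sum C X s : dominated C X ->
  has_sum (mixed_term X s) (tsum (mixed_term X s)).
Proof.
move=> domX; apply: abs_summable_has_sum; apply: abs_summable_le => p.
have [M HM] := expansion_summable domX p; exists M => J.
have := HM [fset (s, I) | I in J]%fset.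
rewrite (big_fset_inj _ _ _ (h := pair s)); last by move=> ? ? [].
by under eq_bigr => I _ do rewrite sn_expansion_term /=.
Qed.

Lemma term_has_prod C X s : dominated C X ->
  has_prod (fun n => (T + X) n (val s n)) (tsum (mixed_term X s)).
Proof.
move=> domX p e e0; have [J0 HJ] := mixed_has_sum s domX p e0.
exists (finsupp (val s) `|` \bigcup_(I <- J0) I)%fset => J.
rewrite fsubUset => /andP[sJ J0J].
rewrite (eq_bigr (fun n => X n (val s n) + T n (val s n))) => [|n _]; last exact: addrC.
rewrite (prod_mixed P d0 X sJ); apply: HJ; apply/fsubsetP => I IJ0.
by rewrite fpowersetE (fsubset_trans _ J0J) // (bigfcup_sup (fun I => I)).
Qed.

Lemma tdet_termE C X s : dominated C X -> tdet_term (T + X) s = tsum (mixed_term X s).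
Proof. by move=> domX; exact/tprodE/term_has_prod/domX. Qed.

Lemma signed_has_sum C X s : dominated C X ->
  has_sum (fun I => expansion_term X (s, I)) ((-1) ^+ odd_finperm s * tdet_term (T + X) s).
Proof.
move=> domX; rewrite (tdet_termE s domX) mulrC.
apply: eq_has_sum (has_sumMr _ (mixed_has_sum s domX)) => I.
by rewrite /expansion_term mulrC.
Qed.

Lemma tdet_cvg_bidiag C X : dominated C X -> tdet_cvg (T + X).
Proof.
move=> domX; split=> [s|]; first by exists (tsum (mixed_term X s)); exact: term_has_prod domX.
apply: abs_summable_le => p; have [M HM] := expansion_summable domX p.
exists M => K.
have HM1 (J : {fset finperm int * {fset int}}) : \sum_(x <- J) sn p (expansion_term X x) * 1 <= M.
  under eq_bigr => x _ do rewrite mulr1.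
  exact: HM.
have := sum_sn_has_sum K (fun=> ler01) (fun s => signed_has_sum s domX) HM1.
apply: le_trans; apply: ler_sum => s _; rewrite mulr1.
by case: odd_finperm; rewrite ?mul1r // mulN1r snN.
Qed.

Lemma tdet_expansion C X : dominated C X -> has_sum (expansion_term X) (tdet (T + X)).
Proof.
move=> domX; have H := expansion_has_sum domX.
rewrite /tdet (tsumE (has_sum_fubini H (fun s => signed_has_sum s domX))) //.
Qed.

Definition expansion_range N : {fset finperm int * {fset int}} :=
  ([fset push (@block_point_inj N) s | s : {perm 'I_(N.*2.+1)}] `*` fpowerset (block N))%fset.

Lemma fdet_expansion N X :
  fdet N (T + X) = \sum_(x <- expansion_range N) expansion_term X x.
Proof.
rewrite big_fsetM /= big_fset_fintype; last exact: push_injective.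
apply: eq_bigr => s _; rewrite /expansion_term /= -mulr_sumr odd_push; congr (_ * _).
rewrite -prod_mixed //; last first.
  apply/fsubsetP => n /finsupp_push[i ->]; apply/imfsetP; by exists i.
rewrite big_fset_fintype; last exact: block_point_inj.
by apply: eq_bigr => i _; rewrite mxE pushE addrC.
Qed.

Lemma expansion_range_exhausts x :
  exists N0, forall N, (N0 <= N)%N -> x \in expansion_range N.
Proof.
case: x => s I; have [N0 H] := eventually_block (finsupp (val s) `|` I)%fset.
exists N0 => N /H; rewrite fsubUset => /andP[sN IN].
rewrite in_fsetM /= fpowersetE IN andbT.
have [|t ->] := push_onto (h := @block_point N) (@block_point_inj N) (t := s).
  by move=> n /(fsubsetP sN)/imfsetP[i /= _ ->]; exists i.
by apply/imfsetP; exists t.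
Qed.

Lemma mixed_term_cvg (X_ : nat -> int -> int -> B) X x :
  (forall n m, cvg_sn (fun N => X_ N n m) (X n m)) ->
  cvg_sn (fun N => expansion_term (X_ N) x) (expansion_term X x).
Proof.
move=> XX; apply: cvg_snM; first exact: cvg_sn_cst.
apply: cvg_snM; last exact: cvg_sn_cst.
by apply: cvg_sn_prod => n; exact: XX.
Qed.

(** Dominated convergence for determinants: the perturbation may be replaced by
    approximations at the same time as the matrix is cut down to a finite
    block. Identities between infinite determinants thus follow from identities
    between finite ones. *)
Theorem fdet_cvg C C' (X_ : nat -> int -> int -> B) X :
  (forall N, dominated C (X_ N)) -> dominated C' X ->
  (forall n m, cvg_sn (fun N => X_ N n m) (X n m)) ->
  cvg_sn (fun N => fdet N (T + X_ N)) (tdet (T + X)).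
Proof.
move=> domX_ domX XX.
apply: (eq_cvg_sn (fun N => esym (fdet_expansion N (X_ N)))).
apply: (has_sum_dominated expansion_range_exhausts _ _ (tdet_expansion domX)).
  by move=> x; exact: mixed_term_cvg.
move=> p; have [q Hq] := sn_mixed_term p.
exists (fun x => (1 + sn p 1) * majorant (C q) x), ((1 + sn p 1) * expR (4 * C q * 4)).
split=> [N x|J]; first by rewrite sn_expansion_term; exact: Hq.
rewrite -mulr_sumr ler_wpM2l ?addr_ge0 ?sn_ge0 //.
exact: (sum_majorant P d0 J (dominated_ge0 q (domX_ 0%N))).
Qed.

End DeterminantLimit.

(** * The ring of matrices with off-diagonal decay *)

Section Decay.
Context {R : realType} {B : completeStrongPolymetricType R}.
Implicit Types (X Y Z : int -> int -> B) (p q : sn_index B).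

Definition decay X := rapid (fun x : int * int => intsz (x.1 - x.2)) (fun x => X x.1 x.2).

Lemma decayP X : decay X <->
  forall p k, exists2 C : R, 0 <= C & forall n m, sn p (X n m) * weight (n - m) ^+ k <= C.
Proof.
split=> H p k; last by have [C _ HC] := H p k; exists C => -[n m]; exact: HC.
have [C HC] := H p k; exists C => [|n m]; last exact: (HC (n, m)).
by apply: le_trans (HC (0, 0)); rewrite mulr_ge0 ?sn_ge0 ?exprn_ge0 ?weight_ge0.
Qed.

Lemma weightN n : weight (- n) = weight n :> R.
Proof. by rewrite /weight /intsz abszN. Qed.

Lemma weight_exp_ge0 n k : 0 <= weight n ^+ k :> R.
Proof. by rewrite exprn_ge0 ?weight_ge0. Qed.

Lemma weight_inv_ge0 n k : 0 <= weight n ^- k :> R.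
Proof. by rewrite invr_ge0 weight_exp_ge0. Qed.

Lemma weightX_le n m k : weight (n + m) ^+ k <= weight n ^+ k * weight m ^+ k :> R.
Proof.
by rewrite -exprMn lerXn2r ?nnegrE ?mulr_ge0 ?weight_ge0 ?weightD.
Qed.

Lemma sum_weight_inj (J : {fset int}) (h : int -> int) : injective h ->
  \sum_(n <- J) weight (h n) ^- 2 <= 4 :> R.
Proof. by move=> hI; rewrite -(big_fset_inj _ (fun n => weight n ^- 2) J hI) sum_weight. Qed.

Lemma sub_injr n : injective (fun k : int => n - k).
Proof. by move=> i j /addrI/oppr_inj. Qed.

Lemma sub_injl n : injective (fun k : int => k - n).
Proof. by move=> i j /addIr. Qed.

(** Two powers of the weight pay for a summation over an index. *)
Lemma le_invsq (x C : R) n k : x * weight n ^+ (k + 2) <= C ->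
  x * weight n ^+ k <= C * weight n ^- 2.
Proof. by move=> H; rewrite ler_pdivlMr ?exprn_gt0 ?weight_gt0 // -mulrA -exprD. Qed.

Lemma summable_weight (f : int -> B) (h : int -> int) : injective h ->
  (forall p, exists2 C : R, 0 <= C & forall k, sn p (f k) <= C * weight (h k) ^- 2) ->
  abs_summable f.
Proof.
move=> hI H; apply: abs_summable_le => p; have [C C0 HC] := H p.
exists (C * 4) => J; apply: (le_trans (ler_sum _ (fun k _ => HC k))).
by rewrite -mulr_sumr ler_wpM2l // sum_weight_inj.
Qed.

Lemma summable_weight2 (f : int * int -> B) (h : int * int -> int * int) : injective h ->
  (forall p, exists2 C : R, 0 <= C &
     forall x, sn p (f x) <= C * (weight (h x).1 ^- 2 * weight (h x).2 ^- 2)) ->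
  abs_summable f.
Proof.
move=> hI H; apply: abs_summable_le => p; have [C C0 HC] := H p.
exists (C * (4 * 4)) => J; apply: (le_trans (ler_sum _ (fun k _ => HC k))).
rewrite -mulr_sumr ler_wpM2l //.
rewrite -(big_fset_inj _ (fun y : int * int => weight y.1 ^- 2 * weight y.2 ^- 2) J hI).
set J' := (X in \sum_(y <- X) _).
pose J1 := [fset y.1 | y in J']%fset; pose J2 := [fset y.2 | y in J']%fset.
apply: (@le_trans _ _ (\sum_(y <- (J1 `*` J2)%fset) (weight y.1 ^- 2 * weight y.2 ^- 2))).
  apply: ler_sum_sub => [y||]; [by rewrite mulr_ge0 ?weight_inv_ge0|exact: fset_uniq|].
  move=> [i j] ij; rewrite in_fsetM /=; apply/andP; split; apply/imfsetP.
    by exists (i, j).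
  by exists (i, j).
rewrite big_fsetM /=; under eq_bigr => i _ do rewrite -mulr_sumr.
rewrite -mulr_suml; apply: ler_pM; rewrite ?sumr_ge0 ?sum_weight // => *; exact: weight_inv_ge0.
Qed.

Lemma decay_mul_bound p K : exists q, forall X Y, decay X -> decay Y ->
  exists2 C : R, 0 <= C & forall n k m,
    sn p (X n k * Y k m) * weight (n - m) ^+ K <= C * weight (n - k) ^- 2.
Proof.
have [q Hq] := sn_mul p; exists q => X Y /decayP/(_ q (K + 2)%N)[C C0 HC].
move=> /decayP/(_ q K)[D D0 HD]; exists (C * D); first by rewrite mulr_ge0.
move=> n k m; have -> : n - m = (n - k) + (k - m) by ring.
apply: (@le_trans _ _ ((sn q (X n k) * weight (n - k) ^+ K) *
                       (sn q (Y k m) * weight (k - m) ^+ K))).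
  rewrite mulrACA; apply: ler_pM; rewrite ?sn_ge0 ?weight_exp_ge0 //.
  exact: weightX_le.
rewrite [leRHS]mulrAC; apply: ler_pM; rewrite ?mulr_ge0 ?sn_ge0 ?weight_exp_ge0 //.
exact: le_invsq.
Qed.

Lemma immul_has_sum X Y n m : decay X -> decay Y ->
  has_sum (fun k => X n k * Y k m) ((X ** Y) n m).
Proof.
move=> dX dY; apply: abs_summable_has_sum.
apply: (summable_weight (sub_injr (n := n))) => p.
have [q /(_ X Y dX dY)[C C0 HC]] := decay_mul_bound p 0.
by exists C => // k; have := HC n k m; rewrite expr0 mulr1.
Qed.

Lemma decay_immul X Y : decay X -> decay Y -> decay (X ** Y).
Proof.
move=> dX dY; apply/decayP => p K.
have [q /(_ X Y dX dY)[C C0 HC]] := decay_mul_bound p K.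
exists (C * 4) => [|n m]; first by rewrite mulr_ge0.
have w0 : 0 < weight (n - m) ^+ K :> R by rewrite exprn_gt0 ?weight_gt0.
rewrite -ler_pdivlMr //; apply: (has_sum_le (immul_has_sum n m dX dY)) => J.
rewrite ler_pdivlMr // mulr_suml; apply: (le_trans (ler_sum _ (fun k _ => HC n k m))).
by rewrite -mulr_sumr ler_wpM2l // (sum_weight_inj _ (sub_injr (n := n))).
Qed.

Lemma immulA X Y Z : decay X -> decay Y -> decay Z -> X ** (Y ** Z) = X ** Y ** Z.
Proof.
move=> dX dY dZ; apply/funext => n; apply/funext => m.
pose f (x : int * int) := X n x.1 * (Y x.1 x.2 * Z x.2 m).
have fa : abs_summable f.
  apply: (@summable_weight2 _ (fun x => (n - x.1, x.1 - x.2))).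
    by move=> [i j] [i' j'] [/sub_injr -> /sub_injr ->].
  move=> p; have [q Hq] := sn_mul p; have [q' Hq'] := sn_mul q.
  have [C C0 HC] := (decayP X).1 dX q 2%N.
  have [D D0 HD] := (decayP Y).1 dY q' 2%N.
  have [E E0 HE] := (decayP Z).1 dZ q' 0%N.
  exists (C * (D * E)) => [|[k l]]; first by rewrite !mulr_ge0.
  apply: (le_trans (Hq _ _)); rewrite mulrACA /=.
  apply: ler_pM; rewrite ?sn_ge0 //.
    by rewrite ler_pdivlMr ?exprn_gt0 ?weight_gt0.
  apply: (le_trans (Hq' _ _)); rewrite mulrAC; apply: ler_pM; rewrite ?sn_ge0 //.
    by rewrite ler_pdivlMr ?exprn_gt0 ?weight_gt0.
  by have := HE l m; rewrite expr0 mulr1.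
have sf := abs_summable_has_sum fa.
have E1 : (X ** (Y ** Z)) n m = tsum f.
  apply: (has_sum_unique (immul_has_sum n m dX (decay_immul dY dZ))).
  apply: (has_sum_fubini sf) => k; rewrite mulrC.
  by apply: eq_has_sum (has_sumMr _ (immul_has_sum k m dY dZ)) => l; rewrite /f mulrC.
rewrite E1; apply/esym.
apply: (has_sum_unique (immul_has_sum n m (decay_immul dX dY) dZ)).
pose sw (x : int * int) := (x.2, x.1).
have swK : cancel sw sw by case.
apply: (has_sum_fubini (has_sum_bij swK swK sf)) => l.
by apply: eq_has_sum (has_sumMr _ (immul_has_sum n l dX dY)) => k; rewrite /f /= mulrA.
Qed.

Lemma decay0 : decay 0.
Proof. by move=> p k; exists 0 => x; rewrite sn0 mul0r. Qed.

Lemma decayB X Y : decay X -> decay Y -> decay (X - Y).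
Proof.
move=> dX dY p k; have [C H] := dX p k; have [D K] := dY p k.
exists (C + D) => x; apply: le_trans (lerD (H x) (K x)).
by rewrite -mulrDl ler_wpM2r ?snB // weight_exp_ge0.
Qed.

Lemma decay_sparse X (r : nat) :
  (forall n m, (r < `|n - m|)%N -> X n m = 0) ->
  (forall p, exists C : R, forall n m, sn p (X n m) <= C) -> decay X.
Proof.
move=> X0 XC; apply/decayP => p k; have [C HC] := XC p.
have C0 : 0 <= C by apply: le_trans (HC 0 0); exact: sn_ge0.
have r0 : 0 <= 1 + r%:R :> R by rewrite addr_ge0.
exists (C * (1 + r%:R) ^+ k) => [|n m]; first by rewrite mulr_ge0 ?exprn_ge0.
have [/X0 ->|le] := ltnP r `|n - m|; first by rewrite sn0 mul0r mulr_ge0 ?exprn_ge0.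
apply: ler_pM; rewrite ?sn_ge0 ?weight_exp_ge0 //.
by rewrite lerXn2r ?nnegrE ?weight_ge0 // lerD2l ler_nat.
Qed.

Lemma decay1 : decay imone.
Proof.
apply: (@decay_sparse _ 0) => [n m nm|p].
  by rewrite /imone; case: eqP nm => // ->; rewrite subrr.
exists (sn p 1) => n m; rewrite /imone; case: (n == m) => //.
by rewrite sn0 sn_ge0.
Qed.

Lemma immul_has_sum_fin (S : choiceType) (X Y : S -> S -> B) n m (J : {fset S}) :
  (forall k, k \notin J -> X n k * Y k m = 0) ->
  (X ** Y) n m = \sum_(k <- J) X n k * Y k m.
Proof. by move=> H; apply/tsumE/has_sum_fin. Qed.

Lemma immul_single (S : choiceType) (k0 : S) (X Y : S -> S -> B) n m :
  (forall k, k != k0 -> X n k * Y k m = 0) -> (X ** Y) n m = X n k0 * Y k0 m.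
Proof.
move=> H; rewrite (@immul_has_sum_fin _ _ _ _ _ [fset k0]%fset) ?big_seq_fset1 //.
by move=> k; rewrite in_fset1; exact: H.
Qed.

Lemma imone_mul X : imone ** X = X.
Proof.
apply/funext => n; apply/funext => m; rewrite (immul_single (k0 := n)).
  by rewrite /imone eqxx mul1r.
by move=> k /negPf kn; rewrite /imone eq_sym kn mul0r.
Qed.

Lemma mul_imone X : X ** imone = X.
Proof.
apply/funext => n; apply/funext => m; rewrite (immul_single (k0 := m)).
  by rewrite /imone eqxx mulr1.
by move=> k /negPf kn; rewrite /imone kn mulr0.
Qed.

Lemma decayD X Y : decay X -> decay Y -> decay (X + Y).
Proof.
move=> dX dY; rewrite -[Y]opprK; apply: decayB => //.
by rewrite -sub0r; apply: decayB => //; exact: decay0.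
Qed.

Lemma immulDl X Y Z : decay X -> decay Y -> decay Z -> (X + Y) ** Z = X ** Z + Y ** Z.
Proof.
move=> dX dY dZ; apply/funext => n; apply/funext => m; apply: tsumE.
apply: eq_has_sum (has_sumD (immul_has_sum n m dX dZ) (immul_has_sum n m dY dZ)) => k.
by rewrite -mulrDl.
Qed.

Lemma immulDr X Y Z : decay X -> decay Y -> decay Z -> X ** (Y + Z) = X ** Y + X ** Z.
Proof.
move=> dX dY dZ; apply/funext => n; apply/funext => m; apply: tsumE.
apply: eq_has_sum (has_sumD (immul_has_sum n m dX dY) (immul_has_sum n m dX dZ)) => k.
by rewrite -mulrDr.
Qed.

Definition decay_pred : {pred int -> int -> B} := fun X => `[< decay X >].

Lemma decay_predP X : reflect (decay X) (X \in decay_pred).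
Proof. exact: asboolP. Qed.

Lemma decay_zmod : zmod_closed decay_pred.
Proof.
split; first exact/decay_predP/decay0.
by move=> X Y /decay_predP dX /decay_predP dY; apply/decay_predP/decayB.
Qed.

HB.instance Definition _ :=
  GRing.isZmodClosed.Build (int -> int -> B) decay_pred decay_zmod.

(** The matrices with rapid off-diagonal decay form a ring, large enough for U(a),
    U~(a, w), F and all rapidly decreasing matrices, and in which products may
    therefore be rearranged freely. It does not contain the inverse of F. *)
Record dmat := DMat { dm :> int -> int -> B; _ : dm \in decay_pred }.

HB.instance Definition _ := [isSub for dm].
HB.instance Definition _ := [Choice of dmat by <:].
HB.instance Definition _ := [SubChoice_isSubZmodule of dmat by <:].

Implicit Types M N : dmat.

Lemma dmP M : decay M.
Proof. by apply/decay_predP; case: M. Qed.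

Definition dmk X (dX : decay X) : dmat := DMat (introT (decay_predP _) dX).

Definition dmul M N : dmat := dmk (decay_immul (dmP M) (dmP N)).

Lemma dmulA : associative dmul.
Proof. by move=> M N K; apply/val_inj/immulA; exact: dmP. Qed.

Lemma dmul1l : left_id (dmk decay1) dmul.
Proof. by move=> M; apply/val_inj/imone_mul. Qed.

Lemma dmul1r : right_id (dmk decay1) dmul.
Proof. by move=> M; apply/val_inj/mul_imone. Qed.

Lemma dmulDl : left_distributive dmul +%R.
Proof. by move=> M N K; apply/val_inj/immulDl; exact: dmP. Qed.

Lemma dmulDr : right_distributive dmul +%R.
Proof. by move=> M N K; apply/val_inj/immulDr; exact: dmP. Qed.

HB.instance Definition _ :=
  GRing.Zmodule_isPzRing.Build dmat dmulA dmul1l dmul1r dmulDl dmulDr.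

Lemma dmM M N : (M * N) = M ** N :> (int -> int -> B). Proof. by []. Qed.
Lemma dmD M N : (M + N) = (M : int -> int -> B) + N :> (int -> int -> B). Proof. by []. Qed.
Lemma dm1 : (1 : dmat) = imone :> (int -> int -> B). Proof. by []. Qed.

End Decay.

Arguments dmat {R} B.

(** * Multiplicativity and conjugation invariance of determinants *)

Local Notation smooth := (im_rapid intsz).

Section Smooth.
Context {R : realType} {B : completeStrongPolymetricType R}.
Implicit Types (X Y Z : int -> int -> B) (p q : sn_index B).

(** The form of the condition in which the two indices can be summed separately. *)
Lemma smoothP X : smooth X <->
  forall p k, exists2 C : R, 0 <= C &
    forall n m, sn p (X n m) * (weight n ^+ k * weight m ^+ k) <= C.
Proof.
have sz0 n : 0 <= intsz n :> R by rewrite ler0n.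
split=> H p k.
  have [C HC] := H p (k + k)%N; exists C => [|n m].
    by apply: le_trans (HC (0, 0)); rewrite mulr_ge0 ?sn_ge0 ?exprn_ge0 ?addr_ge0.
  apply: le_trans (HC (n, m)) => /=; rewrite ler_wpM2l ?sn_ge0 // exprD.
  by apply: ler_pM; rewrite ?weight_exp_ge0 // lerXn2r ?nnegrE ?weight_ge0 ?addr_ge0 //
    /weight lerD2l ?lerDl ?lerDr.
have [C C0 HC] := H p k; exists C => -[n m] /=; apply: le_trans (HC n m).
rewrite ler_wpM2l ?sn_ge0 // -exprMn lerXn2r ?nnegrE ?mulr_ge0 ?weight_ge0 ?addr_ge0 //.
by rewrite /weight; have := sz0 n; have := sz0 m; nra.
Qed.

Definition imtr X : int -> int -> B := fun n m => X m n.

Lemma decay_tr X : decay X -> decay (imtr X).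
Proof.
move=> /decayP dX; apply/decayP => p k; have [C C0 HC] := dX p k.
by exists C => // n m; rewrite -opprB weightN; exact: HC.
Qed.

Lemma smooth_tr X : smooth X -> smooth (imtr X).
Proof.
move=> /smoothP dX; apply/smoothP => p k; have [C C0 HC] := dX p k.
by exists C => // n m; rewrite (mulrC (weight n ^+ k)); exact: HC.
Qed.

Lemma immul_tr X Y : X ** Y = imtr (imtr Y ** imtr X).
Proof.
apply/funext => n; apply/funext => m; rewrite /imtr /immul; congr tsum.
by apply/funext => k; rewrite mulrC.
Qed.

Lemma mulblock_tr N X Y : mulblock N X Y = imtr (mulblock N (imtr Y) (imtr X)).
Proof.
apply/funext => n; apply/funext => m; rewrite /imtr /mulblock.
by apply: eq_bigr => k _; rewrite mulrC.
Qed.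

Lemma smooth_decay X : smooth X -> decay X.
Proof.
move=> /smoothP dX; apply/decayP => p k; have [C C0 HC] := dX p k.
exists C => // n m; apply: le_trans (HC n m); rewrite ler_wpM2l ?sn_ge0 //.
by rewrite -(weightN m); exact: weightX_le.
Qed.

Lemma smooth_mul_bound p K : exists q, forall X Y, decay X -> smooth Y ->
  exists2 C : R, 0 <= C & forall n k m,
    sn p (X n k * Y k m) * (weight n ^+ K * weight m ^+ K) <= C * weight k ^- 2.
Proof.
have [q Hq] := sn_mul p; exists q => X Y /decayP/(_ q K)[C C0 HC].
move=> /smoothP/(_ q (K + 2)%N)[D D0 HD]; exists (C * D); first by rewrite mulr_ge0.
move=> n k m.
apply: (@le_trans _ _ ((sn q (X n k) * weight (n - k) ^+ K) *
   (sn q (Y k m) * (weight k ^+ K * weight m ^+ K)))).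
  rewrite [leRHS]mulrACA; apply: ler_pM; rewrite ?sn_ge0 ?mulr_ge0 ?weight_exp_ge0 //.
  rewrite [leRHS]mulrA ler_wpM2r ?weight_exp_ge0 //.
  by rewrite -{1}(subrK k n) weightX_le.
rewrite -[leRHS]mulrA; apply: ler_pM; rewrite ?mulr_ge0 ?sn_ge0 ?weight_exp_ge0 //.
rewrite mulrA mulrAC; apply: le_invsq; apply: le_trans (HD k m).
rewrite -mulrA ler_wpM2l ?sn_ge0 // [leRHS]mulrC ler_wpM2r ?weight_exp_ge0 //.
by rewrite ler_weXn2l ?weight_ge1 ?leq_addr.
Qed.

Lemma smooth_mull X Y : decay X -> smooth Y -> smooth (X ** Y).
Proof.
move=> dX sY; apply/smoothP => p K.
have [q /(_ X Y dX sY)[C C0 HC]] := smooth_mul_bound p K.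
exists (C * 4) => [|n m]; first by rewrite mulr_ge0.
have w0 : 0 < weight n ^+ K * weight m ^+ K :> R.
  by rewrite mulr_gt0 ?exprn_gt0 ?weight_gt0.
rewrite -ler_pdivlMr //.
apply: (has_sum_le (immul_has_sum n m dX (smooth_decay sY))) => J.
rewrite ler_pdivlMr // mulr_suml; apply: (le_trans (ler_sum _ (fun k _ => HC n k m))).
by rewrite -mulr_sumr ler_wpM2l // sum_weight.
Qed.

Lemma smooth_mulr X Y : smooth X -> decay Y -> smooth (X ** Y).
Proof.
by move=> sX dY; rewrite immul_tr; apply/smooth_tr/smooth_mull;
  [exact: decay_tr|exact: smooth_tr].
Qed.

Lemma smooth0 : smooth (0 : int -> int -> B).
Proof. by move=> p k; exists 0 => x; rewrite sn0 mul0r. Qed.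

Lemma smoothD X Y : smooth X -> smooth Y -> smooth (X + Y).
Proof.
move=> /smoothP dX /smoothP dY; apply/smoothP => p k.
have [C C0 H] := dX p k; have [D D0 K] := dY p k.
exists (C + D) => [|n m]; first by rewrite addr_ge0.
apply: le_trans (lerD (H n m) (K n m)).
by rewrite -mulrDl ler_wpM2r ?snD // mulr_ge0 ?weight_exp_ge0.
Qed.

Lemma smoothN X : smooth X -> smooth (- X).
Proof. by move=> sX p k; have [C H] := sX p k; exists C => x; rewrite snN. Qed.

Lemma smoothB X Y : smooth X -> smooth Y -> smooth (X - Y).
Proof. by move=> sX sY; apply: smoothD => //; exact: smoothN. Qed.

Lemma dominated_smooth X : smooth X -> exists C, dominated C X.
Proof.
move=> /smoothP sX.
have /choice[C HC] : forall p, exists C : R, forall n m,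
    sn p (X n m) <= C * (weight n ^- 2 * weight m ^- 2).
  move=> p; have [C C0 HC] := sX p 2%N; exists C => n m.
  by rewrite -invfM ler_pdivlMr ?mulr_gt0 ?exprn_gt0 ?weight_gt0.
by exists C => p n m.
Qed.

Lemma dominated_mulblock X Y : decay X -> smooth Y ->
  exists C, forall N, dominated C (mulblock N X Y).
Proof.
move=> dX sY.
have /choice[C HC] : forall p, exists C : R, forall N n m,
    sn p (mulblock N X Y n m) <= C * (weight n ^- 2 * weight m ^- 2).
  move=> p; have [q /(_ X Y dX sY)[C C0 HC]] := smooth_mul_bound p 2.
  exists (C * 4) => N n m.
  have w0 : 0 < weight n ^+ 2 * weight m ^+ 2 :> R.
    by rewrite mulr_gt0 ?exprn_gt0 ?weight_gt0.
  rewrite -invfM ler_pdivlMr //.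
  apply: (@le_trans _ _ (\sum_(k <- block N) sn p (X n k * Y k m) *
      (weight n ^+ 2 * weight m ^+ 2))).
    by rewrite -mulr_suml ler_wpM2r ?(ltW w0) // sn_sum.
  apply: (le_trans (ler_sum _ (fun k _ => HC n k m))).
  by rewrite -mulr_sumr ler_wpM2l // sum_weight.
by exists C => N p n m.
Qed.

Lemma dominated_tr C X : dominated C X -> dominated C (imtr X).
Proof. by move=> H p n m; rewrite mulrC mulrC (mulrC (weight n ^- 2)); exact: H. Qed.

Lemma dominated_mulblockr X Y : smooth X -> decay Y ->
  exists C, forall N, dominated C (mulblock N X Y).
Proof.
move=> sX dY; have [C HC] := dominated_mulblock (decay_tr dY) (smooth_tr sX).
by exists C => N; rewrite mulblock_tr; exact: dominated_tr.
Qed.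

Lemma dominatedD C D X Y : dominated C X -> dominated D Y ->
  dominated (fun p => C p + D p) (X + Y).
Proof.
by move=> HX HY p n m; rewrite mulrDl; apply: le_trans (snD _ _ _) _; rewrite lerD.
Qed.

Lemma mulblock_cvg X Y n m : decay X -> decay Y ->
  cvg_sn (fun N => mulblock N X Y n m) ((X ** Y) n m).
Proof.
move=> dX dY; apply: has_sum_fin_cvg (immul_has_sum n m dX dY) => k.
by exists `|k|%N => N kN; rewrite in_block.
Qed.

End Smooth.

Section Determinants.
Context {R : realType} {B : completeStrongPolymetricType R}.
Implicit Types (X Y Z : dmat B).

Lemma bidiag_pred0 : bidiag 1 pred0 = imone :> (int -> int -> B).
Proof.
by apply/funext => n; apply/funext => m; rewrite /bidiag andbF subr0.
Qed.

Lemma det_cvg (X_ : nat -> int -> int -> B) (X : int -> int -> B) C : smooth X ->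
  (forall N, dominated C (X_ N)) ->
  (forall n m, cvg_sn (fun N => X_ N n m) (X n m)) ->
  cvg_sn (fun N => fdet N (imone + X_ N)) (tdet (imone + X)).
Proof.
move=> /dominated_smooth[C' HC'] HC XX; rewrite -bidiag_pred0.
exact: (fdet_cvg (d := 1) pred0 isT HC HC' XX).
Qed.

Lemma det_cvg_smooth X : smooth X -> tdet_cvg (1 + X).
Proof.
move=> /dominated_smooth[C HC]; rewrite dmD dm1 -bidiag_pred0.
exact: (tdet_cvg_bidiag (d := 1) pred0 isT HC).
Qed.

Lemma det_defined_smooth X : smooth (X - 1 : dmat B) -> det_defined intsz X.
Proof.
by move=> sX; split=> //; rewrite -[X](subrK 1) addrC; exact: det_cvg_smooth.
Qed.

Lemma fdet1D N (X : int -> int -> B) : fdet N (imone + X) = \det (1%:M + section_mx N X).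
Proof. by rewrite /fdet section_mxD section_mx1. Qed.

Theorem det_mul X Y : smooth X -> smooth Y ->
  tdet ((1 + X) * (1 + Y)) = tdet (1 + X) * tdet (1 + Y).
Proof.
move=> sX sY.
have [CX HX] := dominated_smooth sX; have [CY HY] := dominated_smooth sY.
have [C HC] := dominated_mulblockr sX (dmP Y).
have -> : (1 + X) * (1 + Y) = 1 + (X + Y + X * Y).
  by rewrite mulrDl mul1r mulrDr mulr1 -!addrA; congr (1 + _); rewrite addrCA.
have sXY : smooth ((X : int -> int -> B) + Y + X ** Y).
  by apply: smoothD; [exact: smoothD|exact: smooth_mulr sX (dmP Y)].
have cXY := det_cvg sXY (fun N => dominatedD (dominatedD HX HY) (HC N))
  (fun n m => cvg_snD (cvg_sn_cst _) (mulblock_cvg n m (dmP X) (dmP Y))).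
apply: cvg_sn_unique cXY _.
have cX := det_cvg sX (fun=> HX) (fun n m => cvg_sn_cst (X n m)).
have cY := det_cvg sY (fun=> HY) (fun n m => cvg_sn_cst (Y n m)).
apply: eq_cvg_sn (cvg_snM cX cY) => N.
rewrite !fdet1D !section_mxD section_mxM -det_mulmx mulmxDl mul1mx mulmxDr mulmx1.
by rewrite -!addrA; congr (\det (_ + _)); rewrite addrCA.
Qed.

Lemma det_sylvester_mx (A : comPzRingType) n (M N : 'M[A]_n) :
  \det (1%:M + M *m N) = \det (1%:M + N *m M).
Proof.
have E1 : block_mx 1%:M (- M) N 1%:M =
    block_mx 1%:M (- M) 0 1%:M *m block_mx (1%:M + M *m N) 0 N 1%:M.
  by rewrite mulmx_block !mul1mx !mul0mx !mulmx1 mulNmx addrK !add0r.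
have E2 : block_mx 1%:M (- M) N 1%:M =
    block_mx 1%:M 0 N 1%:M *m block_mx 1%:M (- M) 0 (1%:M + N *m M).
  by rewrite mulmx_block !mul1mx !mul0mx !mulmx1 mulmxN !addr0 (addrC 1%:M) addKr.
have := congr1 determinant E1; rewrite E2 !det_mulmx det_ublock det_lblock.
by rewrite det_ublock det_lblock !det1 !mul1r !mulr1.
Qed.

(** Conjugation invariance comes from this identity, which holds for finite blocks
    too, whereas the blocks of mutually inverse matrices are not mutually
    inverse. *)
Theorem det_sylvester X Y : smooth Y -> tdet (1 + X * Y) = tdet (1 + Y * X).
Proof.
move=> sY; have [C HC] := dominated_mulblock (dmP X) sY.
have [D HD] := dominated_mulblockr sY (dmP X).
have c1 := det_cvg (smooth_mull (dmP X) sY) HC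
  (fun n m => mulblock_cvg n m (dmP X) (dmP Y)).
have c2 := det_cvg (smooth_mulr sY (dmP X)) HD
  (fun n m => mulblock_cvg n m (dmP Y) (dmP X)).
apply: cvg_sn_unique c1 _; apply: eq_cvg_sn c2 => N.
by rewrite !fdet1D !section_mxM det_sylvester_mx.
Qed.

Lemma det_conj X Y Z : smooth Z -> Y * X = 1 ->
  tdet (1 + X * Z * Y) = tdet (1 + Z).
Proof.
move=> sZ YX; rewrite -mulrA det_sylvester; last exact: smooth_mulr sZ (dmP Y).
by rewrite -mulrA YX mulr1.
Qed.

Lemma det_block_bidiag d P N : d != 0 -> fdet N (bidiag d P) = 1 :> B.
Proof.
move=> d0; have diag (M : 'M[B]_(N.*2.+1)) :
    (forall i, M i i = 1) -> is_trig_mx M -> \det M = 1.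
  by move=> Hd /det_trig ->; rewrite big1.
have off n m : (n != m) -> (m != n + d) -> bidiag d P n m = 0 :> B.
  by move=> /negPf nm /negPf nmd; rewrite /bidiag nm nmd subr0.
have [dlt|dge] := ltP d 0.
  apply: diag => [i|]; first by rewrite mxE bidiag_diag.
  apply/is_trig_mxP => i j ij; rewrite mxE /block_point.
  by apply: off; apply/eqP; lia.
rewrite /fdet -det_tr; apply: diag => [i|]; first by rewrite !mxE bidiag_diag.
apply/is_trig_mxP => i j ij; rewrite !mxE /block_point.
by apply: off; apply/eqP; lia.
Qed.

(** In (1 + X) Y = Y + X Y only the second term needs to be approximated. If it is
    replaced by the product over the block, then the block of the sum is the
    product of the blocks of 1 + X and of Y, and the latter is triangular with
    unit diagonal. *)
Theorem tdet_mul_bidiag d P X Y : d != 0 -> smooth X -> Y = bidiag d P :> (int -> int -> B) ->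
  tdet_cvg ((1 + X) * Y) /\ tdet ((1 + X) * Y) = tdet (1 + X).
Proof.
move=> d0 sX YE; have [C HC] := dominated_mulblockr sX (dmP Y).
have [CX HX] := dominated_smooth sX.
have sXY : smooth (X * Y) by exact: smooth_mulr sX (dmP Y).
have [CXY HXY] := dominated_smooth sXY.
have -> : (1 + X) * Y = bidiag d P + (X * Y : dmat B) :> (int -> int -> B).
  by rewrite mulrDl mul1r dmD YE.
split; first exact: (tdet_cvg_bidiag P d0 HXY).
apply: cvg_sn_unique (fdet_cvg P d0 HC HXY
  (fun n m => mulblock_cvg n m (dmP X) (dmP Y))) _.
apply: eq_cvg_sn (det_cvg sX (fun=> HX) (fun n m => cvg_sn_cst (X n m))) => N.
have -> : fdet N (bidiag d P + mulblock N X Y) =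
    \det ((1%:M + section_mx N X) *m section_mx N Y).
  by rewrite /fdet section_mxD section_mxM -YE mulmxDl mul1mx.
rewrite det_mulmx fdet1D; have := det_block_bidiag P N d0; rewrite /fdet -YE => ->.
by rewrite mulr1.
Qed.

End Determinants.

(** * Laurent series form a complete strong polymetric ring *)

Section LaurentRing.
Context {R : realType} {A : completeStrongPolymetricType R}.
Implicit Types (a b c : laurent A) (p q : sn_index A).

Lemma lsn_le p k a (M : R) :
  (forall J : {fset int}, \sum_(n <- J) sn p (a n) * weight n ^+ k <= M) ->
  lsn (p, k) a <= M.
Proof.
move=> H; rewrite -lee_fin /lsn fineK ?lsn_fin //.
exact: esum_bounded.
Qed.

Lemma le_lsn p k a (J : {fset int}) :
  \sum_(n <- J) sn p (a n) * weight n ^+ k <= lsn (p, k) a.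
Proof.
rewrite -lee_fin /lsn fineK ?lsn_fin //.
apply: (@sum_le_esum R int (fun n => sn p (a n) * (1 + intsz n) ^+ k)) => n.
by rewrite mulr_ge0 ?sn_ge0 ?weight_exp_ge0.
Qed.

Lemma le_lsn1 p k a n : sn p (a n) * weight n ^+ k <= lsn (p, k) a.
Proof. by have := le_lsn p k a [fset n]%fset; rewrite big_seq_fset1. Qed.

Lemma lcoefM a b n : has_sum (fun i => a i * b (n - i)) ((a * b) n).
Proof. by apply: conv_sum; exact: lcoef_rapid. Qed.

(** The first list collects the coefficients already extracted from the first
    factors of the product: the seminorm [p] must be compared with [q] once for
    the whole product, since a comparison at each factor would change the
    seminorm each time. *)
Lemma lsn_prod p q k : (forall s : seq A, s != [::] ->
    sn p (\prod_(x <- s) x) <= \prod_(x <- s) sn q x) ->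
  forall (s : seq (laurent A)) (y : seq A), (size y + size s != 0)%N ->
  forall J : {fset int},
    \sum_(n <- J) sn p (\prod_(x <- y) x * (\prod_(a <- s) a) n) * weight n ^+ k <=
    \prod_(x <- y) sn q x * \prod_(a <- s) lsn (q, k) a.
Proof.
move=> Hq; elim=> [|a s IH] y ys J.
  move: ys; rewrite /= addn0 => ys; rewrite !big_nil mulr1.
  apply: (@le_trans _ _ (\sum_(n <- J) if n == 0 then sn p (\prod_(x <- y) x) else 0)).
    apply: ler_sum => n _ /=; rewrite /mono; case: eqP => [->|_].
      by rewrite mulr1 /weight /intsz addr0 expr1n mulr1.
    by rewrite mulr0 sn0 mul0r.
  apply: le_trans (Hq y _); last by rewrite -size_eq0.
  rewrite -big_mkcond /= -big_filter; set L := (X in \sum_(_ <- X) _).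
  have : (size L <= 1)%N.
    by rewrite /L size_filter [count _ _](count_uniq_mem 0 (fset_uniq J)); case: (_ \in _).
  case: L => [|x [|//]] _; first by rewrite big_nil sn_ge0.
  by rewrite big_seq1.
rewrite big_cons; set c := \prod_(a <- s) a.
pose f (x : int * int) := \prod_(x <- y) x * (a x.2 * c (x.1 - x.2)).
have fr n : has_sum (fun i => f (n, i)) (\prod_(x <- y) x * (a * c) n).
  rewrite mulrC; apply: eq_has_sum (has_sumMr _ (lcoefM a c n)) => i.
  by rewrite mulrC.
apply: (sum_sn_has_sum J (fun n => weight_exp_ge0 n k) fr) => L.
pose L2 := [fset x.2 | x in L]%fset; pose L1 := [fset x.1 - x.2 | x in L]%fset.
pose g (x : int * int) := sn p (\prod_(z <- a x.1 :: y) z * c x.2) *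
  (weight x.1 ^+ k * weight x.2 ^+ k).
have g0 x : 0 <= g x by rewrite !mulr_ge0 ?sn_ge0 ?weight_exp_ge0.
apply: (@le_trans _ _ (\sum_(x <- L) g (x.2, x.1 - x.2))).
  apply: ler_sum => -[n i] _; rewrite /f /g /= big_cons.
  rewrite mulrCA mulrA ler_wpM2l ?sn_ge0 //.
  by rewrite -{1}(subrK i n) addrC weightX_le.
have hI : injective (fun x : int * int => (x.2, x.1 - x.2)).
  by move=> [i j] [i' j'] [-> /addIr ->].
rewrite -(big_fset_inj _ g L hI).
apply: (@le_trans _ _ (\sum_(x <- (L2 `*` L1)%fset) g x)).
  apply: ler_sum_sub => //.
  move=> _ /imfsetP[x /= xL ->]; rewrite in_fsetM /=.
  by apply/andP; split; apply/imfsetP; exists x.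
rewrite big_fsetM big_cons.
apply: (@le_trans _ _ (\sum_(i <- L2) (sn q (a i) * weight i ^+ k) *
   (\prod_(x <- y) sn q x * \prod_(b <- s) lsn (q, k) b))).
  apply: ler_sum => i _; rewrite /g /=.
  have := IH (a i :: y) isT L1; rewrite [X in _ <= X * _]big_cons => H.
  under eq_bigr => j _ do rewrite mulrCA.
  rewrite -mulr_sumr (mulrC (sn q (a i))) -mulrA.
  by rewrite ler_wpM2l ?weight_exp_ge0 // mulrA; exact: H.
rewrite -mulr_suml [leRHS]mulrCA ler_wpM2r ?le_lsn //.
by apply: mulr_ge0; apply: prodr_ge0 => *; rewrite ?sn_ge0 // (lsn_ge0 (q, k)).
Qed.

Lemma laurent_strong (pk : sn_index (laurent A)) : exists qk : sn_index (laurent A),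
  forall s : seq (laurent A), s != [::] ->
  sn pk (\prod_(x <- s) x) <= \prod_(x <- s) sn qk x.
Proof.
case: pk => p k; have [q Hq] := sn_strong p; exists (q, k) => s s0.
apply: lsn_le => J; have := @lsn_prod p q k Hq s [::] _ J.
rewrite big_nil [X in _ <= X * _]big_nil mul1r size_eq0 => /(_ s0).
by apply: le_trans; apply: ler_sum => n _; rewrite mul1r.
Qed.

Lemma laurent_separated (a : laurent A) : (forall pk, sn pk a = 0) -> a = 0.
Proof.
move=> H; apply/val_inj/funext => n; apply: (@sn_separated R A) => p.
apply/eqP; rewrite eq_le sn_ge0 andbT.
by have := le_lsn1 p 0 a n; rewrite expr0 mulr1 [lsn _ _](H (p, 0%N)).
Qed.

Lemma laurent_complete (u : nat -> laurent A) : cauchy_sn u -> exists l, cvg_sn u l.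
Proof.
move=> cu.
have cu' n : cauchy_sn (fun m => u m n).
  move=> p e e0; have [N HN] := cu (p, 0%N) e e0; exists N => i j iN jN.
  apply: le_lt_trans (HN i j iN jN).
  by have := le_lsn1 p 0 (u i - u j) n; rewrite expr0 mulr1.
have /choice[l Hl] := fun n => sn_complete _ (cu' n).
have fin p k (J : {fset int}) (e : R) : 0 < e -> forall N0, exists2 m, (N0 <= m)%N &
    \sum_(n <- J) sn p (u m n - l n) * weight n ^+ k <= e.
  move=> e0 N0; set W := \sum_(n <- J) weight n ^+ k : R.
  have W0 : 0 < 1 + W by rewrite ltr_wpDr // sumr_ge0 // => n _; exact: weight_exp_ge0.
  have /choice[N HN] := fun n => Hl n p _ (divr_gt0 e0 W0).
  exists (maxn N0 (\max_(n <- J) N n)); first exact: leq_maxl.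
  apply: (@le_trans _ _ (\sum_(n <- J) e / (1 + W) * weight n ^+ k)).
    rewrite big_seq [leRHS]big_seq; apply: ler_sum => n nJ.
    rewrite ler_wpM2r ?weight_exp_ge0 // ltW // HN //.
    by rewrite leq_max (bigD1_seq n nJ (fset_uniq J)) /= leq_maxl orbT.
  by rewrite -mulr_sumr -/W mulrAC ler_pdivrMr // ler_wpM2l ?(ltW e0) // lerDr.
have lim p k (e : R) : 0 < e -> exists N, forall m, (N <= m)%N -> forall J : {fset int},
    \sum_(n <- J) sn p (u m n - l n) * weight n ^+ k <= e.
  move=> e0; have e2 : 0 < e / 2 by rewrite divr_gt0.
  have [N HN] := cu (p, k) _ e2; exists N => m Nm J.
  have [m' Nm' Hm'] := fin p k J _ e2 N.
  rewrite [leRHS]splitr; apply: le_trans (lerD (ltW (HN m m' Nm Nm')) Hm').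
  apply: le_trans (lerD (le_lsn p k (u m - u m') J) (lexx _)).
  rewrite -big_split; apply: ler_sum => n _ /=.
  rewrite -mulrDl ler_wpM2r ?weight_exp_ge0 // -(subrKA (u m' n)).
  exact: snD.
have rl : rapid intsz l.
  move=> p k; have [N HN] := lim p k 1 ltr01.
  have [C HC] := lcoef_rapid (u N) p k; exists (C + 1) => n.
  have := HN N (leqnn _) [fset n]%fset; rewrite big_seq_fset1 => H.
  apply: le_trans (lerD (HC n) H); rewrite -mulrDl ler_wpM2r ?weight_exp_ge0 //.
  by rewrite -{1}(subKr (u N n) (l n)) snB.
exists (Laurent (introT (rapid_seqP _) rl)) => -[p k] e e0.
have e2 : 0 < e / 2 by rewrite divr_gt0.
have [N HN] := lim p k _ e2; exists N => m Nm.
apply: (@le_lt_trans _ _ (e / 2)); last by rewrite ltr_pdivrMr // ltr_pMr // ltr1n.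
by apply: lsn_le => J; exact: HN.
Qed.

(** The theory above applies to matrices with entries in A[w^-1, w]. *)
HB.instance Definition _ := isCompleteStrongPolymetric.Build R (laurent A)
  laurent_strong laurent_separated laurent_complete.

End LaurentRing.

(** * Monomials *)

Section LaurentMonomials.
Context {R : realType} {A : completeStrongPolymetricType R}.
Implicit Types (a b c : laurent A) (p q : sn_index A).

Lemma lmono_coefM (x : A) j c n : (lmono x j * c) n = x * c (n - j).
Proof.
apply: (has_sum_unique (lcoefM (lmono x j) c n)).
have := @has_sum_fin R A int (fun i => lmono x j i * c (n - i)) [fset j]%fset.
rewrite big_seq_fset1 /= /mono eqxx; apply=> i.
by rewrite in_fset1 => /negPf->; rewrite mul0r.
Qed.

Lemma lconst_coefM (x : A) c n : (lconst x * c) n = x * c n.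
Proof. by rewrite lmono_coefM subr0. Qed.

Lemma lX_coefM j c n : (lX j * c) n = c (n - j).
Proof. by rewrite lmono_coefM mul1r. Qed.

Lemma laurent_eq a b : (forall n, a n = b n) -> a = b.
Proof. by move=> E; apply/val_inj/funext. Qed.

Lemma lmonoM (x y : A) i j : lmono x i * lmono y j = lmono (x * y) (i + j).
Proof.
apply: laurent_eq => n; rewrite lmono_coefM /= /mono subr_eq addrC.
by case: eqP; rewrite ?mulr0.
Qed.

Lemma lX0 : lX 0 = 1 :> laurent A. Proof. by []. Qed.

Lemma lXD i j : lX (i + j) = lX i * lX j :> laurent A.
Proof. by rewrite lmonoM mul1r. Qed.

Lemma lXNr j : lX j * lX (- j) = 1 :> laurent A.
Proof. by rewrite -lXD subrr. Qed.

Lemma lconstM (x y : A) : lconst (x * y) = lconst x * lconst y.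
Proof. by rewrite lmonoM addr0. Qed.

Lemma lconst1 : lconst 1 = 1 :> laurent A. Proof. by []. Qed.

Lemma lconst0 : lconst 0 = 0 :> laurent A.
Proof. by apply: laurent_eq => n; rewrite /= /mono; case: eqP. Qed.

Lemma lconstB (x y : A) : lconst (x - y) = lconst x - lconst y.
Proof.
apply: laurent_eq => n; rewrite -[RHS]/(lconst x n - lconst y n) /= /mono.
by case: eqP => // _; rewrite subr0.
Qed.

Lemma lconstD (x y : A) : lconst (x + y) = lconst x + lconst y.
Proof.
apply: laurent_eq => n; rewrite -[RHS]/(lconst x n + lconst y n) /= /mono.
by case: eqP => // _; rewrite addr0.
Qed.

Lemma lconst_sum (I : Type) (r : seq I) (f : I -> A) :
  lconst (\sum_(i <- r) f i) = \sum_(i <- r) lconst (f i).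
Proof.
elim: r => [|i r IH]; first by rewrite !big_nil lconst0.
by rewrite !big_cons lconstD IH.
Qed.

Lemma sn_lconst p k (x : A) : sn ((p, k) : sn_index (laurent A)) (lconst x) <= sn p x.
Proof.
apply: lsn_le => J /=.
rewrite (eq_bigr (fun n => if n == 0 then sn p x else 0)) => [|n _]; last first.
  rewrite /mono; case: eqP => [->|_]; last by rewrite sn0 mul0r.
  by rewrite /weight /intsz addr0 expr1n mulr1.
have [J0|J0] := boolP (0 \in J); last first.
  rewrite big_seq big1 ?sn_ge0 // => n nJ; case: eqP => // n0.
  by move: J0; rewrite -n0 nJ.
rewrite (big_fsetD1 0 J0) /= big_seq big1 ?addr0 // => n.
by rewrite in_fsetD1 => /andP[/negPf -> _].
Qed.

Lemma has_sum_lconst (I : choiceType) (f : I -> A) x :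
  has_sum f x -> has_sum (fun i => lconst (f i)) (lconst x).
Proof.
move=> fx [p k] e e0; have [J0 H] := fx p e e0; exists J0 => J /H.
by rewrite -lconst_sum -lconstB; apply: le_lt_trans; exact: sn_lconst.
Qed.

Lemma sn_lX p k j c : sn ((p, k) : sn_index (laurent A)) (lX j * c) <=
  weight j ^+ k * sn ((p, k) : sn_index (laurent A)) c.
Proof.
apply: lsn_le => J.
apply: (@le_trans _ _ (\sum_(n <- J) weight j ^+ k * (sn p (c (n - j)) * weight (n - j) ^+ k))).
  apply: ler_sum => n _; rewrite lX_coefM [leRHS]mulrCA ler_wpM2l ?sn_ge0 //.
  by rewrite -{1}(subrK j n) addrC weightX_le.
rewrite -mulr_sumr ler_wpM2l ?weight_exp_ge0 //.
rewrite -(big_fset_inj _ (fun n => sn p (c n) * weight n ^+ k) J (sub_injl (n := j))).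
exact: le_lsn.
Qed.

(** This turns the sum over j in F U(a) F^-1 into an explicit series in w. *)
Lemma has_sum_monomials c : has_sum (fun i => lconst (c i) * lX i) c.
Proof.
move=> [p k] e e0; have e2 : 0 < e / 2 by rewrite divr_gt0.
have g0 n : 0 <= sn p (c n) * weight n ^+ k by rewrite mulr_ge0 ?sn_ge0 ?weight_exp_ge0.
have gfin : (\esum_(n in [set: int]) (sn p (c n) * weight n ^+ k)%:E < +oo)%E.
  have := lsn_fin p k c; rewrite ge0_fin_numE //.
  by apply: esum_ge0 => n _; rewrite lee_fin g0.
have [J0 HJ0] := esum_tail g0 gfin e2; exists J0 => J J0J.
apply: (@le_lt_trans _ _ (e / 2)); last by rewrite ltr_pdivrMr // ltr_pMr // ltr1n.
have sumE n : (\sum_(i <- J) lconst (c i) * lX i : laurent A) n = if n \in J then c n else 0.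
  have coef_sum (r : seq int) (f : int -> laurent A) :
      (\sum_(i <- r) f i : laurent A) n = \sum_(i <- r) f i n.
    elim: r => [|i r IH]; first by rewrite !big_nil.
    by rewrite !big_cons -IH.
  rewrite coef_sum.
  have E i : (lconst (c i) * lX i) n = if n == i then c n else 0.
    by rewrite lconst_coefM /= /mono; case: eqP => [->|]; rewrite ?mulr1 ?mulr0.
  under eq_bigr => i _ do rewrite E.
  case: ifP => nJ.
    rewrite (big_fsetD1 n nJ) /= eqxx big_seq big1 ?addr0 // => i.
    by rewrite in_fsetD1 eq_sym => /andP[/negPf -> _].
  by rewrite big_seq big1 // => i iJ; case: eqP nJ iJ => // <- ->.
move: sumE; set S := \sum_(i <- J) _ => sumE; apply: lsn_le => K.
pose F n := if n \in J then 0 else sn p (c n) * weight n ^+ k.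
apply: (@le_trans _ _ (\sum_(n <- K) F n)).
  apply: ler_sum => n _; rewrite /F -[(c - S) n]/(c n - S n) sumE.
  by case: ifP => _; rewrite ?subrr ?sn0 ?mul0r ?subr0.
rewrite -(@big_fset_incl _ _ _ _ (K `\` J)%fset K F) ?fsubsetDl //; last first.
  by move=> n nK; rewrite in_fsetD nK andbT negbK /F => ->.
apply/ltW; rewrite big_seq (eq_bigr (fun n => sn p (c n) * weight n ^+ k)) => [|n].
  rewrite -big_seq; apply: HJ0; apply/fdisjointP => n nJ0.
  by rewrite in_fsetD (fsubsetP J0J).
by rewrite in_fsetD /F => /andP[/negPf -> _].
Qed.

End LaurentMonomials.

(** * Toeplitz matrices and the matrices F *)

Section LaurentMatrices.
Context {R : realType} {A : completeStrongPolymetricType R}.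
Local Notation B := (laurent A).
Implicit Types (a b c : laurent A) (X Y : int -> int -> B) (M N : dmat B).

Lemma lconst_decay (f : int -> A) : rapid intsz f -> decay (laurent_mx (fun n => lconst (f n))).
Proof.
move=> rf; apply/decayP => -[p l] k; have [C HC] := rf p k; exists C => [|n m].
  by apply: le_trans (HC 0); rewrite mulr_ge0 ?sn_ge0 ?weight_exp_ge0.
apply: le_trans (HC (n - m)); rewrite ler_wpM2r ?weight_exp_ge0 //.
exact: sn_lconst.
Qed.

Lemma U_decay a : decay (U a).
Proof. exact/lconst_decay/lcoef_rapid. Qed.

Definition dU a : dmat B := dmk (U_decay a).

Lemma dU1 : dU 1 = 1.
Proof.
apply/val_inj/funext => n; apply/funext => m.
rewrite /= /U /laurent_mx /= /mono subr_eq0 /imone.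
by case: eqP => _; [exact: lconst1|rewrite lconst0].
Qed.

Lemma dUM a b : dU (a * b) = dU a * dU b.
Proof.
apply/val_inj/funext => n; apply/funext => m.
apply: (has_sum_unique _ (immul_has_sum n m (U_decay a) (U_decay b))).
have := has_sum_lconst (lcoefM a b (n - m)).
have h1 : cancel (fun k : int => n - k) (fun k => n - k) by move=> k; rewrite subKr.
move/(has_sum_bij h1 h1); apply: eq_has_sum => k /=.
rewrite lconstM /U /laurent_mx; congr (_ * lconst (b _)); ring.
Qed.

Lemma dU_comm a b : dU a * dU b = dU b * dU a.
Proof. by rewrite -!dUM mulrC. Qed.

Lemma imind_decay (P : pred int) : decay (imind P : int -> int -> B).
Proof.
apply: (@decay_sparse _ _ _ 0) => [n m nm|p].
  by rewrite /imind; case: eqP nm => // ->; rewrite subrr.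
exists (sn p 1) => n m; rewrite /imind; case: (_ && _) => //.
by rewrite sn0 sn_ge0.
Qed.

Lemma imind_mul (P : pred int) X n m : (imind P ** X) n m = (P n)%:R * X n m.
Proof.
rewrite (immul_single (k0 := n)) /imind ?eqxx //.
by move=> k /negPf kn; rewrite eq_sym kn mul0r.
Qed.

Lemma mul_imind (P : pred int) X n m : (X ** imind P) n m = X n m * (P m)%:R.
Proof.
rewrite (immul_single (k0 := m)) /imind ?eqxx //.
by move=> k /negPf kn; rewrite kn mulr0.
Qed.

Lemma toeplitz_decay X : toeplitz X -> decay X.
Proof.
case=> an [ap [Z [ran rap rZ ->]]].
have rmx (f : int -> B) : rapid intsz f -> decay (laurent_mx f).
  move=> rf p k; have [C HC] := rf p k; exists C => -[n m]; exact: HC.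
apply: decayD; last exact: smooth_decay.
by apply: decayD; apply: decay_immul (imind_decay _); apply: decay_immul (imind_decay _) _;
  exact: rmx.
Qed.

(** Toeplitz matrices lie in the ring [dmat], where inverses are unique; this
    determines the choice made in [tinv]. *)
Lemma tinvE M N : toeplitz N -> M * N = 1 -> N * M = 1 ->
  inverse_in toeplitz M N /\ tinv M = N.
Proof.
move=> tN MN NM.
have HN : inverse_in toeplitz M N by split=> //; rewrite -dmM ?MN ?NM.
split=> //; rewrite /tinv /iminv.
have [tY MY YM] := @xgetPex _ 0 (inverse_in toeplitz M) (ex_intro _ _ HN).
set Y := xget _ _ in tY MY YM *.
have E : M * dmk (toeplitz_decay tY) = 1 by apply: val_inj; exact: MY.
by rewrite -[Y]/(dm (dmk (toeplitz_decay tY))) -[dmk _]mul1r -NM -mulrA E mulr1.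
Qed.

(** Multiplying the (n, m) entry by w^(n - m) is conjugation by an (unbounded)
    diagonal matrix. It turns the entry - w of the bidiagonal matrices F into
    - 1, while preserving determinants and all decay conditions. *)
Definition twist X : int -> int -> B := fun n m => lX (n - m) * X n m.

Lemma twist_decay X : decay X -> decay (twist X).
Proof.
move=> /decayP dX; apply/decayP => -[p l] k.
have [C C0 HC] := dX (p, l) (l + k)%N; exists C => // n m.
apply: le_trans (HC n m); rewrite exprD mulrA ler_wpM2r ?weight_exp_ge0 //.
by rewrite [leRHS]mulrC; exact: sn_lX.
Qed.

Lemma twist_smooth X : smooth X -> smooth (twist X).
Proof.
move=> /smoothP sX; apply/smoothP => -[p l] k.
have [C C0 HC] := sX (p, l) (l + k)%N; exists C => // n m.
apply: le_trans (HC n m); rewrite !exprD mulrACA [leRHS]mulrA.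
rewrite ler_wpM2r ?mulr_ge0 ?weight_exp_ge0 // [leRHS]mulrC.
apply: le_trans (sn_lX _ _ _ _) _; rewrite ler_wpM2r ?sn_ge0 //.
by rewrite -(weightN m) weightX_le.
Qed.

Definition dtwist M : dmat B := dmk (twist_decay (dmP M)).

Lemma dtwistM M N : dtwist (M * N) = dtwist M * dtwist N.
Proof.
apply/val_inj/funext => n; apply/funext => m.
apply: (has_sum_unique _ (immul_has_sum n m (dmP (dtwist M)) (dmP (dtwist N)))).
rewrite /= /twist mulrC.
apply: eq_has_sum (has_sumMr (lX (n - m)) (immul_has_sum n m (dmP M) (dmP N))) => k.
by rewrite (_ : n - m = (n - k) + (k - m)) ?lXD; ring.
Qed.

Lemma dtwistD M N : dtwist (M + N) = dtwist M + dtwist N.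
Proof.
apply/val_inj/funext => n; apply/funext => m.
by rewrite /= /twist -mulrDr.
Qed.

Lemma dtwist1 : dtwist 1 = 1.
Proof.
apply/val_inj/funext => n; apply/funext => m.
rewrite /= /twist /imone; case: eqP => [->|_]; last by rewrite mulr0.
by rewrite subrr mulr1.
Qed.

Lemma tdet_twist M : tdet_cvg (dtwist M) -> tdet_cvg M /\ tdet M = tdet (dtwist M).
Proof.
have -> : dtwist M = (fun n m => lX n * M n m * lX (- m)) :> (int -> int -> B).
  by apply/funext => n; apply/funext => m; rewrite /= /twist lXD; ring.
by move=> H; apply: tdet_diag_conj H => n; exact: lXNr.
Qed.

Section Bidiagonal.
Variable e : int.
Hypothesis he : e = 1 \/ e = -1.

(** The sign e treats the two matrices F at once: at t = 1, F^{R+} is [dF] for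
    e = 1 and F^{R-} is [dF] for e = -1. *)
Definition Fpred : pred int := fun n => e * n < 0.

Definition Nmx : int -> int -> B :=
  fun n m => lX e * ((m == n + e) && Fpred n)%:R.

Lemma Nmx_decay : decay Nmx.
Proof.
apply: (@decay_sparse _ _ _ 1) => [n m nm|p].
  by rewrite /Nmx (_ : (m == n + e) = false) ?mulr0 //; apply/negP => /eqP; lia.
exists (sn p (lX e)) => n m; rewrite /Nmx; case: (_ && _); rewrite ?mulr1 //.
by rewrite mulr0 sn0 sn_ge0.
Qed.

Definition dN : dmat B := dmk Nmx_decay.
Definition dF : dmat B := 1 - dN.

Lemma dN_mul M n m : (dN * M) n m = lX e * (Fpred n)%:R * M (n + e) m.
Proof.
rewrite dmM (immul_single (k0 := (n + e))) /= /Nmx ?eqxx //.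
by move=> k /negPf ->; rewrite mulr0 mul0r.
Qed.

Lemma mul_dN M n m : (M * dN) n m = M n (m - e) * (lX e * (Fpred (m - e))%:R).
Proof.
rewrite dmM (immul_single (k0 := (m - e))) /= /Nmx ?subrK ?eqxx // => k km.
rewrite (_ : (m == k + e) = false) ?mulr0 //.
by apply/negP => /eqP E; case/eqP: km; rewrite E addrK.
Qed.

Lemma dtwist_dF : dtwist dF = bidiag e Fpred :> (int -> int -> B).
Proof.
apply/funext => n; apply/funext => m; rewrite -[LHS]/(lX (n - m) * (imone n m - Nmx n m)).
rewrite mulrBr /bidiag /imone /Nmx; congr (_ - _).
  by case: eqP => [->|_]; rewrite ?mulr0 // subrr mul1r.
case: eqP => [->|_]; rewrite /= ?mulr0 //.
rewrite mulrA -lXD (_ : n - (n + e) + e = 0) ?mul1r //; ring.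
Qed.

Lemma e_neq0 : e != 0. Proof. by case: he => ->. Qed.

Theorem tdet_mul_F M : smooth M ->
  tdet_cvg ((1 + M) * dF) /\ tdet ((1 + M) * dF) = tdet (1 + M).
Proof.
move=> sM; have sM' : smooth (dtwist M) by exact: twist_smooth.
have E1 : dtwist (1 + M) = 1 + dtwist M by rewrite dtwistD dtwist1.
have E2 : dtwist ((1 + M) * dF) = (1 + dtwist M) * dtwist dF by rewrite dtwistM E1.
have [c d] := tdet_mul_bidiag e_neq0 sM' dtwist_dF.
rewrite -E2 in c d; rewrite -E1 in d.
have c' := det_cvg_smooth sM'; rewrite -E1 in c'.
have [c1 d1] := tdet_twist c; have [_ d2] := tdet_twist c'.
split; first exact: c1.
exact: (etrans d1 (etrans d (esym d2))).
Qed.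

End Bidiagonal.

End LaurentMatrices.

(** * The matrices F U(a) F^-1 *)

Section ConjugatedU.
Context {R : realType} {A : completeStrongPolymetricType R}.
Local Notation B := (laurent A).
Implicit Types (a b c : laurent A) (X Y : int -> int -> B) (M N : dmat B).
Definition FR (e : int) : nat -> int -> int -> B :=
  pslin imone (- imscale (lX e) (imind (Fpred e) ** U (lX (- e)))).

Lemma ZnegE : Zneg = Fpred 1.
Proof. by apply/funext => n; rewrite /Fpred mul1r. Qed.

Lemma ZposE : Zpos = Fpred (-1).
Proof. by apply/funext => n; rewrite /Fpred mulN1r oppr_lt0. Qed.

Lemma FRpE : FRp = FR 1.
Proof. by rewrite /FRp /FR ZnegE. Qed.

Lemma FRmE : FRm = FR (-1).
Proof. by rewrite /FRm /FR opprK ZposE. Qed.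

Lemma U_lX j n m : U (lX j) n m = (m == n - j)%:R :> B.
Proof.
rewrite /U /laurent_mx /= /mono (_ : (n - m == j) = (m == n - j)).
  by case: eqP; rewrite ?lconst0.
by apply/eqP/eqP; lia.
Qed.

Lemma NmxE e : imscale (lX e) (imind (Fpred e) ** U (lX (- e))) = Nmx e :> (int -> int -> B).
Proof.
apply/funext => n; apply/funext => m; rewrite /imscale imind_mul U_lX opprK /Nmx.
by rewrite andbC -mulnb natrM.
Qed.

Lemma at1_FR e : at1 (FR e) = imone - Nmx e :> (int -> int -> B).
Proof.
apply/funext => n; apply/funext => m; rewrite /at1.
rewrite (@fsbigTE _ _ _ _ [fset 0%N; 1%N]%fset) => [|k]; last first.
  by rewrite !inE; case: k => [|[|k]].
by rewrite big_fsetU1 ?inE //= big_seq_fset1 /= NmxE.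
Qed.

Lemma immul0 X : 0 ** X = 0.
Proof.
apply/funext => n; apply/funext => m; apply: tsumE.
have := @has_sum_fin R B int (fun k => 0 * X k m) fset0.
by rewrite big_seq_fset0; apply=> k _; rewrite mul0r.
Qed.

Lemma mul_immul0 X : X ** 0 = 0.
Proof.
apply/funext => n; apply/funext => m; apply: tsumE.
have := @has_sum_fin R B int (fun k => X n k * 0) fset0.
by rewrite big_seq_fset0; apply=> k _; rewrite mulr0.
Qed.

Section Direction.
Variable e : int.
Hypothesis he : e = 1 \/ e = -1.

Let N1 : dmat B := dN he.

Lemma psmul_psconst (F : nat -> int -> int -> B) X k : psmul F (psconst X) k = F k ** X.
Proof.
rewrite /psmul big_ord_recr /= subnn big1 ?add0r // => i _.
by case E: (k - i)%N => [|l]; [have := ltn_ord i; lia|rewrite /= mul_immul0].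
Qed.

Lemma psmul_linear (F G : nat -> int -> int -> B) k : (forall l, F l.+2 = 0) ->
  psmul F G k.+1 = F 0 ** G k.+1 + F 1%N ** G k.
Proof.
move=> F0; rewrite /psmul !big_ord_recl /= subn0 subn1 /=; congr (_ + _).
by rewrite big1 ?addr0 // => i _; rewrite F0 immul0.
Qed.

Lemma psmul0 (F G : nat -> int -> int -> B) : psmul F G 0 = F 0 ** G 0.
Proof. by rewrite /psmul big_ord1. Qed.

Lemma mulN_dN X : (- Nmx e) ** X = - (Nmx e ** X).
Proof.
apply/funext => n; apply/funext => m.
have z k : k != n + e -> Nmx e n k = 0 :> B by move=> /negPf E; rewrite /Nmx E mulr0.
rewrite (immul_single (k0 := (n + e))) => [|k /z E].
  rewrite -[RHS]/(- ((Nmx e ** X) n m)) (immul_single (k0 := (n + e))).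
    exact: mulNr.
  by move=> k /z ->; rewrite mul0r.
by rewrite -[(- _) n k]/(- Nmx e n k) E oppr0 mul0r.
Qed.

(** The product of F = 1 - t N with G is 1 only if G_0 = 1 and G_{k+1} = N G_k,
    so the inverse chosen in [psinv] is the geometric series. *)
Lemma psinv_FR k : psinv (FR e) k = (N1 ^+ k : dmat B).
Proof.
pose G k : int -> int -> B := (N1 ^+ k : dmat B).
have FG : psmul (FR e) G = psconst imone.
  apply/funext => -[|l]; first by rewrite psmul0 /FR /= imone_mul.
  rewrite psmul_linear // /FR /= NmxE imone_mul mulN_dN /G exprS.
  by rewrite dmM subrr.
have GF : psmul G (FR e) = psconst imone.
  apply/funext => -[|l]; first by rewrite psmul0 /FR /= mul_imone.
  rewrite /psmul !big_ord_recr /= subnn subSnn /= big1 => [|i _]; last first.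
    rewrite (_ : (l.+1 - i)%N = (l - i.+1).+2); last by have := ltn_ord i; lia.
    by rewrite /FR /= mul_immul0.
  rewrite add0r /FR /= NmxE mul_imone /G exprSr.
  have -> : - Nmx e = (- N1 : dmat B) :> (int -> int -> B) by [].
  by rewrite -dmM mulrN -dmD addNr.
rewrite /psinv; set W := xget _ _.
have [WF _] : [set G | psmul (FR e) G = psconst imone /\ psmul G (FR e) = psconst imone] W.
  by apply: xgetPex; exists G.
elim: k => [|k IH].
  by have := congr1 (fun F => F 0%N) WF; rewrite /= psmul0 /FR /= imone_mul.
have := congr1 (fun F => F k.+1) WF; rewrite /= psmul_linear // /FR /= NmxE imone_mul mulN_dN IH.
by move=> /eqP; rewrite subr_eq0 => /eqP ->; rewrite exprS dmM.
Qed.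

Lemma dN_exp k n m : (N1 ^+ k : dmat B) n m =
  lX (e * k%:Z) * ((m == n + e * k%:Z) && ((k == 0%N) || (e * m <= 0)))%:R.
Proof.
elim: k n m => [|k IH] n m.
  by rewrite expr0 mulr0 addr0 andbT eq_sym lX0 mul1r.
rewrite exprS dN_mul IH mulrACA -lXD -natrM mulnb.
rewrite (_ : e + e * k%:Z = e * k.+1%:Z); last by rewrite -addn1 PoszD; ring.
rewrite (_ : n + e + e * k%:Z = n + e * k.+1%:Z); last by rewrite -addn1 PoszD; ring.
congr (_ * (nat_of_bool _)%:R); rewrite /= andbCA; case: eqP => //= ->.
rewrite /Fpred; case: he => ->; case: k {IH} => [|k] /=; lia.
Qed.

(** The coefficient of w^i in the entry (n, m) of V = F U(a) F^-1 at t = 1. With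
    K = e i and j = n - m + i, the minuend in the last case comes from
    U(z^j) N^K and the subtrahend from N U(z^j) N^(K-1). *)
Definition conj_coef a (n m i : int) : A :=
  if e * i < 0 then 0 else if i == 0 then a (n - m) else
  a (n - m + i) * ((e * m <= 0)%R%:R - ((e * n < 0) && ((e * m <= 0) || (e * i == 1)))%:R).

Lemma sn_conj_coef p a n m i : sn p (conj_coef a n m i) <= sn p (a (n - m + i)).
Proof.
rewrite /conj_coef; case: ifP => _; first by rewrite sn0 sn_ge0.
case: eqP => [->|_]; first by rewrite addr0.
case: (e * m <= 0); case: (e * n < 0); case: (e * i == 1);
  by rewrite /= ?subrr ?subr0 ?sub0r ?mulr0 ?mulrN ?mulr1 ?snN ?sn0 ?sn_ge0.
Qed.

Lemma conj_coef_rapid a n m : rapid intsz (conj_coef a n m).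
Proof.
move=> p k; have [C HC] := lcoef_rapid (lX (m - n) * a) p k; exists C => i.
apply: le_trans (HC i); rewrite lX_coefM ler_wpM2r ?weight_exp_ge0 //.
by apply: le_trans (sn_conj_coef _ _ _ _ _) _; rewrite (_ : i - (m - n) = n - m + i) //; ring.
Qed.

Definition Vmx a : int -> int -> B :=
  fun n m => Laurent (introT (rapid_seqP _) (conj_coef_rapid a n m)).

Lemma at1_conj_shift j n m (i := m - n + j) :
  at1 (psmul (psmul (FR e) (psconst (U (lX j)))) (psinv (FR e))) n m =
  if e * i < 0 then 0 else if i == 0 then 1 else
  lX i * ((e * m <= 0)%R%:R - ((e * n < 0) && ((e * m <= 0) || (e * i == 1)))%:R).
Proof.
pose X := dU (lX j : laurent A).
have XE M l m' : (X * M) l m' = M (l - j) m'.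
  rewrite dmM (immul_single (k0 := (l - j))) => [|k' kl].
    by rewrite /= U_lX eqxx mul1r.
  by rewrite /= U_lX (negPf kl) mul0r.
pose E k : dmat B := if k is l.+1 then X * N1 ^+ k - N1 * (X * N1 ^+ l) else X.
have HE k : psmul (psmul (FR e) (psconst (U (lX j)))) (psinv (FR e)) k = E k.
  have -> : psinv (FR e) = fun k => (N1 ^+ k : dmat B) by apply/funext => l; rewrite psinv_FR.
  have -> : psmul (FR e) (psconst (U (lX j))) = pslin X (- (N1 * X) : dmat B).
    apply/funext => -[|[|l]]; rewrite psmul_psconst /FR /= ?imone_mul ?immul0 //.
    by rewrite NmxE mulN_dN.
  case: k => [|k]; first by rewrite psmul0 /= -[LHS]/(dm (X * 1)) mulr1.
  rewrite psmul_linear // -[LHS]/(dm (X * N1 ^+ k.+1 + - (N1 * X) * N1 ^+ k)).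
  by rewrite mulNr -mulrA.
have ES k : E k.+1 n m = (N1 ^+ k.+1 : dmat B) (n - j) m -
    lX e * (Fpred e n)%:R * (N1 ^+ k : dmat B) (n + e - j) m.
  rewrite -[LHS]/((X * N1 ^+ k.+1) n m - (N1 * (X * N1 ^+ k)) n m).
  by rewrite (XE (N1 ^+ k.+1)) -(XE (N1 ^+ k)) (dN_mul he (X * N1 ^+ k)).
have E00 : E 0%N n m = (n - j == m)%:R.
  by rewrite -[LHS]/(dm X n m) -[X]mulr1 (XE 1).
(* the (n, m) entry is a multiple of t^(e i), and 0 if e i < 0 *)
have E0 k : e * i != k%:Z -> E k n m = 0.
  move=> ik; case: k ik => [|k] ik.
    rewrite E00 (_ : (_ == _) = false) //.
    by apply/negP => /eqP mE; case/eqP: ik; rewrite /i -mE; case: he => ->; lia.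
  rewrite ES !dN_exp.
  rewrite (_ : (m == n - j + e * k.+1%:Z) = false); last first.
    by apply/negP => /eqP E1; move/eqP: ik; rewrite /i E1; case: he => ->; lia.
  rewrite (_ : (m == n + e - j + e * k%:Z) = false); last first.
    by apply/negP => /eqP E1; move/eqP: ik; rewrite /i E1; case: he => ->; lia.
  by rewrite /= !mulr0 subr0.
rewrite /at1; under eq_fsbigr => k _ do rewrite HE.
have [i0|i0] := ltP (e * i) 0.
  by rewrite fsbig1 // => k _; apply: E0; apply/eqP; lia.
have [K iK] : exists K : nat, e * i = K%:Z by exists `|(e * i)%R|%N; lia.
rewrite (@fsbigTE _ _ _ _ [fset K]%fset) => [|k]; last first.
  rewrite in_fset1 => kK; apply: E0; rewrite iK; apply: contra kK => /eqP [->] //.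
rewrite big_seq_fset1; have iE : i = e * K%:Z by rewrite -iK mulrA; case: he => ->; ring.
case: K iK iE => [|K] iK iE.
  rewrite iE mulr0 eqxx E00 (_ : n - j == m) //.
  by apply/eqP; move: iE; rewrite /i; lia.
rewrite (_ : (i == 0) = false); last by rewrite iE; apply/negP => /eqP; case: he => ->; lia.
rewrite ES !dN_exp /= iK.
rewrite (_ : m == n - j + e * K.+1%:Z); last by rewrite -iE /i; apply/eqP; ring.
rewrite (_ : m == n + e - j + e * K%:Z); last first.
  by apply/eqP; move: iE; rewrite /i -addn1 PoszD; case: he => ->; lia.
rewrite -iE mulrACA -lXD (_ : e + e * K%:Z = i); last by rewrite iE -addn1 PoszD; ring.
rewrite -natrM mulnb -mulrBr /= /Fpred; congr (_ * (_ - (nat_of_bool (_ && _))%:R)).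
by rewrite orbC; congr orb; apply/eqP/eqP; lia.
Qed.

Lemma UconjE a : Uconj (FR e) a = Vmx a.
Proof.
apply/funext => n; apply/funext => m; apply: tsumE.
have h1 : cancel (fun j : int => m - n + j) (fun i => i - (m - n)) by move=> j; ring.
have h2 : cancel (fun i : int => i - (m - n)) (fun j => m - n + j) by move=> j; ring.
have := has_sum_bij h1 h2 (has_sum_monomials (Vmx a n m)); apply: eq_has_sum => j /=.
rewrite at1_conj_shift /conj_coef; case: ifP => _; first by rewrite lconst0 mul0r mulr0.
case: eqP => [i0|_].
  by rewrite i0 lX0 (_ : j = n - m) //; lia.
rewrite lconstM -mulrA (_ : n - m + (m - n + j) = j); last by ring.
congr (_ * _); rewrite mulrC; congr (_ * _).
by rewrite lconstB; case: (e * m <= 0); case: (_ && _); rewrite /= ?lconst0 ?lconst1.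
Qed.

(** Where V differs from U(a), the signs of n, m and i are such that |n|, |m| and
    |i| are all at most |n - m + i| + 2, so the decay of a bounds everything. *)
Lemma Vmx_smooth a : smooth (Vmx a - U a).
Proof.
apply/smoothP => -[p l] k; pose K := (l + (k + k))%N.
exists (3 ^+ K * lsn (p, K) a) => [|n m].
  by rewrite mulr_ge0 ?exprn_ge0 // (lsn_ge0 (p, K)).
have w0 : 0 < weight n ^+ k * weight m ^+ k :> R.
  by rewrite mulr_gt0 ?exprn_gt0 ?weight_gt0.
rewrite -ler_pdivlMr //; apply: lsn_le => J; rewrite ler_pdivlMr // mulr_suml.
apply: (@le_trans _ _ (\sum_(i <- J) 3 ^+ K * (sn p (a (n - m + i)) * weight (n - m + i) ^+ K))).
  apply: ler_sum => i _.
  rewrite -[(Vmx a - U a) n m i]/(conj_coef a n m i - mono (a (n - m)) 0 i).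
  set x := n - m + i.
  have [z|[z le1 le2 le3]] : conj_coef a n m i - mono (a (n - m)) 0 i = 0 \/
      [/\ mono (a (n - m)) 0 i = 0, (`|n| <= `|x| + 2)%N, (`|m| <= `|x| + 2)%N &
          (`|i| <= `|x| + 2)%N].
  - rewrite /conj_coef /mono /x; case: ltP => ei.
      by left; case: eqP ei => [->|_ _]; rewrite ?mulr0 // subrr.
    case: eqP => [_|i0]; first by left; rewrite subrr.
    case: leP => em; case: ltP => en /=.
    + by left; rewrite subrr mulr0 subr0.
    + by right; split=> //; case: he => E; rewrite E in em en ei *; lia.
    + case: eqP => [e1|_]; last by left; rewrite /= subrr mulr0 subr0.
      by right; split=> //; case: he => E; rewrite E in em en ei e1 *; lia.
    + by left; rewrite subrr mulr0 subr0.
  - by rewrite z sn0 !mul0r mulr_ge0 ?exprn_ge0 // mulr_ge0 ?sn_ge0 ?weight_exp_ge0.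
  have wle j : (`|j| <= `|x| + 2)%N -> weight j <= 3 * weight x :> R.
    by rewrite -(ler_nat R) natrD /weight /intsz => ?; have : 0 <= (`|x|%N)%:R :> R by []; lra.
  have wleX j r : (`|j| <= `|x| + 2)%N -> weight j ^+ r <= (3 * weight x) ^+ r :> R.
    by move=> /wle jx; rewrite lerXn2r ?nnegrE ?mulr_ge0 ?weight_ge0.
  rewrite z subr0 [leRHS]mulrCA -mulrA; apply: ler_pM; rewrite ?sn_ge0 //.
  - by rewrite mulr_ge0 ?mulr_ge0 ?weight_exp_ge0.
  - exact: sn_conj_coef.
  rewrite -[leRHS]exprMn /K !exprD; apply: ler_pM; rewrite ?mulr_ge0 ?weight_exp_ge0 ?wleX //.
  by apply: ler_pM; rewrite ?weight_exp_ge0 ?wleX.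
rewrite -mulr_sumr ler_wpM2l ?exprn_ge0 //.
rewrite -(big_fset_inj _ (fun i => sn p (a i) * weight i ^+ K) J (@addrI _ (n - m))).
exact: le_lsn.
Qed.

Lemma Vmx_decay a : decay (Vmx a).
Proof.
rewrite -[Vmx a](subrK (U a)); apply: decayD; last exact: U_decay.
exact: smooth_decay (Vmx_smooth a).
Qed.

Definition dV a : dmat B := dmk (Vmx_decay a).

(** This is the definition of V multiplied by F; it is verified on coefficients,
    as the inverse of F has no place in the ring [dmat]. *)
Lemma dV_mul_dF a : dV a * dF he = dF he * dU a.
Proof.
apply/val_inj/funext => n; apply/funext => m; apply: laurent_eq => i.
rewrite /dF mulrBr mulr1 mulrBl mul1r.
rewrite -[LHS]/(conj_coef a n m i - (dV a * N1 : dmat B) n m i).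
rewrite -[RHS]/(mono (a (n - m)) 0 i - (N1 * dU a : dmat B) n m i).
have coefl (x : B) (b : bool) l : (x * (lX e * b%:R)) l = if b then x (l - e) else 0.
  by case: b; rewrite ?mulr0 // mulr1 mulrC lX_coefM.
have coefr (x : B) (b : bool) l : (lX e * b%:R * x) l = if b then x (l - e) else 0.
  by rewrite mulrC; exact: coefl.
rewrite (mul_dN he (dV a)) (dN_mul he (dU a)) coefl coefr.
rewrite /Fpred /= /mono /conj_coef.
have -> : n - (m - e) + (i - e) = n - m + i by ring.
have -> : n - (m - e) = n - m + e by ring.
have -> : n + e - m = n - m + e by ring.
have -> : (e * (m - e) < 0) = (e * m <= 0) by case: he => ->; lia.
have e0 : e * (i - e) < 0 = (e * i <= 0) by case: he => ->; lia.
have i0 : (i == 0) = (e * i == 0) by case: he => ->; lia.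
have ie : (i - e == 0) = (e * i == 1) by case: he => ->; lia.
have me : e * m <= 0 -> e * (m - e) <= 0 by case: he => ->; lia.
have ai : e * i = 1 -> i = e by case: he => ->; lia.
have ie2 : (e * (i - e) == 1) = (e * i == 2) by case: he => ->; lia.
rewrite e0 i0 ie ie2 {e0 i0 ie ie2}; move: (e * i) ai => K ai.
case: (ltgtP K 0) => K0.
- rewrite (_ : (K == 1) = false); last by apply/eqP; lia.
  by case: (e * m <= 0); case: (e * n < 0); rewrite !subr0.
- case: (K =P 1) => [/ai -> |K1]; case: (leP (e * m) 0) => [/me em|_];
    case: (e * n < 0); rewrite /= ?em /=; ring.
- by rewrite K0; case: (e * m <= 0); case: (e * n < 0); rewrite /= !subr0.
Qed.



End Direction.
Lemma scalar_decay c : decay (fun n m : int => c * (n == m)%:R).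
Proof.
apply: (@decay_sparse _ _ _ 0) => [n m nm|p].
  by case: eqP nm => [->|_ _]; rewrite ?mulr0 // subrr.
exists (sn p c) => n m; case: eqP => _; rewrite ?mulr1 //.
by rewrite mulr0 sn0 sn_ge0.
Qed.

Definition dscal c : dmat B := dmk (scalar_decay c).

Lemma dscalE c M : imscale c M = dscal c * M :> (int -> int -> B).
Proof.
apply/funext => n; apply/funext => m; rewrite dmM (immul_single (k0 := n)) /=.
  by rewrite eqxx mulr1.
by move=> k /negPf kn; rewrite eq_sym kn mulr0 mul0r.
Qed.

Lemma dscal_comm c M : dscal c * M = M * dscal c.
Proof.
apply/val_inj/funext => n; apply/funext => m.
rewrite -[LHS]/((dscal c * M) n m) -dscalE -[RHS]/((dm M ** dscal c) n m).
rewrite (immul_single (k0 := m)) /=; first by rewrite eqxx mulr1 mulrC.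
by move=> k /negPf km; rewrite km !mulr0.
Qed.

Lemma dN_scal e (he : e = 1 \/ e = -1) :
  dN he = dscal (lX e) * (dmk (imind_decay (Fpred e)) * dU (lX (- e))).
Proof. by apply: val_inj; rewrite -[RHS]dscalE; exact/esym/NmxE. Qed.

End ConjugatedU.

(** * The matrices U~(a, w) and the half-integers *)

Section TwistedU.
Context {R : realType} {A : completeStrongPolymetricType R}.
Local Notation B := (laurent A).
Implicit Types (a b c : laurent A) (X Y : int -> int -> B) (M N : dmat B).
Lemma rapid_lconst (f : int -> A) : rapid intsz f -> rapid intsz (fun n => lconst (f n)).
Proof.
move=> rf [p l] k; have [C HC] := rf p k; exists C => n.
by apply: le_trans (HC n); rewrite ler_wpM2r ?weight_exp_ge0 ?sn_lconst.
Qed.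

Lemma rapid_shift (f : int -> A) j : rapid intsz f -> rapid intsz (fun n => f (n + j)).
Proof.
move=> rf p k; have [C HC] := rf p k.
have C0 : 0 <= C by apply: le_trans (HC 0); rewrite mulr_ge0 ?sn_ge0 ?weight_exp_ge0.
exists (C * weight j ^+ k) => n.
apply: le_trans (ler_wpM2r (weight_exp_ge0 j k) (HC (n + j))).
rewrite -mulrA ler_wpM2l ?sn_ge0 // -{1}(addrK j n) -(weightN j).
exact: weightX_le.
Qed.

Lemma rapid_scale (x : B) (f : int -> B) : rapid intsz f -> rapid intsz (fun n => x * f n).
Proof.
move=> rf p k; have [q Hq] := sn_mul p; have [C HC] := rf q k.
exists (sn q x * C) => n; apply: (@le_trans _ _ (sn q x * (sn q (f n) * weight n ^+ k))).
  by rewrite mulrA ler_wpM2r ?weight_exp_ge0.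
by rewrite ler_wpM2l ?sn_ge0.
Qed.

(** A Toeplitz matrix restricted to pairs of indices of opposite signs is rapidly
    decreasing, since |n - m| = |n| + |m| there. *)
Lemma smooth_corner (P : rel int) (f : int -> B) : rapid intsz f ->
  (forall n m, P n m -> (`|n| + `|m| <= `|n - m|)%N) ->
  smooth (fun n m => if P n m then f (n - m) else 0).
Proof.
move=> rf HP; apply/smoothP => p k; have [C HC] := rf p (k + k)%N.
have C0 : 0 <= C by apply: le_trans (HC 0); rewrite mulr_ge0 ?sn_ge0 ?weight_exp_ge0.
exists C => // n m; case: ifP => [/HP Pnm|_]; last by rewrite sn0 mul0r.
apply: le_trans (HC (n - m)); rewrite ler_wpM2l ?sn_ge0 // exprD.
have le j : (`|j| <= `|n - m|)%N -> weight j ^+ k <= weight (n - m) ^+ k :> R.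
  by move=> jnm; rewrite lerXn2r ?nnegrE ?weight_ge0 // lerD2l ler_nat.
by apply: ler_pM; rewrite ?weight_exp_ge0 ?le //; lia.
Qed.

Definition same_side (n m : int) : bool := ((0 < n) && (0 < m)) || ((n < 0) && (m < 0)).

Lemma corner_decomp n m : ~~ same_side n m -> (`|n| + `|m| <= `|n - m|)%N.
Proof. by rewrite /same_side; lia. Qed.

Lemma Ut_smooth a u v : smooth (Utilde a u v - U a).
Proof.
have ra := rapid_lconst (lcoef_rapid a).
pose F1 := fun n m : int => if (n < 0) && (0 < m) then
  (- u) * lconst (a (n - m + 1)) else 0.
pose F2 := fun n m : int => if (m < 0) && (0 < n) then
  (- v) * lconst (a (n - m + -1)) else 0.
pose F3 := fun n m : int => if ~~ same_side n m then (- 1) * lconst (a (n - m)) else 0.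
pose F4 := fun n m : int => if (n == 0) && (m == 0) then mono (1 : B) 0 (n - m) else 0.
have -> : Utilde a u v - U a = F1 + F2 + F3 + F4.
  apply/funext => n; apply/funext => m.
  rewrite -[LHS]/(Utilde a u v n m - lconst (a (n - m))).
  rewrite -[RHS]/(F1 n m + F2 n m + F3 n m + F4 n m).
  rewrite /Utilde /F1 /F2 /F3 /F4 -/(same_side n m) /mono.
  case E1: (same_side n m) => /=.
    rewrite subrr (_ : (n < 0) && (0 < m) = false); last by move: E1; rewrite /same_side; lia.
    rewrite (_ : (m < 0) && (0 < n) = false); last by move: E1; rewrite /same_side; lia.
    rewrite (_ : (n == 0) && (m == 0) = false) ?addr0 //; by move: E1; rewrite /same_side; lia.
  case: ifP => E2.
    rewrite (_ : (m < 0) && (0 < n) = false); last by lia.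
    rewrite (_ : (n == 0) && (m == 0) = false); last by lia.
    by rewrite !addr0 !mulNr mul1r.
  case: ifP => E3.
    rewrite (_ : (n == 0) && (m == 0) = false); last by lia.
    by rewrite !addr0 add0r !mulNr mul1r.
  rewrite !add0r mulN1r addrC; congr (_ + _).
  case: (eqVneq n m) E1 => [->|nm] E1.
    by rewrite subrr eqxx andbb (_ : (m == 0)) //; move: E1; rewrite /same_side; lia.
  by rewrite (_ : (n == 0) && (m == 0) = false) //; lia.
have r1 := rapid_scale (- u) (rapid_lconst (rapid_shift 1 (lcoef_rapid a))).
have r2 := rapid_scale (- v) (rapid_lconst (rapid_shift (-1) (lcoef_rapid a))).
have r3 := rapid_scale (- 1) ra.
apply: smoothD; first (apply: smoothD; first apply: smoothD).
- by apply: (smooth_corner (P := fun n m => (n < 0) && (0 < m)) r1) => n m; lia.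
- by apply: (smooth_corner (P := fun n m => (m < 0) && (0 < n)) r2) => n m; lia.
- by apply: (smooth_corner (P := fun n m => ~~ same_side n m) r3) => n m; exact: corner_decomp.
- by apply: (smooth_corner (P := fun n m => (n == 0) && (m == 0)) (rapid_mono 1 0)) => n m; lia.
Qed.

Lemma Ut_decay a u v : decay (Utilde a u v).
Proof.
rewrite -[Utilde a u v](subrK (U a)); apply: decayD; last exact: U_decay.
exact: smooth_decay (Ut_smooth a u v).
Qed.

Definition dUt a u v : dmat B := dmk (Ut_decay a u v).

Lemma toeplitz_perturb a X : smooth (X - U a) -> toeplitz X.
Proof.
move=> sX; have ra := rapid_lconst (lcoef_rapid a).
pose c n := lconst (a n); pose F := fun n m : int => if ~~ same_side n m then c (n - m) else 0.
exists c, c, ((X - U a) + F); split=> //.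
  apply: smoothD => //; apply: (smooth_corner (P := fun n m => ~~ same_side n m) ra) => n m.
  exact: corner_decomp.
apply/funext => n; apply/funext => m.
rewrite -[RHS]/((imind Zneg ** laurent_mx c ** imind Zneg) n m +
  (imind Zpos ** laurent_mx c ** imind Zpos) n m + ((X n m - c (n - m)) + F n m)).
rewrite !mul_imind !imind_mul /laurent_mx /F /same_side /Zneg /Zpos.
case: (ltgtP n 0) => n0; case: (ltgtP m 0) => m0 /=;
  rewrite ?mul1r ?mulr1 ?mul0r ?mulr0 ?add0r ?addr0; ring.
Qed.

Lemma toeplitz_U a : toeplitz (U a).
Proof. by apply: (@toeplitz_perturb a); rewrite subrr; exact: smooth0. Qed.

Lemma toeplitz_Ut a u v : toeplitz (Utilde a u v).
Proof. exact/(@toeplitz_perturb a)/Ut_smooth. Qed.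

Definition diagmx (S : choiceType) (g : S -> B) : S -> S -> B := fun n m => g n * (n == m)%:R.

Lemma diagmx_mul (S : choiceType) (g : S -> B) (X : S -> S -> B) n m :
  (diagmx g ** X) n m = g n * X n m.
Proof.
rewrite (immul_single (k0 := n)) /diagmx ?eqxx ?mulr1 // => k /negPf kn.
by rewrite eq_sym kn mulr0 mul0r.
Qed.

Lemma mul_diagmx (S : choiceType) (g : S -> B) (X : S -> S -> B) n m :
  (X ** diagmx g) n m = X n m * g m.
Proof.
rewrite (immul_single (k0 := m)) /diagmx ?eqxx ?mulr1 // => k /negPf kn.
by rewrite kn !mulr0.
Qed.

Definition side_diag (x y : B) (n : int) : B :=
  if n < 0 then x else if n == 0 then 1 else y.

Lemma side_diag_decay x y : decay (diagmx (side_diag x y)).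
Proof.
apply: (@decay_sparse _ _ _ 0) => [n m nm|p].
  by rewrite /diagmx; case: eqP nm => [->|_ _]; rewrite ?mulr0 // subrr.
exists (sn p x + sn p 1 + sn p y) => n m; rewrite /diagmx.
case: eqP => _; last by rewrite mulr0 sn0 !addr_ge0 ?sn_ge0.
rewrite mulr1 /side_diag; have := sn_ge0 p x; have := sn_ge0 p y; have := sn_ge0 p 1.
by case: ifP => _; [|case: ifP => _]; lra.
Qed.

Definition dD x y : dmat B := dmk (side_diag_decay x y).

Lemma dDM x y x' y' : dD x y * dD x' y' = dD (x * x') (y * y').
Proof.
apply/val_inj/funext => n; apply/funext => m.
rewrite -[LHS]/((diagmx (side_diag x y) ** diagmx (side_diag x' y')) n m) diagmx_mul /=.
rewrite /diagmx mulrA; congr (_ * _); rewrite /side_diag.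
by case: ifP => _ //; case: ifP => _ //; rewrite mulr1.
Qed.

Lemma dD1 : dD 1 1 = 1.
Proof.
apply/val_inj/funext => n; apply/funext => m.
by rewrite /= /diagmx /side_diag !if_same mul1r.
Qed.

Lemma Ut_conj a x y x' y' u v : x * x' = 1 -> y * y' = 1 ->
  dD x y * dUt a u v * dD x' y' = dUt a (x * u * y') (y * v * x').
Proof.
move=> xx yy; apply/val_inj/funext => n; apply/funext => m.
rewrite -[LHS]/((dm (dD x y * dUt a u v) ** diagmx (side_diag x' y')) n m) mul_diagmx.
rewrite -[dm _ n m]/((diagmx (side_diag x y) ** Utilde a u v) n m) diagmx_mul.
rewrite /= /Utilde /side_diag.
have off (z t : B) : (n == m) = false -> z * (n == m)%:R * t = (n == m)%:R.
  by move=> ->; rewrite mulr0 mul0r.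
case: (ltgtP n 0) => n0; case: (ltgtP m 0) => m0 /=;
  try (by rewrite off //; apply/eqP; lia).
- by rewrite mulrAC xx mul1r.
- ring.
- ring.
- by rewrite mulrAC yy mul1r.
- by rewrite mul1r mulr1.
Qed.

(** Through the floors of half-integers, this identifies the half-integers with the
    nonzero integers, preserving signs. *)
Definition skip0 (k : int) : int := if 0 <= k then k + 1 else k.

Lemma skip0_inj : injective skip0.
Proof. by move=> i j; rewrite /skip0; case: leP => ?; case: leP => ?; lia. Qed.

Lemma skip0_neq0 k : skip0 k != 0.
Proof. by rewrite /skip0; case: ifP; lia. Qed.

Lemma skip0_onto n : n != 0 -> exists k, n = skip0 k.
Proof.
move=> n0; exists (if 0 < n then n - 1 else n); rewrite /skip0.
by do 2 case: ifP; lia.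
Qed.

(** The scalars -1 compensate the signs in the definition of [Utilde], so that
    [dK a] is U_H(a) on the nonzero integers. *)
Definition dK a := dUt a (-1) (-1).

Lemma dK_skip0 a i j : dK a (skip0 i) (skip0 j) = lconst (a (i - j)).
Proof.
rewrite /= /Utilde /skip0; case: (leP 0 i) => i0; case: (leP 0 j) => j0.
- have -> : (0 < i + 1) && (0 < j + 1) by lia.
  by congr (lconst (a _)); lia.
- have -> : (0 < i + 1) && (0 < j) || (i + 1 < 0) && (j < 0) = false by lia.
  have -> : (i + 1 < 0) && (0 < j) = false by lia.
  have -> : (j < 0) && (0 < i + 1) by lia.
  by rewrite mulN1r opprK; congr (lconst (a _)); lia.
- have -> : (0 < i) && (0 < j + 1) || (i < 0) && (j + 1 < 0) = false by lia.
  have -> : (i < 0) && (0 < j + 1) by lia.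
  by rewrite mulN1r opprK; congr (lconst (a _)); lia.
- by have -> : (0 < i) && (0 < j) || (i < 0) && (j < 0) by lia.
Qed.

Lemma dK_0r a n : dK a n 0 = (n == 0)%:R.
Proof. by rewrite /= /Utilde ltxx !andbF. Qed.

Lemma dK_0l a m : dK a 0 m = (m == 0)%:R.
Proof. by rewrite /= /Utilde ltxx !andbF /= eq_sym. Qed.

Lemma has_sum_skip0 (f : int -> B) x : f 0 = 0 -> has_sum f x -> has_sum (f \o skip0) x.
Proof.
move=> f0; apply: has_sum_inj skip0_inj _ => j nj.
have [->//|/skip0_onto[k jk]] := eqVneq j 0.
by case: (nj k).
Qed.

(** Up to the relabelling [skip0], [dK a] is the Toeplitz matrix of [a] with an
    additional diagonal entry 1, and Toeplitz matrices multiply like series. *)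
Lemma dKM a b : dK a * dK b = dK (a * b).
Proof.
apply/val_inj/funext => n; apply/funext => m.
rewrite -[LHS]/((dK a ** dK b) n m) -[RHS]/(dK (a * b) n m).
have [->|/skip0_onto[i ->]] := eqVneq n 0.
  rewrite (immul_single (k0 := 0)) ?dK_0l ?eqxx ?mul1r // => k /negPf k0.
  by rewrite dK_0l k0 mul0r.
have [->|/skip0_onto[j ->]] := eqVneq m 0.
  rewrite (immul_single (k0 := 0)) ?dK_0r ?eqxx ?mulr1 // => k /negPf k0.
  by rewrite dK_0r k0 mulr0.
rewrite dK_skip0; apply: (has_sum_unique (f := fun k => U a i k * U b k j)); last first.
  rewrite -[lconst _]/(dU (a * b) i j) dUM.
  exact: immul_has_sum (U_decay a) (U_decay b).
have := has_sum_skip0 _ (immul_has_sum (skip0 i) (skip0 j) (dmP (dK a)) (dmP (dK b))).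
rewrite dK_0r (negPf (skip0_neq0 i)) mul0r => /(_ erefl).
apply: eq_has_sum => k.
by rewrite -[LHS]/(dK a (skip0 i) (skip0 k) * dK b (skip0 k) (skip0 j)) !dK_skip0.
Qed.

Lemma dK1 : dK 1 = 1.
Proof.
apply/val_inj/funext => n; apply/funext => m.
rewrite -[LHS]/(dK 1 n m) -[RHS]/((n == m)%:R).
have [->|/skip0_onto[i ->]] := eqVneq n 0; first by rewrite dK_0l eq_sym.
have [->|/skip0_onto[j ->]] := eqVneq m 0; first by rewrite dK_0r.
rewrite dK_skip0 (inj_eq skip0_inj) /= /mono subr_eq0.
by case: eqP => _; [exact: lconst1|rewrite lconst0].
Qed.

(** This exhibits U~(a, w) as a conjugate of a matrix that is multiplicative in a;
    hence its inverse is U~(a^-1, w). *)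
Lemma dUt_dK a u v : u * v = 1 -> dUt a u v = dD (- u) 1 * dK a * dD (- v) 1.
Proof.
move=> uv; rewrite Ut_conj ?mulr1 ?mulrNN //.
by congr (dUt a _ _); ring.
Qed.

Lemma dUtM a b u v : u * v = 1 -> a * b = 1 -> dUt a u v * dUt b u v = 1.
Proof.
move=> uv ab; rewrite !dUt_dK //.
have DD : dD (- v) 1 * dD (- u) 1 = 1 by rewrite dDM mulrNN mulrC uv mulr1 dD1.
have DD' : dD (- u) 1 * dD (- v) 1 = 1 by rewrite dDM mulrNN uv mulr1 dD1.
rewrite !mulrA -(mulrA _ (dD (- v) 1)) DD mulr1 -(mulrA _ (dK a)) dKM ab dK1 mulr1.
exact: DD'.
Qed.

End TwistedU.

Section HalfIntegers.
Context {R : realType} {A : completeStrongPolymetricType R}.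
Local Notation B := (laurent A).
Implicit Types (a b c : laurent A) (M N : dmat B) (X Y : Defs.half -> Defs.half -> B).
Definition half_int (x : Defs.half) : int := skip0 (hfloor x).

Lemma half_int_inj : injective half_int.
Proof. by move=> [i] [j] /skip0_inj /= ->. Qed.

Lemma half_int_neq0 x : half_int x != 0. Proof. exact: skip0_neq0. Qed.

Lemma half_int_out n : (forall x, n <> half_int x) -> n = 0.
Proof.
move=> H; have [->//|/skip0_onto[k nk]] := eqVneq n 0.
by case: (H (Half k)).
Qed.

(** Adding a diagonal entry 1 at the integer 0 moves a matrix over the
    half-integers into the ring [dmat]. *)
Definition extends X M : Prop :=
  [/\ forall x y, M (half_int x) (half_int y) = X x y,
      forall n, M n 0 = (n == 0)%:R & forall n, M 0 n = (n == 0)%:R].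

Lemma extendsM X Y M N : extends X M -> extends Y N -> extends (X ** Y) (M * N).
Proof.
move=> [XM Mr Ml] [YN Nr Nl]; split=> [x y|n|n].
- apply/esym/tsumE.
  have := immul_has_sum (half_int x) (half_int y) (dmP M) (dmP N).
  move=> /(has_sum_inj half_int_inj) H.
  apply: eq_has_sum (H _) => [k|j /half_int_out ->] /=; first by rewrite XM YN.
  by rewrite Mr (negPf (half_int_neq0 x)) mul0r.
- rewrite dmM (immul_single (k0 := 0)) ?Mr ?Nr ?eqxx ?mulr1 // => k /negPf k0.
  by rewrite Nr k0 mulr0.
- rewrite dmM (immul_single (k0 := 0)) ?Ml ?Nl ?eqxx ?mul1r // => k /negPf k0.
  by rewrite Ml k0 mul0r.
Qed.

Lemma extends_UH a : extends (UH a) (dK a).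
Proof.
by split=> [x y|n|n]; [exact: dK_skip0|exact: dK_0r|exact: dK_0l].
Qed.

Lemma HnegE (x : Defs.half) : Hneg x = (hfloor x < 0).
Proof.
rewrite /Hneg /halfval; apply/idP/idP => H.
  rewrite -(ltr_int rat); lra.
have : hfloor x <= -1 by lia.
rewrite -(ler_int rat); lra.
Qed.

Lemma HposE (x : Defs.half) : Hpos x = (0 <= hfloor x).
Proof.
rewrite /Hpos /halfval; apply/idP/idP => H.
  suff : -1 < hfloor x by lia.
  rewrite -(ltr_int rat); lra.
move: H; rewrite -(ler_int rat); lra.
Qed.

Definition half_diag (x : B) (h : Defs.half) : B := if hfloor h < 0 then x else 1.

Lemma DHE : DH = diagmx (half_diag (lX 1)) :> (Defs.half -> Defs.half -> B).
Proof.
apply/funext => x; apply/funext => y.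
rewrite -[LHS]/(lX 1 * ((x == y) && Hneg x)%:R + ((x == y) && Hpos x)%:R).
rewrite /diagmx /half_diag HnegE HposE; case: (x == y) => /=; last by rewrite !mulr0 addr0.
by case: ltP => _; rewrite ?mulr1 ?mulr0 ?addr0 ?add0r.
Qed.

Lemma extends_half_diag (x : B) : extends (diagmx (half_diag x)) (dD x 1).
Proof.
split=> [i j|n|n].
- rewrite /= /diagmx (inj_eq half_int_inj) /side_diag /half_diag (negPf (half_int_neq0 i)).
  by congr (_ * _); rewrite /half_int /skip0; case: (leP 0 (hfloor i)) => i0;
    rewrite ?ltNge ?i0 //; case: ifP => //; lia.
- by rewrite /= /diagmx /side_diag; case: eqP => [->|_]; rewrite ?mulr0 // ltxx mulr1.
- by rewrite /= /diagmx /side_diag ltxx mul1r eq_sym.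
Qed.

Lemma DH_inv : iminv setT DH = diagmx (half_diag (lX (-1))) :> (Defs.half -> Defs.half -> B).
Proof.
have prod (x y : B) : x * y = 1 ->
    diagmx (half_diag x) ** diagmx (half_diag y) = imone :> (Defs.half -> Defs.half -> B).
  move=> xy; apply/funext => i; apply/funext => j; rewrite diagmx_mul /diagmx mulrA.
  by rewrite /half_diag; case: ifP => _; rewrite ?xy !mul1r.
have H1 : lX 1 * lX (-1) = 1 :> B by exact: lXNr.
rewrite /iminv DHE; set Y := xget _ _.
have [_ DY _] : inverse_in setT (diagmx (half_diag (lX 1))) Y.
  apply: xgetPex; exists (diagmx (half_diag (lX (-1)))); split=> //; apply: prod => //.
  by rewrite mulrC.
apply/funext => i; apply/funext => j.
have := congr1 (fun Z => half_diag (lX (-1)) i * Z i j) DY.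
rewrite diagmx_mul mulrA /half_diag /diagmx => E; rewrite -[RHS]E.
by rewrite /half_diag; case: ifP => _; rewrite ?(mulrC (lX (-1))) ?H1 !mul1r.
Qed.

Lemma halfsz_le (x : Defs.half) : halfsz x <= intsz (half_int x) :> R.
Proof.
rewrite /halfsz /intsz -[leRHS](ratr_nat R) ler_rat natr_absz.
rewrite /halfval /half_int /skip0; case: (leP 0 (hfloor x)) => k0.
  rewrite !ger0_norm ?intrD ?lerD2l //; first by lia.
  by rewrite addr_ge0 ?ler0z.
have k1 : (hfloor x)%:~R <= -1 :> rat by rewrite -[-1]/((-1)%:~R) ler_int; lia.
by rewrite (ltr0_norm k0) mulrNz ltr0_norm; lra.
Qed.

Lemma halfsz_ge0 (x : Defs.half) : 0 <= halfsz x :> R.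
Proof. by rewrite /halfsz ler0q. Qed.

Lemma extends_det X M : extends X M -> smooth (M - 1 : dmat B) ->
  det_defined halfsz X /\ tdet X = tdet M.
Proof.
move=> [XM Mr Ml] sM; have [_ cM] := det_defined_smooth sM.
have [|cX eX] := tdet_transport half_int_inj XM _ cM.
  by move=> y z /half_int_out ->; rewrite Ml eq_sym.
split=> //; split=> // p k; have [C HC] := sM p k; exists C => -[x y].
apply: le_trans (HC (half_int x, half_int y)) => /=.
have -> : (X - imone) x y = (M - 1 : dmat B) (half_int x) (half_int y).
  rewrite -[LHS]/(X x y - (x == y)%:R).
  by rewrite -[RHS]/(M (half_int x) (half_int y) - (half_int x == half_int y)%:R)
    XM (inj_eq half_int_inj).
rewrite ler_wpM2l ?sn_ge0 // lerXn2r ?nnegrE ?addr_ge0 ?halfsz_ge0 ?ler0n //.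
by rewrite lerD2l lerD ?halfsz_le.
Qed.

End HalfIntegers.

(** * The factorizations *)

Section RingIdentities.
Context {T : pzRingType}.
Implicit Types (L K D C : T).

Lemma three_inverse L K D L' K' D' : L * L' = 1 -> K * K' = 1 -> D * D' = 1 ->
  L * K * D * (D' * K' * L') = 1.
Proof.
by move=> LL KK DD; rewrite !mulrA -(mulrA _ D) DD mulr1 -(mulrA _ K) KK mulr1.
Qed.

Lemma conj_commutator L K K' D D' : L * L = 1 -> D * D' = 1 -> K * K' = 1 ->
  L * K * L * (L * D * K' * (D' * L)) =
  (L * K * D) * (K' * D' * K * D) * (D' * K' * L).
Proof.
move=> LL DD KK; rewrite !mulrA -(mulrA _ L L) LL mulr1.
by rewrite -[in RHS](mulrA _ D D') DD mulr1 -[in RHS](mulrA _ K K') KK mulr1.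
Qed.

Lemma comm_sub K K' D D' : K' * D' * K * D - K' * K = K' * (D' * K * D - K).
Proof. by rewrite mulrBr !mulrA. Qed.

Lemma conj_sub1 X Y C : X * C * Y - X * Y = X * (C - 1) * Y :> T.
Proof. by rewrite mulrBr mulr1 mulrBl. Qed.

Lemma cancel_middle X Y X' Y' : Y * X' = 1 -> X * Y * (X' * Y') = X * Y' :> T.
Proof. by move=> YX; rewrite mulrA -(mulrA X) YX mulr1. Qed.

End RingIdentities.

Section Quantities.
Context {R : realType} {A : completeStrongPolymetricType R}.
Local Notation B := (laurent A).
Variables a b : laurent A.
Hypothesis ab : a * b = 1.

Let ba : b * a = 1. Proof. by rewrite mulrC. Qed.

Lemma tinv_U : inverse_in toeplitz (U a) (U b) /\ tinv (U a) = U b.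
Proof.
have := @tinvE _ _ (dU a) (dU b) (toeplitz_U b); apply.
  by rewrite -dUM ab dU1.
by rewrite -dUM ba dU1.
Qed.

Lemma tinv_Ut u v : u * v = 1 ->
  inverse_in toeplitz (Utilde a u v) (Utilde b u v) /\
  tinv (Utilde a u v) = Utilde b u v.
Proof.
move=> uv; have := @tinvE _ _ (dUt a u v) (dUt b u v) (toeplitz_Ut b u v); apply.
  exact: dUtM.
exact: dUtM.
Qed.

Section Direction.
Variable e : int.
Hypothesis he : e = 1 \/ e = -1.

(** Since V F = F U(a), the matrix U(b) F U(a) is U(b) V F, where U(b) V is a rapidly
    decreasing perturbation of 1. The factor F does not change the determinant,
    and U(b) V has the same determinant as V U(b). *)
Lemma pi_direction :
  [/\ det_defined intsz (Uconj (FR e) a ** U b),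
      tdet_cvg (U b ** at1 (FR e) ** U a),
      tdet_cvg (imone - imscale (lX e) (U b ** imind (Fpred e) ** U a ** U (lX (- e)))),
      tdet (Uconj (FR e) a ** U b) = tdet (U b ** at1 (FR e) ** U a) &
      tdet (U b ** at1 (FR e) ** U a) =
      tdet (imone - imscale (lX e) (U b ** imind (Fpred e) ** U a ** U (lX (- e))))].
Proof.
have [D DE] : exists D, D = dV he a - dU a by exists (dV he a - dU a).
have sD : smooth D by rewrite DE; exact: Vmx_smooth.
have UU : dU a * dU b = 1 by rewrite -dUM ab dU1.
have UU' : dU b * dU a = 1 by rewrite -dUM ba dU1.
have VE : dV he a * dU b = 1 + D * dU b.
  by rewrite DE mulrBl UU addrC subrK.
have VE' : dU b * dV he a = 1 + dU b * D.
  by rewrite DE mulrBr UU' addrC subrK.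
have E1 : Uconj (FR e) a ** U b = dV he a * dU b :> (int -> int -> B).
  by rewrite UconjE.
have E2 : U b ** at1 (FR e) ** U a = (1 + dU b * D) * dF he :> (int -> int -> B).
  rewrite -VE' -mulrA dV_mul_dF mulrA at1_FR; by [].
have E3 : imone - imscale (lX e) (U b ** imind (Fpred e) ** U a ** U (lX (- e))) =
    U b ** at1 (FR e) ** U a.
  pose P : dmat B := dmk (imind_decay (Fpred e)).
  pose S : dmat B := dU (lX (- e)).
  have -> : imone - imscale (lX e) (U b ** imind (Fpred e) ** U a ** U (lX (- e))) =
      (1 - dscal (lX e) * (dU b * P * dU a * S) : dmat B) :> (int -> int -> B).
    by rewrite -[LHS]/(imone - imscale (lX e) (dU b * P * dU a * S : dmat B)) dscalE.
  rewrite at1_FR -[RHS]/(dm (dU b * (1 - dN he) * dU a)); congr dm.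
  rewrite mulrBr mulr1 mulrBl UU'; congr (_ - _).
  by rewrite dN_scal !mulrA -dscal_comm -!mulrA (dU_comm a).
have sBD : smooth (dU b * D) by exact: smooth_mull (dmP (dU b)) sD.
have sDB : smooth (D * dU b) by exact: smooth_mulr sD (dmP (dU b)).
have [c1 d1] := tdet_mul_F he sBD.
have dE : tdet (Uconj (FR e) a ** U b) = tdet (U b ** at1 (FR e) ** U a).
  have e1 : tdet (Uconj (FR e) a ** U b) = tdet (1 + D * dU b).
    by rewrite E1; exact: (congr1 (fun Z : dmat B => tdet Z) VE).
  have e2 : tdet (U b ** at1 (FR e) ** U a) = tdet (1 + dU b * D).
    by rewrite E2; exact: d1.
  exact: (etrans e1 (etrans (esym (det_sylvester (dU b) sD)) (esym e2))).
have c2 : tdet_cvg (U b ** at1 (FR e) ** U a) by rewrite E2; exact: c1.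
split; [|exact: c2|exact: (eq_ind_r tdet_cvg c2 E3)|exact: dE|exact: (congr1 tdet (esym E3))].
rewrite E1; apply: det_defined_smooth.
by rewrite VE addrC addKr; exact: sDB.
Qed.

End Direction.

Lemma det_U_Ut u v : u * v = 1 -> smooth (dU a * dUt b u v - 1 : dmat B).
Proof.
move=> uv.
have -> : dU a * dUt b u v - 1 = dU a * (dUt b u v - dU b).
  by rewrite mulrBr -dUM ab dU1.
exact: smooth_mull (dmP (dU a)) (Ut_smooth b u v).
Qed.

(** The ratio of the two determinants is that of U~(a, 1) U~(a, w)^-1. On the nonzero
    integers this matrix is conjugate, by [L * dK a * D], to the commutator of
    U_H(a) with the diagonal matrix D = w 1_{H^-} + 1_{H^+}. *)
Lemma pi_tilde_factor :
  [/\ det_defined intsz (U a ** Utilde b (lX 1) (lX (-1))),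
      det_defined intsz (U a ** Utilde b 1 1),
      det_defined halfsz (UH b ** iminv setT DH ** UH a ** DH) &
      tdet (U a ** Utilde b (lX 1) (lX (-1))) =
      tdet (U a ** Utilde b 1 1) * tdet (UH b ** iminv setT DH ** UH a ** DH)].
Proof.
have ww' : lX 1 * lX (-1) = 1 :> B by exact: lXNr.
have [w Ew] : exists w : B, w = lX 1 by exists (lX 1).
have [w' Ew'] : exists w : B, w = lX (-1) by exists (lX (-1)).
have [L EL] : exists L : dmat B, L = dD (-1) 1 by exists (dD (-1) 1).
have [D ED] : exists D : dmat B, D = dD w 1 by exists (dD w 1).
have [D' ED'] : exists D : dmat B, D = dD w' 1 by exists (dD w' 1).
rewrite -Ew -Ew' in ww'.
have LL : L * L = 1 by rewrite EL dDM mulrNN !mulr1 dD1.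
have DD' : D * D' = 1 by rewrite ED ED' dDM ww' mulr1 dD1.
have D'D : D' * D = 1 by rewrite ED ED' dDM mulrC ww' mulr1 dD1.
have KK : dK a * dK b = 1 by rewrite dKM ab dK1.
have KK' : dK b * dK a = 1 by rewrite dKM ba dK1.
have [C EC] : exists C : dmat B, C = dK b * D' * dK a * D by eexists.
have [Q EQ] : exists Q : dmat B, Q = dUt a 1 1 * dUt b w w' by eexists.
have EC1 : C - 1 = dK b * (D' * dK a * D - dK a).
  by rewrite EC -KK'; exact: comm_sub.
have sC : smooth (C - 1 : dmat B).
  rewrite EC1; apply: smooth_mull (dmP (dK b)) _.
  have DKD : exists u v, D' * dK a * D = dUt a u v.
    by rewrite ED ED'; do 2 eexists; apply: Ut_conj; rewrite ?mulr1 // mulrC.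
  have [u [v ->]] := DKD.
  have -> : dUt a u v - dK a = (dUt a u v - dU a) - (dK a - dU a).
    by rewrite opprB addrA subrK.
  by apply: smoothB; exact: Ut_smooth.
have s1 : smooth (dU a * dUt b 1 1 - 1 : dmat B) by apply: det_U_Ut; rewrite mulr1.
have sw : smooth (dU a * dUt b w w' - 1 : dmat B) by exact: det_U_Ut.
have ext : extends (UH b ** iminv setT DH ** UH a ** DH) C.
  rewrite DH_inv DHE EC ED ED' Ew Ew'.
  apply: extendsM (extends_half_diag _); apply: extendsM (extends_UH a).
  exact: extendsM (extends_UH b) (extends_half_diag _).
have [dC eC] := extends_det ext sC.
have QE : Q = (L * dK a * D) * C * (D' * dK b * L).
  have -> : Q = L * dK a * L * (dD (- w) 1 * dK b * dD (- w') 1).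
    by rewrite EQ EL !dUt_dK ?mulr1.
  have -> : dD (- w) 1 = L * D by rewrite EL ED dDM mulN1r mulr1.
  have -> : dD (- w') 1 = D' * L by rewrite EL ED' dDM mulrN1 mulr1.
  by rewrite EC; exact: conj_commutator LL DD' KK.
have YX : (D' * dK b * L) * (L * dK a * D) = 1 by exact: three_inverse D'D KK' LL.
have XY : (L * dK a * D) * (D' * dK b * L) = 1 by exact: three_inverse LL KK DD'.
have sQ : smooth (Q - 1 : dmat B).
  rewrite QE -XY conj_sub1.
  exact: smooth_mulr (smooth_mull (dmP _) sC) (dmP _).
have QC : tdet Q = tdet C.
  have e1 : Q = 1 + (L * dK a * D) * (C - 1) * (D' * dK b * L).
    by rewrite -conj_sub1 XY -QE addrC subrK.
  have e2 : C = 1 + (C - 1) by rewrite addrC subrK.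
  rewrite e1 (det_conj sC YX) -e2 //.
have Uw : dU a * dUt b w w' = (1 + (dU a * dUt b 1 1 - 1)) * (1 + (Q - 1)).
  rewrite (addrC 1 (_ - 1)) subrK (addrC 1 (_ - 1)) subrK EQ.
  have UU : dUt b 1 1 * dUt a 1 1 = 1 by apply: dUtM; rewrite ?mulr1.
  exact/esym/cancel_middle.
have e0 : (dU a * dUt b 1 1 : dmat B) = 1 + (dU a * dUt b 1 1 - 1) by rewrite addrC subrK.
have e1 : Q = 1 + (Q - 1) by rewrite addrC subrK.
rewrite -Ew -Ew'.
split; [exact: det_defined_smooth sw|exact: det_defined_smooth s1|exact: dC|].
have H : tdet (dU a * dUt b w w') = tdet (dU a * dUt b 1 1) * tdet Q.
  by rewrite Uw (det_mul s1 sQ) -e0 -e1.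
rewrite eC -QC; exact: H.
Qed.

End Quantities.

Theorem proposition5p3 (R : realType) (A : completeStrongPolymetricType R)
    (a b : laurent A) (hab : a * b = 1) :
  [/\ toeplitz_invertible (U a),
      toeplitz_invertible (Utilde a (lX 1) (lX (-1))) &
      toeplitz_invertible (Utilde a 1 1)] /\
  [/\ [/\ det_defined intsz (pi_plus_mx a),
          tdet_cvg (U b ** at1 FRp ** U a),
          tdet_cvg (imone - imscale (lX 1) (U b ** imind Zneg ** U a ** U (lX (-1)))),
          pi_plus a = tdet (U b ** at1 FRp ** U a) &
          tdet (U b ** at1 FRp ** U a) =
          tdet (imone - imscale (lX 1) (U b ** imind Zneg ** U a ** U (lX (-1))))],
      [/\ det_defined intsz (pi_tilde_mx a),
          det_defined intsz (U a ** tinv (Utilde a 1 1)),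
          det_defined halfsz (UH b ** iminv setT DH ** UH a ** DH) &
          pi_tilde a = tdet (U a ** tinv (Utilde a 1 1)) *
                       tdet (UH b ** iminv setT DH ** UH a ** DH)] &
      [/\ det_defined intsz (pi_minus_mx a),
          tdet_cvg (U b ** at1 FRm ** U a),
          tdet_cvg (imone - imscale (lX (-1)) (U b ** imind Zpos ** U a ** U (lX 1))),
          pi_minus a = tdet (U b ** at1 FRm ** U a) &
          tdet (U b ** at1 FRm ** U a) =
          tdet (imone - imscale (lX (-1)) (U b ** imind Zpos ** U a ** U (lX 1)))]].
Proof.
have [iU tU] := tinv_U hab.
have [iw tw] := tinv_Ut hab (lXNr 1).
have [i1 t1] := tinv_Ut hab (mulr1 1).
split; first by split; [exists (U b)|exists (Utilde b (lX 1) (lX (-1)))|exists (Utilde b 1 1)].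
have := pi_direction hab (e := 1) (or_introl erefl).
have := pi_direction hab (e := -1) (or_intror erefl).
rewrite opprK -FRpE -FRmE -ZnegE -ZposE -tU => Hm Hp.
have Ht := pi_tilde_factor hab; rewrite -tw -t1 in Ht.
by split; [exact: Hp|exact: Ht|exact: Hm].
Qed.
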